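(* Let $m\ge1$, $q,q_i\in[1,\infty)$, $r_i\in(1,\infty)$, $\alpha_i\in(-n,nr_i/r_i')$, with $\sum_i\frac1{q_i}+\sum_i\frac1{r_i}=\frac1q$ and $\sum_i\frac{\alpha_i}{q_i}+\sum_i\frac{\alpha_i}{r_i}=\frac\alpha q$; let $\omega(x)=|x|_p^\alpha$, $\omega_i(x)=|x|_p^{\alpha_i}$. Let $\lambda_i\in(-\frac1{q_i},0)$ for all $i$, let $\lambda$ satisfy $(\alpha+n)\lambda=\sum_{i=1}^m(\alpha_i+n)\lambda_i$, assume condition (DK1), and assume $$\operatorname{supp}(\Phi)\subset\bigcap_{i=1}^m\{y\in\mathbb Q_p^n:\|A_i(y)\|_p<1\}.$$ Set $\mathcal C_8=\int_{\mathbb Q_p^n}\frac{\Phi(y)}{|y|_p^n}\prod_{i=1}^m\|A_i^{-1}(y)\|_p^{-(\alpha_i+n)\lambda_i}\big|\log_p\|A_i(y)\|_p\big|\,dy$. (i) If $\mathcal C_8<\infty$, then for every $\vec b=(b_1,\dots,b_m)$ with $b_i\in CMO^{r_i}_{\omega_i}(\mathbb Q_p^n)$, $\mathcal H^p_{\Phi,\vec A,\vec b}$ is bounded from $\dot B^{q_1,\lambda_1}_{\omega_1}(\mathbb Q_p^n)\times\cdots\times\dot B^{q_m,\lambda_m}_{\omega_m}(\mathbb Q_p^n)$ to $\dot B^{q,\lambda}_\omega(\mathbb Q_p^n)$, with norm at most $C\,\mathcal C_8\prod_i\|b_i\|_{CMO^{r_i}_{\omega_i}}$. (ii) Conversely,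 if $\mathcal H^p_{\Phi,\vec A,\vec b}$ is bounded between these spaces for every $\vec b\in CMO^{r_1}_{\omega_1}(\mathbb Q_p^n)\times\cdots\times CMO^{r_m}_{\omega_m}(\mathbb Q_p^n)$, then $\mathcal C_8<\infty$.
   Context: Let $p$ be a prime, $\mathbb Q_p$ the $p$-adic numbers with absolute value $|\cdot|_p$; for $x\in\mathbb Q_p^n$, $|x|_p=\max_j|x_j|_p$. $dx$ is the Haar measure on $\mathbb Q_p^n$ normalized so that $B_0$ has measure 1, $|E|$ the measure of $E$, $B_\gamma=\{x:|x|_p\le p^\gamma\}$. For an $n\times n$ matrix $A=(a_{ij})$ over $\mathbb Q_p$, $\|A\|_p=\max_{i,j}|a_{ij}|_p$; $r'$ is the conjugate exponent of $r$. For a weight $\omega$, $\omega(E)=\int_E\omega$. $CMO^q_\omega(\mathbb Q_p^n)$ ($1\le q<\infty$): $f$ locally in $L^q_\omega$ with $\|f\|_{CMO^q_\omega}=\sup_{\gamma}\big(\frac1{\omega(B_\gamma)}\int_{B_\gamma}|f-f_{B_\gamma}|^q\omega\big)^{1/q}<\infty$, $f_{B_\gamma}=\frac1{|B_\gamma|}\int_{B_\gamma}f$. Weighted central Morrey space $\dot B^{q,\lambda}_\omega(\mathbb Q_p^n)$ ($\lambda\in\mathbb R$, $1\le q<\infty$): $f$ locally in $L^q_\omega$ with $\|f\|_{\dot B^{q,\lambda}_\omega}=\sup_{\gamma\in\mathbb Z}\big(\omega(B_\gamma)^{-1-\lambda q}\int_{B_\gamma}|f|^q\omega\big)^{1/q}<\infty$.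 Let $\Phi:\mathbb Q_p^n\to[0,\infty)$ be measurable and $A_i(y)$ $n\times n$ matrices over $\mathbb Q_p$, measurable in $y$, invertible a.e. $\mathcal H^p_{\Phi,\vec A,\vec b}(\vec f)(x)=\int\frac{\Phi(y)}{|y|_p^n}\prod_{i=1}^m\big(b_i(x)-b_i(A_i(y)x)\big)\prod_{i=1}^m f_i(A_i(y)x)\,dy$. Condition (DK1): there is $\nu\in\mathbb N$ with $\|A_i(y)\|_p\|A_i^{-1}(y)\|_p\le p^\nu$ for all $i$ and a.e. $y$. *)

(* Defs.v *)
From HB Require Import structures.
From mathcomp Require Import all_boot all_order all_algebra.
From mathcomp Require Import all_classical all_reals all_analysis.
From mathcomp Require Import measurable_realfun.
Unset Printing Implicit Defensive.
Import Order.TTheory GRing.Theory Num.Theory numFieldNormedType.Exports.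
Local Open Scope classical_set_scope.
Local Open Scope ring_scope.

(* the base; equals p for every prime p (maxn only makes the type inhabited
   for all p) *)
Definition qp_base (p : nat) : nat := maxn p 2.

Definition qp_valid (p : nat) (a : int -> nat) : Prop :=
  (forall k, (a k < qp_base p)%N) /\ exists N : int, forall k, k < N -> a k = 0%N.

Definition Qp (p : nat) := {a : int -> nat | `[< qp_valid p a >]}.

Lemma qp_valid0 p : qp_valid p (fun _ => 0%N).
Proof. split=> [k|]; first by rewrite /qp_base leq_max orbT. by exists 0. Qed.

Lemma qp_valid1 p : qp_valid p (fun k => (k == 0)%N : nat).
Proof.
split=> [k|]; first by case: (k == 0) => /=; rewrite /qp_base leq_max orbT.
by exists 0 => k /lt_eqF ->.
Qed.

Definition qzero (p : nat) : Qp p :=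
  exist (fun a => `[< qp_valid p a >]) _ (asboolT (qp_valid0 p)).
Definition qone (p : nat) : Qp p :=
  exist (fun a => `[< qp_valid p a >]) _ (asboolT (qp_valid1 p)).

HB.instance Definition _ (p : nat) := Choice.on (Qp p).
HB.instance Definition _ (p : nat) := isPointed.Build (Qp p) (qzero p).

Definition qdig (p : nat) (x : Qp p) (k : int) : nat := proj1_sig x k.

Definition qmake (p : nat) (d : int -> nat) : Qp p :=
  match pselect (qp_valid p d) with
  | left h => exist (fun a => `[< qp_valid p a >]) d (asboolT h)
  | right _ => qzero p
  end.

Section QpArith.
Variable R : realType.
Variable p : nat.
Local Notation B := ((qp_base p)%:R : R).

(* truncation  T_k(x) = sum_{j < k} a_j p^j  (a finite sum) *)
Definition qtrunc (x : Qp p) (k : int) : R :=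
  \sum_(j \in [set j : int | j < k]) (qdig p x j)%:R * B ^ j.

Definition rmodp (y : R) (k : int) : R := y - B ^ k * (Num.floor (y / B ^ k))%:~R.

(* a binary ring operation on Q_p, determined through truncations:
   T_k(x op y) = lim_{K -> oo} (T_K x op T_K y  mod p^k)  (eventually constant) *)
Definition qbinop (op : R -> R -> R) (x y : Qp p) : Qp p :=
  let S (k : int) : R :=
    limn (fun K : nat => rmodp (op (qtrunc x K%:Z) (qtrunc y K%:Z)) k) in
  qmake p (fun j : int => absz (Num.floor ((S (j + 1) - S j) / B ^ j))).

Definition qadd : Qp p -> Qp p -> Qp p := qbinop +%R.
Definition qmul : Qp p -> Qp p -> Qp p := qbinop *%R.

(* p-adic absolute value |x|_p = p^{-v(x)} *)
Definition qabs (x : Qp p) : R :=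
  if pselect (exists k, qdig p x k != 0%N) is left _ then
    sup [set B ^ (- k) | k in [set k : int | qdig p x k != 0%N]]
  else 0.
End QpArith.

Definition QpV (p n : nat) := 'I_n -> Qp p.
HB.instance Definition _ (p n : nat) := Choice.on (QpV p n).
HB.instance Definition _ (p n : nat) :=
  isPointed.Build (QpV p n) (fun _ => qzero p).
Notation QpMx p n := ('I_n -> 'I_n -> Qp p).

Section QpVec.
Variable R : realType.
Variables p n : nat.

Definition qvadd (x y : QpV p n) : QpV p n := fun i => @qadd R p (x i) (y i).

Definition qmatvec (A : QpMx p n) (x : QpV p n) : QpV p n :=
  fun i => \big[@qadd R p/qzero p]_(j < n) @qmul R p (A i j) (x j).

Definition qmatmul (A B : QpMx p n) : QpMx p n :=
  fun i k => \big[@qadd R p/qzero p]_(j < n) @qmul R p (A i j) (B j k).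

Definition qidmx : QpMx p n := fun i j => if i == j then qone p else qzero p.

Definition qnormv (x : QpV p n) : R := \big[Num.max/0]_(j < n) @qabs R p (x j).
Definition qnormm (A : QpMx p n) : R :=
  \big[Num.max/0]_(i < n) \big[Num.max/0]_(j < n) @qabs R p (A i j).

Definition qball (g : int) : set (QpV p n) :=
  [set x | qnormv x <= (qp_base p)%:R ^ g].

Definition qtranslate (x : QpV p n) (E : set (QpV p n)) : set (QpV p n) :=
  [set qvadd x z | z in E].

(* the balls x + B_gamma generate the Borel sigma-algebra of Q_p^n *)
Definition qballs : set (set (QpV p n)) :=
  [set qtranslate x (qball g) | x in [set: QpV p n] & g in [set: int]].
End QpVec.


Notation QpSpace R p n := (g_sigma_algebraType (qballs R p n)).

Section Spaces.
Variable R : realType.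
Variables p n : nat.
Local Notation T := (QpSpace R p n).
Variable mu : {measure set T -> \bar R}.
Local Notation B g := (qball R p n g).

Definition qp_haar : Prop :=
  mu (qball R p n 0) = 1%E /\
  (forall (x : T) (E : set T), measurable E -> mu (qtranslate R p n x E) = mu E).

Definition qwt (alpha : R) (x : T) : R := powR (qnormv R p n x) alpha.

Definition qwmeas (alpha : R) (E : set T) : \bar R :=
  (\int[mu]_(x in E) (qwt alpha x)%:E)%E.

Definition qlocL (alpha q : R) (f : T -> \bar R) : Prop :=
  measurable_fun [set: T] f /\
  forall g : int,
    (\int[mu]_(x in B g) (poweR `|f x| q * (qwt alpha x)%:E) < +oo)%E.

Definition qmorrey_norm (alpha q lambda : R) (f : T -> \bar R) : \bar R :=
  ereal_sup [set poweR
      (poweR (qwmeas alpha (B g)) (- 1 - lambda * q) *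
       \int[mu]_(x in B g) (poweR `|f x| q * (qwt alpha x)%:E))%E q^-1
    | g in [set: int]].

Definition in_qmorrey (alpha q lambda : R) (f : T -> R) : Prop :=
  qlocL alpha q (EFin \o f) /\ (qmorrey_norm alpha q lambda (EFin \o f) < +oo)%E.

Definition qmean (f : T -> R) (g : int) : R :=
  fine (\int[mu]_(x in B g) (f x)%:E)%E / fine (mu (B g)).

Definition qcmo_norm (alpha r : R) (b : T -> R) : \bar R :=
  ereal_sup [set poweR
      ((fine (qwmeas alpha (B g)))^-1%:E *
       \int[mu]_(x in B g) (powR `|b x - qmean b g| r * qwt alpha x)%:E)%E r^-1
    | g in [set: int]].

Definition in_qcmo (alpha r : R) (b : T -> R) : Prop :=
  qlocL alpha r (EFin \o b) /\ (qcmo_norm alpha r b < +oo)%E.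

Definition qHop (m : nat) (Phi : T -> R) (A : 'I_m -> T -> QpMx p n)
    (b f : 'I_m -> T -> R) (x : T) : \bar R :=
  (\int[mu]_(y in [set: T])
     (Phi y / qnormv R p n y ^+ n *
      (\prod_(i < m) (b i x - b i (qmatvec R p n (A i y) x))) *
      (\prod_(i < m) f i (qmatvec R p n (A i y) x)))%:E)%E.

Definition qC8 (m : nat) (Phi : T -> R) (A Ainv : 'I_m -> T -> QpMx p n)
    (alpha lambda : 'I_m -> R) : \bar R :=
  (\int[mu]_(y in [set: T])
     (Phi y / qnormv R p n y ^+ n *
      \prod_(i < m) (powR (qnormm R p n (Ainv i y))
                          (- ((alpha i + n%:R) * lambda i)) *
                     `|ln (qnormm R p n (A i y)) / ln (qp_base p)%:R|))%:E)%E.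

End Spaces.
Arguments qp_haar {R p n} mu.
Arguments qwmeas {R p n} mu alpha E.
Arguments qlocL {R p n} mu alpha q f.
Arguments qmorrey_norm {R p n} mu alpha q lambda f.
Arguments in_qmorrey {R p n} mu alpha q lambda f.
Arguments qmean {R p n} mu f g.
Arguments qcmo_norm {R p n} mu alpha r b.
Arguments in_qcmo {R p n} mu alpha r b.
Arguments qHop {R p n} mu {m} Phi A b f x.
Arguments qC8 {R p n} mu {m} Phi A Ainv alpha lambda.

Definition rconj {R : realType} (r : R) : R := r / (r - 1).

Definition qp_hausdorff_data {R : realType} {p n m : nat}
    (mu : {measure set (QpSpace R p n) -> \bar R}) (nu : nat)
    (Phi : QpSpace R p n -> R) (A Ainv : 'I_m -> QpSpace R p n -> QpMx p n) : Prop :=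
  [/\ measurable_fun [set: QpSpace R p n] Phi /\ (forall y, 0 <= Phi y),
      (forall i j k,
        @measurable_fun _ _ (QpSpace R p n) (QpSpace R p 1) [set: QpSpace R p n]
          (fun y => (fun _ : 'I_1 => A i y j k) : QpV p 1) /\
        @measurable_fun _ _ (QpSpace R p n) (QpSpace R p 1) [set: QpSpace R p n]
          (fun y => (fun _ : 'I_1 => Ainv i y j k) : QpV p 1)),
      {ae mu, forall y, forall i,
          qmatmul R p n (A i y) (Ainv i y) = qidmx p n /\
          qmatmul R p n (Ainv i y) (A i y) = qidmx p n},
      {ae mu, forall y, forall i,
          qnormm R p n (A i y) * qnormm R p n (Ainv i y) <= (qp_base p)%:R ^+ nu} &
      (forall y, Phi y != 0 -> forall i, qnormm R p n (A i y) < 1)].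

(* Main.v *)
(* Write |A| for the norm of a matrix A, and v_i for the averages over balls with
   respect to |x|^(alpha_i) dx.

   Sufficiency.  The image of Haar measure under an invertible A is translation
   invariant, hence a multiple, at most |A^-1|^n, of Haar measure.  By (DK1) a
   v_i-average of g(A x) over a ball B is therefore at most a constant times the
   v_i-average of |g| over |A| B.  Central means of b_i over consecutive balls differ
   by at most C ||b_i||, since |x|^(alpha_i) is an A_(r_i) weight; telescoping over the
   |log_p |A_i(y)|| balls between B and |A_i(y)| B gives the logarithmic factor, which
   is at least 1 because |A_i(y)| < 1.  The Morrey condition on f_i gives the power of
   |A_i(y)^-1|, and the pieces are assembled by Hoelder's and Minkowski's inequalities.
   The latter are only needed up to constants: Hoelder's comes from
   prod t_j^(theta_j) <= sum t_j after normalization, Minkowski's from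
   F <= s^(1-q) F^q D^(1-q) + s D, optimized over s.  To normalize, each norm N is
   replaced by N + e with e -> 0.

   Necessity.  Take b_i(x) = log_p |x| and f_i(x) = |x|^((alpha_i+n) lambda_i).  As
   |A_i(y) x| <= |A_i(y)| |x| and the exponents are negative, (DK1) bounds the integrand
   of the operator at x from below by a positive function of x times that of C_8, so
   finiteness of the operator at a single x <> 0 suffices. *)
Require Import Defs.
From HB Require Import structures.
From mathcomp Require Import all_boot all_order all_algebra.
From mathcomp Require Import all_classical all_reals all_analysis.
From mathcomp Require Import measurable_realfun.
From mathcomp Require Import zify ring lra.
Set Implicit Arguments.
Unset Strict Implicit.
Unset Printing Implicit Defensive.
Import Order.TTheory GRing.Theory Num.Theory numFieldNormedType.Exports.
Local Open Scope classical_set_scope.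
Local Open Scope ring_scope.

Arguments qdig {p} x k.
Arguments qmake {p} d.
Arguments qtrunc R {p} x k.
Arguments rmodp {R} p y k.
Arguments qadd R {p} x y.
Arguments qmul R {p} x y.
Arguments qabs R {p} x.
Arguments qnormv R {p n} x.
Arguments qnormm R {p n} A.
Arguments qvadd R {p n} x y.
Arguments qmatvec R {p n} A x.
Arguments qmatmul R {p n} A B.
Arguments qidmx {p n}.
Arguments qball R {p n} g.
Arguments qtranslate R {p n} x E.

(** * Arithmetic of p-adic numbers *)

(** Elements of Q_p are digit sequences, and their operations are limits of truncations, so every
    p-adic fact is reduced to congruences modulo p^k between truncations, which are elements of
    Z[1/p] in [R]. In these terms |x| <= p^g says that the truncation of order [- g] vanishes, and a
    ball is a class of vectors with equal truncations. Truncations also carry the measurability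
    arguments, being real-valued with countably many values. The norm takes only the values 0 and
    p^k, so a radial integral is a sum over spheres; integrals of powers are geometric series,
    exactly homogeneous in the radius. Lower bounds on |A x| come from x = A^-1 (A x). The constant
    in (i) may depend on [nu] and the exponents only. Auxiliary constants are therefore fixed before
    the functions, the matrices and the ball, and estimates are kept in the form (bound)^q times the
    weighted mass of the ball. *)

Section Arithmetic.
Context {R : realType} {p : nat}.
Local Notation B := ((qp_base p)%:R : R).
Implicit Types (x y z : Qp p) (k j l : int).

Lemma base_gt1 : 1 < B.
Proof. by rewrite ltr1n /qp_base leq_max orbT. Qed.

Lemma base_gt0 : 0 < B.
Proof. exact: lt_trans base_gt1. Qed.

Lemma base_neq0 : B != 0.
Proof. by rewrite gt_eqF // base_gt0. Qed.

Lemma baseX_gt0 k : 0 < B ^ k.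
Proof. by rewrite exprz_gt0 // base_gt0. Qed.

Lemma baseX_neq0 k : B ^ k != 0.
Proof. by rewrite gt_eqF // baseX_gt0. Qed.

Lemma baseXD k l : B ^ (k + l) = B ^ k * B ^ l.
Proof. by rewrite exprzDr // unitfE base_neq0. Qed.

Lemma qdig_lt x k : (qdig x k < qp_base p)%N.
Proof. by case: x => a /= /asboolP[]. Qed.

Lemma qdig_bounded x : exists N : nat, forall k, k < - N%:Z -> qdig x k = 0%N.
Proof.
case: x => a /= aP; case/asboolP: (aP) => _ [N HN].
by exists `|N|%N => k kN; apply: HN; lia.
Qed.

Lemma qdig_inj x y : (forall k, qdig x k = qdig y k) -> x = y.
Proof.
case: x y => [a aP] [b bP] /= ab.
have e : a = b by apply/funext.
by subst b; congr exist; exact: Prop_irrelevance.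
Qed.

Lemma qdig_qmake d k : qp_valid p d -> qdig (qmake (p := p) d) k = d k.
Proof. by move=> dP; rewrite /qmake; case: pselect. Qed.

(** [multp k (a - b)] is congruence modulo p^k in Z[1/p]. A negative [k] is allowed and then bounds
    the denominator. *)
Definition multp k (a : R) := exists z : int, a = B ^ k * z%:~R.

Lemma multp0 k : multp k 0.
Proof. by exists 0; rewrite mulr0. Qed.

Lemma multpD k a b : multp k a -> multp k b -> multp k (a + b).
Proof. by move=> [z ->] [t ->]; exists (z + t); rewrite intrD mulrDr. Qed.

Lemma multpN k a : multp k a -> multp k (- a).
Proof. by move=> [z ->]; exists (- z); rewrite mulrNz mulrN. Qed.

Lemma multpC k a b : multp k (a - b) -> multp k (b - a).
Proof. by move=> /multpN; rewrite opprB. Qed.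

Lemma multp_trans k b a c : multp k (a - b) -> multp k (b - c) -> multp k (a - c).
Proof. by move=> h1 h2; rewrite -(subrKA b); exact: multpD. Qed.

Lemma multpM k l a b : multp k a -> multp l b -> multp (k + l) (a * b).
Proof.
by move=> [z ->] [t ->]; exists (z * t); rewrite baseXD intrM mulrACA.
Qed.

Lemma multpW k l a : k <= l -> multp l a -> multp k a.
Proof.
move=> kl [z ->]; have -> : l = k + `|l - k|%N by lia.
exists (((qp_base p) ^ `|l - k|)%N%:Z * z).
by rewrite baseXD intrM -exprnP mulrA -mulrzr -natrX.
Qed.

Lemma multp_small k a : multp k a -> `|a| < B ^ k -> a = 0.
Proof.
move=> [z ->]; rewrite normrM gtr0_norm ?baseX_gt0// gtr_pMr ?baseX_gt0//.
rewrite -intr_norm -[X in _ < X]/(1%:~R) ltr_int => z1.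
suff -> : z = 0 by rewrite mulr0.
lia.
Qed.

Local Notation T := (qtrunc R).

Lemma multp_eq k a b : multp k (a - b) -> 0 <= a < B ^ k -> 0 <= b < B ^ k -> a = b.
Proof.
move=> /multp_small ab /andP[a0 ak] /andP[b0 bk]; apply/eqP; rewrite -subr_eq0.
by rewrite ab // ltr_norml; apply/andP; split; lra.
Qed.

Lemma qtrunc_sum x (N : int) (s : nat) : (forall k, k < N -> qdig x k = 0%N) ->
  T x (N + s%:Z) = \sum_(0 <= i < s) (qdig x (N + i%:Z))%:R * B ^ (N + i%:Z).
Proof.
move=> x0; pose r := [seq N + i%:Z | i <- iota 0 s].
rewrite /qtrunc (fsbigE r); last first.
- move=> j /= jk; have [jN|Nj] := ltP j N; first by rewrite x0 // mul0r.
  move/mapP; elim; exists `|j - N|%N; last by lia.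
  by rewrite mem_iota; lia.
- by move=> j /= /mapP[i]; rewrite mem_iota => ? ->; lia.
- by rewrite map_inj_uniq ?iota_uniq// => i j; lia.
rewrite big_map /index_iota subn0 big_seq_cond [RHS]big_seq_cond.
apply: eq_bigl => i; rewrite andbT; apply: andb_idr.
by rewrite mem_iota inE /=; lia.
Qed.

Lemma qtrunc_eq0 x k : (forall j, j < k -> qdig x j = 0%N) -> T x k = 0.
Proof. by move=> x0; apply: fsbig1 => j /= /x0 ->; rewrite mul0r. Qed.

Lemma qtruncS x k : T x (k + 1) = T x k + (qdig x k)%:R * B ^ k.
Proof.
have [N x0] := qdig_bounded x.
have [kN|Nk] := ltP k (- N%:Z).
  by rewrite x0 // mul0r addr0 !qtrunc_eq0 // => j jk; apply: x0; lia.
have [s ->] : exists s : nat, k = - N%:Z + s%:Z.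
  by exists `|(k + N%:Z)%R|%N; lia.
have -> : - N%:Z + s%:Z + 1 = - N%:Z + s.+1%:Z by lia.
by rewrite !qtrunc_sum // big_nat_recr.
Qed.

(** Upward induction over all integers has a starting point because the digits vanish far to the
    left. *)
Lemma qtrunc_ind x (P : int -> Prop) :
  (forall k, T x k = 0 -> P k) -> (forall k, P k -> P (k + 1)) -> forall k, P k.
Proof.
move=> P0 PS k; have [N x0] := qdig_bounded x.
have T0 j : j <= - N%:Z -> P j.
  by move=> jN; apply: P0; apply: qtrunc_eq0 => i ij; apply: x0; lia.
have [/T0 //|Nk] := leP k (- N%:Z).
have -> : k = - N%:Z + `|(k + N%:Z)%R|%N by lia.
elim: `|_|%N => [|s Ps]; first by rewrite addr0; exact: T0.
by rewrite -addn1 PoszD addrA; exact: PS.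
Qed.

Lemma qtrunc_bound x k : 0 <= T x k < B ^ k.
Proof.
elim/(@qtrunc_ind x): k => [k ->|k /andP[T0 Tk]]; first by rewrite lexx baseX_gt0.
rewrite qtruncS; apply/andP; split.
  by rewrite addr_ge0 // mulr_ge0 // ltW // baseX_gt0.
rewrite baseXD expr1z; apply: (@lt_le_trans _ _ (B ^ k + (qdig x k)%:R * B ^ k)).
  by rewrite ltrD2r.
have -> : B ^ k + (qdig x k)%:R * B ^ k = B ^ k * (qdig x k).+1%:R.
  by rewrite -addn1 natrD; ring.
by rewrite ler_pM2l ?baseX_gt0 // ler_nat qdig_lt.
Qed.

Lemma qtrunc_mono x k l : k <= l -> multp k (T x l - T x k).
Proof.
move=> kl; have -> : l = k + `|l - k|%N by lia.
elim: `|_|%N => [|s]; first by rewrite addr0 subrr; exact: multp0.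
rewrite -addn1 PoszD addrA qtruncS => IH; rewrite addrAC.
apply: multpD => //; apply: (@multpW k (k + s)); first by lia.
by exists (qdig x (k + s)); rewrite mulrC.
Qed.

Lemma qtrunc_den x : exists N : nat, forall k, multp (- N%:Z) (T x k).
Proof.
have [N x0] := qdig_bounded x; exists N => k.
have T0 j : j <= - N%:Z -> T x j = 0.
  by move=> jN; apply: qtrunc_eq0 => i ij; apply: x0; lia.
have [/T0 ->|Nk] := leP k (- N%:Z); first exact: multp0.
by rewrite -[T x k]subr0 -(T0 (- N%:Z)) //; apply: qtrunc_mono; exact: ltW.
Qed.

(** Lower truncations are residues of the one of order [k], hence they agree too, and a digit is
    read off from two consecutive truncations. *)
Lemma qtrunc_agree x y k : (T x k = T y k) <-> (forall j, j < k -> qdig x j = qdig y j).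
Proof.
split=> [Txy j jk|xy]; last first.
  by apply: eq_fsbigr => j; rewrite inE /= => jk; rewrite xy.
have Teq i : i <= k -> T x i = T y i.
  move=> ik; apply: (@multp_eq i); rewrite ?qtrunc_bound //.
  apply: (@multp_trans i (T x k)); first by apply/multpC/qtrunc_mono.
  by rewrite Txy; exact: qtrunc_mono.
have := qtruncS x j; rewrite Teq; last by lia.
rewrite qtruncS Teq; last by lia.
by move=> /addrI /(mulIf (baseX_neq0 j)) /eqP; rewrite eqr_nat => /eqP.
Qed.

Lemma qtrunc_inj x y : (forall k, multp k (T x k - T y k)) -> x = y.
Proof.
move=> xy; apply: qdig_inj => k.
have /qtrunc_agree -> // : T x (k + 1) = T y (k + 1); last by lia.
by apply: (multp_eq (xy _)); exact: qtrunc_bound.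
Qed.

Lemma rmodp_multp a k : multp k (a - rmodp p a k).
Proof. by exists (Num.floor (a / B ^ k)); rewrite /rmodp subKr. Qed.

Lemma rmodp_bound a k : 0 <= rmodp p a k < B ^ k.
Proof.
have Bk := @baseX_gt0 k; have /andP[] := floor_itv (a / B ^ k).
rewrite ler_pdivlMr // ltr_pdivrMr // /rmodp intrD mulrDl mul1r => h1 h2.
by apply/andP; split; rewrite mulrC; lra.
Qed.

Lemma rmodp_eq a b k : multp k (a - b) -> rmodp p a k = rmodp p b k.
Proof.
move=> ab; apply: (@multp_eq k); rewrite ?rmodp_bound //.
apply: (@multp_trans _ a); first exact/multpC/rmodp_multp.
by apply: (multp_trans ab); exact: rmodp_multp.
Qed.

(** The construction inside [qbinop], for an arbitrary sequence: [qadd] and [qmul] are convertible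
    to a [qlim], so [represents_qlim] covers both, and negation as well. *)
Definition qlim (r : nat -> R) : Qp p :=
  let S (k : int) : R := limn (fun K : nat => rmodp p (r K) k) in
  qmake (fun j : int => absz (Num.floor ((S (j + 1) - S j) / B ^ j))).

Definition padic_cauchy (r : nat -> R) :=
  forall k, exists K0 : nat, forall K, (K0 <= K)%N -> multp k (r K - r K0).

(* [T x K] is the truncation of [x] modulo p^K, an element of Z[1/p]: the sequence [r]
   of elements of Z[1/p] converges p-adically to [x]. *)
Definition represents (r : nat -> R) x :=
  forall k, exists K0 : nat, forall K, (K0 <= K)%N -> multp k (r K - T x K%:Z).

Definition padic_bounded (r : nat -> R) :=
  exists N : nat, forall K, multp (- N%:Z) (r K).

Lemma limn_eventually (u : nat -> R) (a : R) (N : nat) :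
  (forall k : nat, (N <= k)%N -> u k = a) -> u @ \oo --> a.
Proof.
by move=> ua; apply: cvg_near_cst; exists N => // k /= /ua ->.
Qed.

Lemma cauchy_rmodp r k : padic_cauchy r -> exists a : R,
  [/\ (rmodp p (r K) k) @[K --> \oo] --> a, 0 <= a < B ^ k &
   exists K0 : nat, forall K, (K0 <= K)%N -> multp k (r K - a)].
Proof.
move=> /(_ k)[K0 rK]; exists (rmodp p (r K0) k); split.
- by apply: (@limn_eventually _ _ K0) => K /rK /rmodp_eq.
- exact: rmodp_bound.
- exists K0 => K /rK h; apply: (multp_trans h); exact: rmodp_multp.
Qed.

(** Bounded denominators make the residues [S k] vanish for very negative [k], and the Cauchy
    condition makes them compatible; the digits are the quotients of successive differences by p^j,
    and the truncations of the limit telescope back to [S]. *)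
Lemma represents_qlim r : padic_bounded r -> padic_cauchy r -> represents r (qlim r).
Proof.
move=> [N rN] rc; set S : int -> R := fun k => limn (fun K : nat => rmodp p (r K) k).
have SP k : 0 <= S k < B ^ k /\
    exists K0 : nat, forall K, (K0 <= K)%N -> multp k (r K - S k).
  have [a [ra abd [K0 aK]]] := cauchy_rmodp k rc.
  have -> : S k = a by exact: cvg_lim.
  by split=> //; exists K0.
have Smono k : multp k (S (k + 1) - S k).
  have [_ [K1 h1]] := SP k; have [_ [K2 h2]] := SP (k + 1).
  apply: (@multp_trans _ (r (maxn K1 K2))).
    apply: multpC; apply: (@multpW _ (k + 1)); first by lia.
    by apply: h2; rewrite leq_maxr.
  by apply: h1; rewrite leq_maxl.
have S0 k : k <= - N%:Z -> S k = 0.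
  move=> kN; have [h [K0 hK]] := SP k; apply: (@multp_eq k) => //; last first.
    by rewrite lexx baseX_gt0.
  apply: (@multp_trans _ (r K0)); first exact/multpC/hK.
  by rewrite subr0; apply: multpW (rN _).
pose d (j : int) := absz (Num.floor ((S (j + 1) - S j) / B ^ j)).
have dE j : S (j + 1) - S j = (d j)%:R * B ^ j.
  rewrite /d; have [z zE] := Smono j.
  rewrite zE mulrAC divff ?baseX_neq0 // mul1r intrKfloor mulrC; congr (_ * _).
  have [/andP[_ h1] _] := SP j; have [/andP[h2 _] _] := SP (j + 1).
  (* The quotient is an integer above -1, because [S (j + 1)] is nonnegative and [S j] is below p^j;
     so [absz] does not change it. *)
  have : - 1 < z%:~R :> R.
    rewrite -(ltr_pM2l (baseX_gt0 j)) -zE mulrN1; lra.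
  rewrite -[X in X < _]/((-1)%:~R) ltr_int => z0.
  have -> : z = `|z|%N by lia.
  by rewrite absz_nat.
have dP : qp_valid p d.
  split=> [j|]; last first.
    exists (- N%:Z) => j jN; rewrite /d !S0 ?subrr ?mul0r ?floor0 //; lia.
  have [/andP[h1 _] _] := SP j; have [/andP[_ h2] _] := SP (j + 1).
  rewrite -(ltr_nat R) -(ltr_pM2r (baseX_gt0 j)) -dE.
  by move: h2; rewrite baseXD expr1z [B ^ j * B]mulrC; lra.
have digE j : qdig (qlim r) j = d j by exact: qdig_qmake.
have TS k : T (qlim r) k = S k.
  have [kN|Nk] := leP k (- N%:Z).
    rewrite S0 // qtrunc_eq0 // => j jk.
    by rewrite digE /d !S0 ?subrr ?mul0r ?floor0 //; lia.
  have -> : k = - N%:Z + `|(k + N%:Z)%R|%N by lia.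
  elim: `|_|%N => [|s IH].
    rewrite addr0 S0 // qtrunc_eq0 // => j jk.
    by rewrite digE /d !S0 ?subrr ?mul0r ?floor0 //; lia.
  rewrite -addn1 PoszD addrA qtruncS IH digE -dE; ring.
(* [K] must also be at least [k]: only then is the truncation of order [K] congruent modulo p^k to
   the one of order [k]. *)
move=> k; have [_ [K0 h]] := SP k; exists (maxn K0 `|k|) => K.
rewrite geq_max => /andP[K0K kK].
apply: (multp_trans (h _ K0K)); rewrite -TS; apply: multpC; apply: qtrunc_mono; lia.
Qed.

Lemma represents_uniq r x y : represents r x -> represents r y -> x = y.
Proof.
move=> rx ry; apply: qtrunc_inj => k.
have [K1 h1] := rx k; have [K2 h2] := ry k.
pose K := maxn (maxn K1 K2) `|k|.
have kK : k <= K by rewrite /K; lia.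
apply: (@multp_trans _ (T x K)); first exact/multpC/qtrunc_mono.
apply: (@multp_trans _ (T y K)); last exact/qtrunc_mono.
apply: (@multp_trans _ (r K)); first by apply/multpC/h1; rewrite /K; lia.
by apply: h2; rewrite /K; lia.
Qed.

Lemma represents_qtrunc x : represents (fun K => T x K%:Z) x.
Proof. by move=> k; exists 0%N => K _; rewrite subrr; exact: multp0. Qed.

Lemma represents_bounded r x : represents r x ->
  exists N K0 : nat, forall K, (K0 <= K)%N -> multp (- N%:Z) (r K).
Proof.
move=> rx; have [N xN] := qtrunc_den x; have [K0 h] := rx (- N%:Z).
by exists N, K0 => K /h rK; rewrite -(subrK (T x K) (r K)); exact: multpD.
Qed.

Lemma represents_close r s x : represents s x ->
  (forall k, exists K0 : nat, forall K, (K0 <= K)%N -> multp k (r K - s K)) ->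
  represents r x.
Proof.
move=> sx rs k; have [K1 h1] := sx k; have [K2 h2] := rs k.
exists (maxn K1 K2) => K; rewrite geq_max => /andP[K1K K2K].
by apply: (multp_trans (h2 _ K2K)); exact: h1.
Qed.

Lemma represents_qadd x y : represents (fun K => T x K%:Z + T y K%:Z) (qadd R x y).
Proof.
apply: represents_qlim.
  have [N hN] := qtrunc_den x; have [M hM] := qtrunc_den y.
  exists (N + M)%N => K.
  by apply: multpD; [apply: multpW (hN _)|apply: multpW (hM _)]; lia.
move=> k; exists `|k|%N => K kK; rewrite opprD addrACA.
apply: multpD; (apply: (@multpW _ `|k|%N); first by lia);
  by apply: qtrunc_mono; lia.
Qed.

Lemma represents_qmul x y : represents (fun K => T x K%:Z * T y K%:Z) (qmul R x y).
Proof.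
have [N hN] := qtrunc_den x; have [M hM] := qtrunc_den y.
apply: represents_qlim.
  by exists (N + M)%N => K; apply: multpW (multpM (hN _) (hM _)); lia.
(* Each factor may have a denominator, p^N or p^M, which costs that much precision in the difference
   of the other factor. *)
move=> k; exists (`|k| + N + M)%N => K kK.
set L : nat := (`|k| + N + M)%N.
have -> : T x K * T y K - T x L * T y L = (T x K - T x L) * T y K + T x L * (T y K - T y L).
  ring.
apply: multpD.
- apply: (@multpW _ (L%:Z + - M%:Z)); first by rewrite /L; lia.
  by apply: multpM (hM _); apply: qtrunc_mono; lia.
- apply: (@multpW _ (- N%:Z + L%:Z)); first by rewrite /L; lia.
  by apply: multpM (hN _) _; apply: qtrunc_mono; lia.
Qed.

Lemma representsD r s x y : represents r x -> represents s y ->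
  represents (fun K => r K + s K) (qadd R x y).
Proof.
move=> rx sy; apply: (represents_close (represents_qadd x y)) => k.
have [K1 h1] := rx k; have [K2 h2] := sy k.
exists (maxn K1 K2) => K; rewrite geq_max => /andP[K1K K2K].
by rewrite opprD addrACA; apply: multpD; [exact: h1|exact: h2].
Qed.

Lemma representsM r s x y : represents r x -> represents s y ->
  represents (fun K => r K * s K) (qmul R x y).
Proof.
move=> rx sy; apply: (represents_close (represents_qmul x y)) => k.
have [N hN] := qtrunc_den x; have [M [K0 hM]] := represents_bounded sy.
have [K1 h1] := rx (k + M%:Z); have [K2 h2] := sy (k + N%:Z).
exists (maxn K0 (maxn K1 K2)) => K.
rewrite !geq_max => /andP[K0K /andP[K1K K2K]].
have -> : r K * s K - T x K * T y K = (r K - T x K) * s K + T x K * (s K - T y K).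
  ring.
apply: multpD.
- by apply: multpW (multpM (h1 _ K1K) (hM _ K0K)); lia.
- by apply: multpW (multpM (hN _) (h2 _ K2K)); lia.
Qed.

Lemma represents_qzero : represents (fun=> 0) (qzero p).
Proof.
by move=> k; exists 0%N => K _; rewrite qtrunc_eq0 // subrr; exact: multp0.
Qed.

Lemma represents_qone : represents (fun=> 1) (qone p).
Proof.
move=> k; exists 1%N => K K1; rewrite (_ : T _ _ = 1) ?subrr; first exact: multp0.
rewrite -[K%:Z]add0r qtrunc_sum; last by move=> j /lt_eqF /= ->.
case: K K1 => // K _; rewrite big_nat_recl //= big1 ?addr0; first by rewrite mul1r.
by move=> i _; rewrite add0r mul0r.
Qed.

(** Negated truncations are in general not truncations, as they leave the interval [0, p^k); [qlim]
    reduces them to digits. *)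
Definition qopp x := qlim (fun K => - T x K%:Z).

Lemma represents_qopp x : represents (fun K => - T x K%:Z) (qopp x).
Proof.
apply: represents_qlim.
  by have [N hN] := qtrunc_den x; exists N => K; exact: multpN.
move=> k; exists `|k|%N => K kK; rewrite -opprD; apply: multpN.
by apply: (@multpW _ `|k|%N); [lia|apply: qtrunc_mono].
Qed.

Lemma represents_inj r s x y : represents r x -> represents s y -> r =1 s -> x = y.
Proof. by move=> rx sy /funext rs; subst s; exact: represents_uniq rx sy. Qed.

Let rep := represents_qtrunc.
Let repD := representsD.
Let repM := representsM.

Lemma qaddC : commutative (@qadd R p).
Proof.
move=> x y; apply: (represents_inj (repD (rep x) (rep y)) (repD (rep y) (rep x))).
by move=> K /=; exact: addrC.
Qed.

Lemma qaddA : associative (@qadd R p).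
Proof.
move=> x y z; apply: (represents_inj (repD (rep x) (repD (rep y) (rep z)))
  (repD (repD (rep x) (rep y)) (rep z))).
by move=> K /=; exact: addrA.
Qed.

Lemma qadd0 : left_id (qzero p) (@qadd R p).
Proof.
move=> x; apply: (represents_inj (repD represents_qzero (rep x)) (rep x)).
by move=> K /=; exact: add0r.
Qed.

Lemma qaddN x : qadd R (qopp x) x = qzero p.
Proof.
apply: (represents_inj (repD (represents_qopp x) (rep x)) represents_qzero).
by move=> K /=; exact: addNr.
Qed.

Lemma qmulC : commutative (@qmul R p).
Proof.
move=> x y; apply: (represents_inj (repM (rep x) (rep y)) (repM (rep y) (rep x))).
by move=> K /=; exact: mulrC.
Qed.

Lemma qmulA : associative (@qmul R p).
Proof.
move=> x y z; apply: (represents_inj (repM (rep x) (repM (rep y) (rep z)))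
  (repM (repM (rep x) (rep y)) (rep z))).
by move=> K /=; exact: mulrA.
Qed.

Lemma qmul1 : left_id (qone p) (@qmul R p).
Proof.
move=> x; apply: (represents_inj (repM represents_qone (rep x)) (rep x)).
by move=> K /=; exact: mul1r.
Qed.

Lemma qmul0 : left_zero (qzero p) (@qmul R p).
Proof.
move=> x; apply: (represents_inj (repM represents_qzero (rep x)) represents_qzero).
by move=> K /=; exact: mul0r.
Qed.

Lemma qmulDl : left_distributive (@qmul R p) (@qadd R p).
Proof.
move=> x y z; apply: (represents_inj (repM (repD (rep x) (rep y)) (rep z))
  (repD (repM (rep x) (rep z)) (repM (rep y) (rep z)))).
by move=> K /=; exact: mulrDl.
Qed.

Lemma qmul0r : right_zero (qzero p) (@qmul R p).
Proof. by move=> x; rewrite qmulC qmul0. Qed.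

Lemma qmulDr : right_distributive (@qmul R p) (@qadd R p).
Proof. by move=> x y z; rewrite ![qmul R x _]qmulC qmulDl. Qed.

(** Equality may fail by the carry out of position k - 1, a multiple of p^k. *)
Lemma qtrunc_qadd x y k : multp k (T (qadd R x y) k - (T x k + T y k)).
Proof.
have [K0 h] := represents_qadd x y k.
pose K := maxn K0 `|k|; have kK : k <= K by rewrite /K; lia.
apply: (@multp_trans _ (T (qadd R x y) K)); first exact/multpC/qtrunc_mono.
apply: (@multp_trans _ (T x K + T y K)).
  by apply/multpC/h; rewrite leq_maxl.
by rewrite opprD addrACA; apply: multpD; exact: qtrunc_mono.
Qed.

Lemma multp_qtrunc x k l : T x k = 0 -> multp k (T x l).
Proof.
move=> x0; have [kl|lk] := leP k l; first by rewrite -[T x l]subr0 -x0; exact: qtrunc_mono.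
have /qtrunc_agree xE : T x k = T (qzero p) k by rewrite x0 qtrunc_eq0.
rewrite (@qtrunc_eq0 x) => [|j jl]; first exact: multp0.
by rewrite xE //; lia.
Qed.

Lemma qtrunc_qmul_eq0 x y k l : T x k = 0 -> T y l = 0 -> T (qmul R x y) (k + l) = 0.
Proof.
move=> x0 y0; have [K0 h] := represents_qmul x y (k + l).
pose K := maxn K0 `|(k + l)%R|; have kK : k + l <= K by rewrite /K; lia.
apply: (@multp_eq (k + l)); rewrite ?qtrunc_bound ?lexx ?baseX_gt0 //.
apply: (@multp_trans _ (T (qmul R x y) K)); first exact/multpC/qtrunc_mono.
apply: (@multp_trans _ (T x K * T y K)); first by apply/multpC/h; rewrite leq_maxl.
by rewrite subr0; apply: multpM; exact: multp_qtrunc.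
Qed.

Lemma qtrunc_eq0P x k : T x k = 0 <-> (forall j, j < k -> qdig x j = 0%N).
Proof.
split; last exact: qtrunc_eq0.
by move=> x0; apply/(@qtrunc_agree x (qzero p)); rewrite x0 qtrunc_eq0.
Qed.

(** The supremum in [qabs] is attained at the lowest nonzero digit, which exists because the digits
    vanish far to the left. *)
Lemma qabs_cases x : (x = qzero p /\ qabs R x = 0) \/
  exists k, [/\ qdig x k != 0%N, forall j, j < k -> qdig x j = 0%N & qabs R x = B ^ (- k)].
Proof.
rewrite /qabs; case: pselect => [[k0 xk0]|x0]; last first.
  left; split=> //; apply: qdig_inj => k /=; apply/eqP/negP => /negP xk.
  by apply: x0; exists k.
right; have [N x0] := qdig_bounded x.
have ex : exists s : nat, qdig x (- N%:Z + s%:Z) != 0%N.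
  exists `|(k0 + N%:Z)%R|%N; have [k0N|Nk0] := ltP k0 (- N%:Z).
    by rewrite x0 in xk0.
  by rewrite (_ : - N%:Z + _ = k0); last by lia.
case: (ex_minnP ex) => s xs smin; exists (- N%:Z + s%:Z).
have below j : j < - N%:Z + s%:Z -> qdig x j = 0%N.
  move=> js; have [jN|Nj] := ltP j (- N%:Z); first exact: x0.
  apply/eqP/negP => /negP xj.
  have := smin `|(j + N%:Z)%R|%N; rewrite (_ : - N%:Z + _ = j); last by lia.
  by move=> /(_ xj); lia.
split=> //; apply/eqP; rewrite eq_le; apply/andP; split.
  apply: ge_sup; first by exists (B ^ (- k0)), k0.
  move=> _ [k /= xk <-]; rewrite ler_eXz2l ?base_gt1 // lerN2 leNgt.
  by apply/negP => /below /eqP; apply/negP.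
apply: ub_le_sup; last by exists (- N%:Z + s%:Z).
exists (B ^ N%:Z) => _ [k /= xk <-]; rewrite ler_eXz2l ?base_gt1 //.
rewrite leNgt; apply/negP => kN; move: xk; rewrite x0 //; lia.
Qed.

Lemma qabs_ge0 x : 0 <= qabs R x.
Proof.
by have [[_ ->]|[k [_ _ ->]]] := qabs_cases x; rewrite ?lexx // ltW // baseX_gt0.
Qed.

Lemma qabs_le x g : (qabs R x <= B ^ g) <-> T x (- g) = 0.
Proof.
have [[-> ->]|[k [xk x0 ->]]] := qabs_cases x.
  by rewrite qtrunc_eq0 //; split=> // _; rewrite ltW // baseX_gt0.
rewrite ler_eXz2l ?base_gt1 // qtrunc_eq0P; split=> [gk j jk|xg].
  by apply: x0; lia.
by rewrite leNgt; apply/negP => kg; move: xk; rewrite xg //; lia.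
Qed.

Lemma qabs_eq0 x : qabs R x = 0 <-> x = qzero p.
Proof.
have [[-> ->]|[k [xk x0 ->]]] := qabs_cases x; first by [].
split=> [/eqP|xz]; first by rewrite (negbTE (baseX_neq0 _)).
by move: xk; rewrite xz.
Qed.

Lemma qabs_qzero : qabs R (qzero p) = 0. Proof. exact/qabs_eq0. Qed.

Lemma qabs_qadd_le x y g : qabs R x <= B ^ g -> qabs R y <= B ^ g ->
  qabs R (qadd R x y) <= B ^ g.
Proof.
move=> /qabs_le x0 /qabs_le y0; apply/qabs_le.
apply: (@multp_eq (- g)); rewrite ?qtrunc_bound ?lexx ?baseX_gt0 //.
by have := qtrunc_qadd x y (- g); rewrite x0 y0 addr0.
Qed.

Lemma qabs_qmul x y : qabs R (qmul R x y) <= qabs R x * qabs R y.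
Proof.
have [[-> ->]|[k [_ x0 ->]]] := qabs_cases x; first by rewrite qmul0 mul0r qabs_qzero.
have [[-> ->]|[l [_ y0 ->]]] := qabs_cases y; first by rewrite qmul0r mulr0 qabs_qzero.
rewrite -baseXD; apply/qabs_le; rewrite -opprD opprK.
by apply: qtrunc_qmul_eq0; apply/qtrunc_eq0P.
Qed.

End Arithmetic.
Arguments qopp R {p} x.

(* Conversion would otherwise unfold the digitwise limits. *)
Opaque qadd qmul qabs.

(** With these laws [big_split], [exchange_big] and [big_distrl] apply to the sums that define
    matrix products. *)
HB.instance Definition _ (R : realType) (p : nat) :=
  Monoid.isComLaw.Build (Qp p) (qzero p) (@qadd R p) qaddA qaddC qadd0.
HB.instance Definition _ (R : realType) (p : nat) :=
  Monoid.isMulLaw.Build (Qp p) (qzero p) (@qmul R p) qmul0 qmul0r.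
HB.instance Definition _ (R : realType) (p : nat) :=
  Monoid.isAddLaw.Build (Qp p) (@qmul R p) (@qadd R p) qmulDl qmulDr.

(** * Vectors, matrices and balls *)

Section Vectors.
Context {R : realType} {p n : nat}.
Local Notation B := ((qp_base p)%:R : R).
Local Notation T := (qtrunc R).
Implicit Types (x y z : QpV p n) (A : QpMx p n) (g k : int).

Definition qv0 : QpV p n := fun=> qzero p.
Definition qvopp x : QpV p n := fun i => qopp R (x i).

Lemma qvaddC x y : qvadd R x y = qvadd R y x.
Proof. by apply/funext => i; exact: qaddC. Qed.

Lemma qvaddA x y z : qvadd R x (qvadd R y z) = qvadd R (qvadd R x y) z.
Proof. by apply/funext => i; exact: qaddA. Qed.

Lemma qvadd0 x : qvadd R qv0 x = x.
Proof. by apply/funext => i; exact: qadd0. Qed.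

Lemma qvaddN x : qvadd R (qvopp x) x = qv0.
Proof. by apply/funext => i; exact: qaddN. Qed.

Lemma qvaddKN x y : qvadd R (qvopp x) (qvadd R x y) = y.
Proof. by rewrite qvaddA qvaddN qvadd0. Qed.

Lemma qvaddNK x y : qvadd R x (qvadd R (qvopp x) y) = y.
Proof. by rewrite qvaddA [qvadd R x _]qvaddC qvaddN qvadd0. Qed.

Lemma qmatvecD A x y : qmatvec R A (qvadd R x y) = qvadd R (qmatvec R A x) (qmatvec R A y).
Proof.
apply/funext => i; rewrite /qvadd /qmatvec -big_split /=.
by apply: eq_bigr => j _; rewrite qmulDr.
Qed.

Lemma qmatvecM A C x : qmatvec R (qmatmul R A C) x = qmatvec R A (qmatvec R C x).
Proof.
apply/funext => i; rewrite /qmatvec /qmatmul.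
under eq_bigr do rewrite big_distrl /=.
rewrite exchange_big /=; apply: eq_bigr => j _; rewrite big_distrr /=.
by apply: eq_bigr => k _; rewrite qmulA.
Qed.

Lemma qmatvec1 x : qmatvec R qidmx x = x.
Proof.
apply/funext => i; rewrite /qmatvec (bigD1 i isT) /= {1}/qidmx eqxx qmul1 qaddC.
rewrite big1 ?qadd0 // => j /negbTE ij.
by rewrite /qidmx eq_sym ij qmul0.
Qed.

Lemma qmatvec0 A : qmatvec R A qv0 = qv0.
Proof. by apply/funext => i; rewrite /qmatvec big1 // => j _; rewrite qmul0r. Qed.

Lemma maxr_big_le (I : finType) (F : I -> R) (c : R) :
  0 <= c -> (\big[Num.max/0]_i F i <= c) <-> (forall i, F i <= c).
Proof.
move=> c0; split=> [h i|h]; last by elim/big_ind: _ => // a b ac bc; rewrite ge_max ac.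
by apply: le_trans h; rewrite (bigD1 i) //= le_max lexx.
Qed.

Lemma maxr_big_cases (I : finType) (F : I -> R) (P : R -> Prop) :
  P 0 -> (forall i, P (F i)) -> P (\big[Num.max/0]_i F i).
Proof. by move=> P0 PF; elim/big_ind: _ => // a b Pa Pb; rewrite maxEle; case: ifP. Qed.

Lemma qnormv_le x (c : R) : 0 <= c -> (qnormv R x <= c) <-> (forall i, qabs R (x i) <= c).
Proof. exact: maxr_big_le. Qed.

Lemma qnormm_le A (c : R) : 0 <= c ->
  (qnormm R A <= c) <-> (forall i j, qabs R (A i j) <= c).
Proof.
by move=> c0; rewrite maxr_big_le //; split=> h i; [apply/maxr_big_le|apply/maxr_big_le].
Qed.

Lemma qnormv_ge0 x : 0 <= qnormv R x.
Proof. by apply: (@maxr_big_cases _ _ (fun a => 0 <= a)) => // i; exact: qabs_ge0. Qed.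

Lemma qnormm_ge0 A : 0 <= qnormm R A.
Proof.
by do 2!apply: (@maxr_big_cases _ _ (fun a => 0 <= a)) => // ?; exact: qabs_ge0.
Qed.

Lemma qabs_le_qnormv x i : qabs R (x i) <= qnormv R x.
Proof. by have /qnormv_le := lexx (qnormv R x); apply; exact: qnormv_ge0. Qed.

Lemma qabs_le_qnormm A i j : qabs R (A i j) <= qnormm R A.
Proof. by have /qnormm_le := lexx (qnormm R A); apply; exact: qnormm_ge0. Qed.

Let power_or0 (a : R) := a = 0 \/ exists k, a = B ^ k.

Let qabs_power_or0 (a : Qp p) : power_or0 (qabs R a).
Proof.
by have [[_ ->]|[k [_ _ ->]]] := @qabs_cases R p a; [left|right; exists (- k)].
Qed.

Lemma qnormm_cases A : qnormm R A = 0 \/ exists k, qnormm R A = B ^ k.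
Proof.
apply: (@maxr_big_cases _ _ power_or0) => [|i]; first by left.
by apply: (@maxr_big_cases _ _ power_or0) => [|j]; first by left.
Qed.

Lemma qnormv_cases x : qnormv R x = 0 \/ exists k, qnormv R x = B ^ k.
Proof. by apply: (@maxr_big_cases _ _ power_or0) => [|i]; first by left. Qed.

Lemma qnormv_eq0 x : qnormv R x = 0 <-> x = qv0.
Proof.
split=> [x0|->]; last first.
  by apply: (@maxr_big_cases _ _ (fun a => a = 0)) => // i; exact: qabs_qzero.
apply/funext => i; apply/(@qabs_eq0 R); apply/eqP.
by rewrite eq_le qabs_ge0 andbT -x0 qabs_le_qnormv.
Qed.

Lemma qnormv0 : qnormv R qv0 = 0. Proof. exact/qnormv_eq0. Qed.

Lemma qnormv_gt0 x : x <> qv0 -> 0 < qnormv R x.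
Proof. by move=> x0; rewrite lt0r qnormv_ge0 andbT; apply/eqP => /qnormv_eq0. Qed.

Lemma qnormv_powE x : x <> qv0 -> exists k, qnormv R x = B ^ k.
Proof. by move=> x0; have [/qnormv_eq0|] := qnormv_cases x. Qed.

Lemma qnormv_matvec A x : qnormv R (qmatvec R A x) <= qnormm R A * qnormv R x.
Proof.
have Ax0 : 0 <= qnormm R A * qnormv R x by rewrite mulr_ge0 ?qnormm_ge0 ?qnormv_ge0.
apply/qnormv_le => // i; rewrite /qmatvec.
have le j : qabs R (qmul R (A i j) (x j)) <= qnormm R A * qnormv R x.
  apply: (le_trans (qabs_qmul _ _)).
  by apply: ler_pM; rewrite ?qabs_ge0 ?qabs_le_qnormv ?qabs_le_qnormm.
(* The ultrametric inequality [qabs_qadd_le] is stated for bounds that are powers of the base, so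
   the product of norms is first shown to be 0 or such a power. *)
have [e|[k e]] : power_or0 (qnormm R A * qnormv R x).
- have [->|[k ->]] := qnormm_cases A; first by rewrite mul0r; left.
  have [->|[l ->]] := qnormv_cases x; first by rewrite mulr0; left.
  by rewrite -baseXD; right; exists (k + l).
- rewrite big1 ?qabs_qzero // => j _; apply/(@qabs_eq0 R)/eqP.
  by rewrite eq_le qabs_ge0 andbT -e.
- rewrite e in le *; apply: (@big_ind _ (fun a => qabs R a <= B ^ k)) => //.
    by rewrite qabs_qzero ltW // baseX_gt0.
  by move=> a b; exact: qabs_qadd_le.
Qed.

Lemma qballE g : qball R g = [set z : QpV p n | forall i, T (z i) (- g) = 0].
Proof.
apply/seteqP; split=> z /=; rewrite /qball /= qnormv_le ?(ltW (baseX_gt0 g)) // => h i.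
  exact/qabs_le.
exact/qabs_le.
Qed.

(** Adding an element whose truncation of order [- g] vanishes does not change the residue modulo
    p^(-g), and the truncation is the only representative of that residue in its range. *)
Lemma qtranslateE x g :
  qtranslate R x (qball R g) = [set z : QpV p n | forall i, T (z i) (- g) = T (x i) (- g)].
Proof.
apply/seteqP; split=> [_ [w + <-] i|z /= xz].
  rewrite qballE => /= w0; apply: (@multp_eq _ p (- g)); rewrite ?qtrunc_bound //.
  by have := @qtrunc_qadd R p (x i) (w i) (- g); rewrite w0 addr0.
exists (qvadd R (qvopp x) z); last by rewrite qvaddNK.
rewrite qballE /= => i; apply: (@multp_eq _ p (- g)).
- apply: (multp_trans (qtrunc_qadd _ _ _)); rewrite xz subr0.
  have := @qtrunc_qadd R p (qopp R (x i)) (x i) (- g).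
  by rewrite (@qaddN R p) qtrunc_eq0 // sub0r => /multpN; rewrite opprK.
- exact: qtrunc_bound.
- by rewrite lexx baseX_gt0.
Qed.

End Vectors.
Arguments qvopp R {p n} x.

(** * Measurability *)

Section Measurability.
Context {R : realType} {p : nat}.
Local Notation B := ((qp_base p)%:R : R).

(** Measurability tested on real-valued truncations; [qmeasurableP] and [qmeasurable_coord] tie it
    to the sigma-algebra generated by the balls. *)
Definition qmeasurable d (X : measurableType d) (u : X -> Qp p) :=
  forall k, measurable_fun [set: X] (fun y => qtrunc R (u y) k).

Lemma measurable_rmodp k : measurable_fun [set: R] (fun a : R => rmodp p a k).
Proof.
apply: measurable_funB => //; apply: measurable_funM => //.
apply: (@measurableT_comp _ _ _ _ _ _ (fun a : R => (Num.floor a)%:~R : R)).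
  apply: nondecreasing_measurable => // a b ab.
  by rewrite ler_int; exact: le_floor.
by apply: measurable_funM.
Qed.

Section Operations.
Context d (X : measurableType d).
Implicit Types u v : X -> Qp p.

Lemma qmeasurable_cst a : qmeasurable (fun _ : X => a).
Proof. by move=> k; exact: measurable_cst. Qed.

Lemma qmeasurable_add u v : qmeasurable u -> qmeasurable v ->
  qmeasurable (fun y => qadd R (u y) (v y)).
Proof.
move=> mu mv k; pose f y := qtrunc R (u y) k + qtrunc R (v y) k.
have -> : (fun y => qtrunc R (qadd R (u y) (v y)) k) = (fun a => rmodp p a k) \o f.
  apply/funext => y /=; apply: (@multp_eq _ p k).
  - by apply: (multp_trans (qtrunc_qadd _ _ _)); exact: rmodp_multp.
  - exact: qtrunc_bound.
  - exact: rmodp_bound.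
apply: measurableT_comp; first exact: measurable_rmodp.
exact: measurable_funD.
Qed.

(** When the factors have denominators, the residue of the product modulo p^k depends on truncations
    of order above [k]; it is reached as an eventually constant limit in [K]. *)
Lemma qmeasurable_mul u v : qmeasurable u -> qmeasurable v ->
  qmeasurable (fun y => qmul R (u y) (v y)).
Proof.
move=> mu mv k.
pose f (K : nat) y := rmodp p (qtrunc R (u y) K%:Z * qtrunc R (v y) K%:Z) k.
apply: (@measurable_fun_cvg _ _ _ _ f) => [K|y _].
  apply: (@measurableT_comp _ _ _ _ _ _ (fun a => rmodp p a k)).
    exact: measurable_rmodp.
  exact: measurable_funM.
have [K0 hK] := @represents_qmul R p (u y) (v y) k.
apply: (@limn_eventually _ _ _ (maxn K0 `|k|)) => K.
rewrite geq_max => /andP[K0K kK].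
apply: (@multp_eq _ p k); rewrite ?rmodp_bound ?qtrunc_bound //.
apply: (multp_trans (multpC (rmodp_multp _ _))).
by apply: (multp_trans (hK _ K0K)); apply: qtrunc_mono; lia.
Qed.

Lemma qmeasurable_sum (I : Type) (r : seq I) (u : I -> X -> Qp p) :
  (forall i, qmeasurable (u i)) ->
  qmeasurable (fun y => \big[@qadd R p/qzero p]_(i <- r) u i y).
Proof.
move=> mu; elim: r => [|i r IH].
  by under eq_fun do rewrite big_nil; exact: qmeasurable_cst.
by under eq_fun do rewrite big_cons; exact: qmeasurable_add.
Qed.

Lemma qmeasurable_matvec n (M : X -> QpMx p n) (v : X -> QpV p n) :
  (forall i j, qmeasurable (fun y => M y i j)) ->
  (forall i, qmeasurable (fun y => v y i)) ->
  forall i, qmeasurable (fun y => qmatvec R (M y) (v y) i).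
Proof. by move=> mM mv i; apply: qmeasurable_sum => j; exact: qmeasurable_mul. Qed.

(** A ball is cut out by the truncations of the coordinates at one order, so its preimage is a
    finite intersection of level sets. *)
Lemma qmeasurableP n (f : X -> QpSpace R p n) :
  (forall i, qmeasurable (fun y => (f y : QpV p n) i)) -> measurable_fun [set: X] f.
Proof.
move=> mf; apply: (@measurability _ _ _ _ setT f (qballs R p n)) => //.
move=> _ [_ [x _ [g _ <-]] <-]; rewrite setTI qtranslateE.
rewrite (_ : _ @^-1` _ = \bigcap_(i in [set: 'I_n])
    [set y | qtrunc R ((f y : QpV p n) i) (- g) = qtrunc R (x i) (- g)]); last first.
  by apply/seteqP; split=> y /= h i; [move=> _; exact: h|exact: h].
apply: fin_bigcap_measurable => // i _.
by rewrite -[X in measurable X]setTI; exact: (mf i (- g) measurableT _ (measurable_set1 _)).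
Qed.

End Operations.

Section Space.
Context {n : nat}.
Local Notation T := (QpSpace R p n).

Lemma measurable_qtranslate_ball (x : T) g : measurable (qtranslate R x (qball R g) : set T).
Proof. by apply: sub_sigma_algebra; exists x => //; exists g. Qed.

Lemma measurable_trunc_class (x : T) k :
  measurable ([set z : T | forall i, qtrunc R (z i) k = qtrunc R (x i) k]).
Proof. by have := measurable_qtranslate_ball x (- k); rewrite qtranslateE opprK. Qed.

(* Truncations of a fixed order take countably many values. *)
Lemma measurable_locally_constant (E : set T) k :
  (forall x y : T, (forall i, qtrunc R (x i) k = qtrunc R (y i) k) -> E x -> E y) ->
  measurable E.
Proof.
(* A truncation is coded by a numerator and an exponent of the denominator. There are countably many
   families of codes, and each nonempty piece [F c] is a ball. *)
move=> Ek; pose dec (c : {ffun 'I_n -> int * nat}) i : R := B ^ (- (c i).2%:Z) * (c i).1%:~R.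
pose F c := [set x : T | E x /\ forall i, qtrunc R (x i) k = dec c i].
have -> : E = \bigcup_(c in setT) F c.
  apply/seteqP; split=> [x Ex|x [c _ []]//].
  have /choice[c cP] i : exists c : int * nat, qtrunc R (x i) k = B ^ (- c.2%:Z) * c.1%:~R.
    by have [N /(_ k)[z e]] := @qtrunc_den R p (x i); exists (z, N).
  by exists (finfun c) => //; split=> // i; rewrite /dec ffunE.
apply: countable_bigcupT_measurable => [|c]; first exact: countableP.
have [->|/set0P[x0 [Ex0 x0c]]] := eqVneq (F c) set0; first exact: measurable0.
rewrite (_ : F c = [set z : T | forall i, qtrunc R (z i) k = qtrunc R (x0 i) k]).
  exact: measurable_trunc_class.
apply/seteqP; split=> [x [Ex xc] i|x /= x0x]; first by rewrite xc x0c.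
by split=> [|i]; [apply: (Ek x0) => // i; rewrite x0x|rewrite x0x x0c].
Qed.

Lemma qmeasurable_coord i : qmeasurable (fun x : T => x i).
Proof.
move=> k _ U mU; rewrite setTI; apply: (@measurable_locally_constant _ k) => x y xy.
by rewrite /= xy.
Qed.

Lemma measurable_qball g : measurable (qball R g : set T).
Proof.
apply: (@measurable_locally_constant (qball R g) (- g)) => x y xy.
by rewrite qballE /= => x0 i; rewrite -xy.
Qed.

Lemma measurable_qv0 : measurable ([set qv0] : set T).
Proof.
rewrite (_ : [set qv0] = \bigcap_(k in [set: nat]) (qball R (- k%:Z) : set T)).
  by apply: bigcapT_measurable => k; exact: measurable_qball.
apply/seteqP; split=> [_ -> k _|x x0].
  by rewrite /qball /= qnormv0 ltW // baseX_gt0.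
apply/funext => i; apply: qdig_inj => j.
have := x0 `|(j + 1)%R|%N I; rewrite qballE /= opprK => /(_ i) /qtrunc_eq0P -> //.
by lia.
Qed.

Definition qsphere g : set T := [set x | qnormv R x = B ^ g].

Lemma qsphereE g : qsphere g = qball R g `\` qball R (g - 1).
Proof.
apply/seteqP; split=> x; rewrite /qsphere /qball /=.
  by move=> ->; split=> //; apply/negP; rewrite -ltNge ltr_eXz2l ?base_gt1 //; lia.
move=> [xg /negP]; rewrite -ltNge => gx.
have [x0|[k xk]] := @qnormv_cases R p n x; first by move: gx; rewrite x0 lt_neqAle leNgt baseX_gt0 andbF.
move: xg gx; rewrite xk ler_eXz2l ?base_gt1 // ltr_eXz2l ?base_gt1 // => ? ?.
by congr (_ ^ _); lia.
Qed.

Lemma measurable_qsphere g : measurable (qsphere g).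
Proof. by rewrite qsphereE; apply: measurableD; exact: measurable_qball. Qed.

(* The norm takes countably many values, so no regularity of [h] is needed. *)
Lemma measurable_radial d (Y : measurableType d) (h : R -> Y) :
  measurable_fun [set: T] (fun x => h (qnormv R x)).
Proof.
move=> _ U mU; rewrite setTI.
rewrite (_ : _ @^-1` U = (if `[< U (h 0) >] then [set qv0] else set0) `|`
    \bigcup_(k in [set: int]) (if `[< U (h (B ^ k)) >] then qsphere k else set0)).
  apply: measurableU; first by case: ifP => _; [exact: measurable_qv0|exact: measurable0].
  apply: countable_bigcupT_measurable => [|k]; first exact: countableP.
  by case: ifP => _; [exact: measurable_qsphere|exact: measurable0].
apply/seteqP; split=> x /=.
  move=> Ux; have [x0|[k xk]] := @qnormv_cases R p n x.
    left; rewrite asboolT; last by rewrite -x0.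
    exact/(@qnormv_eq0 R).
  by right; exists k => //; rewrite -xk asboolT.
move=> [|[k _]]; case: asboolP => // Uk; first by move=> ->; rewrite qnormv0.
by rewrite /qsphere /= => ->.
Qed.

Lemma measurable_qnormv : measurable_fun [set: T] (qnormv R : T -> R).
Proof. exact: (measurable_radial id). Qed.

End Space.

Lemma qmeasurable_comp d (X : measurableType d) (u : X -> Qp p) :
  @measurable_fun _ _ X (QpSpace R p 1) [set: X] (fun y => (fun=> u y) : QpV p 1) ->
  qmeasurable u.
Proof.
move=> mu k; have := measurableT_comp (@qmeasurable_coord 1 ord0 k) mu.
exact.
Qed.

Lemma measurable_qabs d (X : measurableType d) (u : X -> Qp p) :
  qmeasurable u -> measurable_fun [set: X] (fun y => qabs R (u y)).
Proof.
move=> mu; have mv : measurable_fun [set: X] (fun y => (fun=> u y) : QpSpace R p 1).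
  exact: qmeasurableP.
have := measurableT_comp measurable_qnormv mv.
congr measurable_fun; apply/funext => y /=.
by rewrite /qnormv big_ord_recl big_ord0 max_l // qabs_ge0.
Qed.

Lemma measurable_qnormm d (X : measurableType d) n (M : X -> QpMx p n) :
  (forall i j, qmeasurable (fun y => M y i j)) ->
  measurable_fun [set: X] (fun y => qnormm R (M y)).
Proof.
move=> mM; rewrite /qnormm.
have mbig (I : Type) (r : seq I) (F : I -> X -> R) :
    (forall i, measurable_fun [set: X] (F i)) ->
    measurable_fun [set: X] (fun y => \big[Num.max/0]_(i <- r) F i y).
  move=> mF; elim: r => [|i r IH].
    by under eq_fun do rewrite big_nil; exact: measurable_cst.
  by under eq_fun do rewrite big_cons; exact: measurable_maxr.
apply: (mbig _ _ _) => i; apply: (mbig _ _ _) => j; exact: measurable_qabs.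
Qed.

End Measurability.
Arguments qsphere R {p n} g.

(** * Haar measure *)

Section Haar.
Context {R : realType} {p n : nat}.
Local Notation B := ((qp_base p)%:R : R).
Local Notation T := (QpSpace R p n).
Implicit Types (x : T) (g : int) (nu mu : {measure set T -> \bar R}).

Definition translation_invariant (nu : set T -> \bar R) :=
  forall x (E : set T), measurable E -> nu (qtranslate R x E) = nu E.

Lemma measurable_qvadd x : measurable_fun [set: T] (qvadd R x : T -> T).
Proof.
apply: qmeasurableP => i; apply: qmeasurable_add; first exact: qmeasurable_cst.
exact: qmeasurable_coord.
Qed.

Lemma qtranslate_preimage x (E : set T) :
  qtranslate R x E = (qvadd R (qvopp R x) : T -> T) @^-1` E.
Proof.
apply/seteqP; split=> [_ [z Ez <-]|z /= Ez]; first by rewrite /= qvaddKN.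
by exists (qvadd R (qvopp R x) z) => //; rewrite qvaddNK.
Qed.

Lemma qtranslate0 (E : set T) : qtranslate R qv0 E = E.
Proof.
apply/seteqP; split=> [_ [z Ez <-]|z Ez]; first by rewrite qvadd0.
by exists z => //; rewrite qvadd0.
Qed.

Lemma qball_mono g h : g <= h -> (qball R g : set T) `<=` qball R h.
Proof.
by move=> gh x; rewrite /qball /= => /le_trans; apply; rewrite ler_weXz2l // ltW // base_gt1.
Qed.

Let digits := {ffun 'I_n -> 'I_(qp_base p)}.

(** Representatives of the cosets of B_(g-1) in B_g: one free digit per coordinate, at position
    [- g], the lowest one that a point of B_g may have. *)
Let rep (g : int) (d : digits) : T :=
  fun i => qmake (fun k => if k == - g then d i : nat else 0%N).

Let repE g d i k : qdig (rep g d i) k = if k == - g then d i : nat else 0%N.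
Proof.
rewrite qdig_qmake //; split=> [j|]; last by exists (- g) => j jg; rewrite lt_eqF.
by case: ifP => _ //; rewrite /qp_base leq_max orbT.
Qed.

Let qtrunc_rep g d i : qtrunc R (rep g d i) (- (g - 1)) = (d i)%:R * B ^ (- g).
Proof.
rewrite (_ : - (g - 1) = - g + 1); last by lia.
rewrite qtruncS qtrunc_eq0 => [|j jg]; first by rewrite add0r repE eqxx.
by rewrite repE lt_eqF.
Qed.

Let qball_partition g : (qball R g : set T) =
  \bigcup_(d in [set: digits]) qtranslate R (rep g d) (qball R (g - 1)).
Proof.
apply/seteqP; split=> [x|x [d _]].
  rewrite qballE => /= x0.
  exists [ffun i => Ordinal (qdig_lt (x i) (- g))] => //.
  rewrite qtranslateE /= => i; rewrite qtrunc_rep ffunE /=.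
  rewrite (_ : - (g - 1) = - g + 1); last by lia.
  by rewrite qtruncS x0 add0r.
rewrite qtranslateE qballE /= => xd i; apply/qtrunc_eq0P => j jg.
have /qtrunc_agree/(_ j) -> // := xd i; last by lia.
by rewrite repE lt_eqF.
Qed.

(** B_g is the disjoint union of p^n translates of B_(g-1), one for each vector of digits. *)
Lemma measure_qballS nu g : translation_invariant nu ->
  nu (qball R g) = ((B ^ n)%:E * nu (qball R (g - 1)))%E.
Proof.
move=> inv; rewrite qball_partition measure_fin_bigcup //.
- rewrite (eq_fsbigr (fun=> nu (qball R (g - 1)))); last first.
    by move=> d _; apply: inv; exact: measurable_qball.
  rewrite (_ : [set: digits] = [set` (xpredT : {pred digits})]); last first.
    by apply/seteqP; split.
  rewrite -(bigfs _ (index_enum_uniq _)) => [|d _]; last by rewrite mem_index_enum.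
  rewrite big_const card_ffun !card_ord -exprnP -natrX.
  elim: (_ ^ _)%N => [|k IH]; first by rewrite mul0e.
  by rewrite iterS IH -add1n natrD EFinD ge0_muleDl ?lee_fin // mul1e.
- exact: finite_finset.
- move=> d e _ _ [x []]; rewrite !qtranslateE /= => xd xe.
  apply/ffunP => i; apply/val_inj => /=; apply/eqP; rewrite -(eqr_nat R).
  by apply/eqP/(mulIf (@baseX_neq0 R p (- g))); rewrite -!qtrunc_rep -xd -xe.
- by move=> d _; exact: measurable_qtranslate_ball.
Qed.

Lemma measure_qball nu g : translation_invariant nu ->
  nu (qball R g) = ((B ^ (n%:Z * g))%:E * nu (qball R 0))%E.
Proof.
move=> inv.
have up (k : nat) h : nu (qball R (h + k%:Z)) = ((B ^ (n%:Z * k%:Z))%:E * nu (qball R h))%E.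
  elim: k => [|k IH]; first by rewrite addr0 mulr0 expr0z mul1e.
  rewrite measure_qballS // (_ : h + k.+1%:Z - 1 = h + k%:Z); last by lia.
  rewrite IH muleA -EFinM -baseXD; congr ((_ ^ _)%:E * _)%E; lia.
have [g0|g0] := leP 0 g.
  by rewrite -[g in LHS](gez0_abs g0) -[`|g|%N%:Z]add0r up gez0_abs.
have -> : 0 = g + `|g|%N%:Z by lia.
rewrite up muleA -EFinM -baseXD (_ : n%:Z * g + _ = 0) ?mul1e //; lia.
Qed.

(** Together with the empty set the balls form a pi-system, and by scaling, agreement on the unit
    ball gives agreement on every ball. *)
Lemma measure_qball_unique nu mu : translation_invariant nu -> translation_invariant mu ->
  (mu (qball R 0) < +oo)%E -> nu (qball R 0) = mu (qball R 0) ->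
  forall E : set T, measurable E -> nu E = mu E.
Proof.
move=> inu imu fin eq0 E mE; apply/esym.
pose G := [set F : set T | F = set0 \/ qballs R p n F].
have ball_eq g : mu (qball R g) = nu (qball R g).
  by rewrite (measure_qball g imu) (measure_qball g inu) eq0.
pose b (k : nat) : set T := qball R k%:Z.
have GE : measurable = <<s G >>.
  apply/seteqP; split; apply: smallest_sub.
  - exact: smallest_sigma_algebra.
  - by move=> F GF; apply: sub_sigma_algebra; right.
  - exact: smallest_sigma_algebra.
  - by move=> F [->|GF]; [exact: sigma_algebra0|exact: sub_sigma_algebra].
have GI : setI_closed G.
  move=> F F' [->|]; first by rewrite set0I; left.
  move=> [x _ [g _ <-]] [->|[y _ [h _ <-]]]; first by rewrite setI0; left.
  rewrite !qtranslateE.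
  (* Balls are nested or disjoint: if they meet at [z], every point of the smaller one agrees with
     [z] to at least the order that the larger one requires. *)
  wlog gh : x y g h / g <= h.
    by move=> wl; have [/wl|/ltW/wl] := leP g h; [exact|rewrite setIC; exact].
  set U := [set z | _]; set V := [set z | _].
  have [->|/set0P[z [/= zx zy]]] := eqVneq (U `&` V) set0; first by left.
  right; exists x => //; exists g => //; rewrite qtranslateE; apply/seteqP.
  split=> [w /= wx|w []//]; split=> // i.
  rewrite -zy; apply/qtrunc_agree => j jh.
  have /qtrunc_agree/(_ j) -> // : qtrunc R (w i) (- g) = qtrunc R (z i) (- g).
    by rewrite wx zx.
  by lia.
have Gb k : G (b k).
  by right; exists qv0 => //; exists k%:Z => //; rewrite qtranslate0.
have bT : \bigcup_k b k = setT.
  apply/seteqP; split=> // x _.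
  have [x0|[k xk]] := @qnormv_cases R p n x.
    by exists 0%N => //; rewrite /b /qball /= x0 ltW // baseX_gt0.
  by exists `|k|%N => //; rewrite /b /qball /= xk ler_weXz2l ?(ltW (base_gt1)) //; lia.
have Geq F : G F -> mu F = nu F.
  move=> [->|]; first by rewrite !measure0.
  move=> [x _ [g _ <-]]; rewrite inu ?imu //; exact: measurable_qball.
have bfin k : (mu (b k) < +oo)%E.
  rewrite /b (measure_qball _ imu).
  by apply: lte_mul_pinfty => //; rewrite lee_fin ltW // baseX_gt0.
exact: (@measure_unique _ R T G b GE GI Gb bT mu nu Geq bfin E mE).
Qed.

End Haar.

(** * Integration against Haar measure *)

Section HaarIntegral.
Context {R : realType} {p n : nat}.
Local Notation B := ((qp_base p)%:R : R).
Local Notation T := (QpSpace R p n).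
Context (mu : {measure set T -> \bar R}) (n_gt0 : (0 < n)%N) (haar : qp_haar mu).
Implicit Types (x : T) (g k : int) (A Ainv : QpMx p n).

Let mu_inv : translation_invariant mu. Proof. exact: haar.2. Qed.

Lemma haar_qball g : mu (qball R g) = (B ^ (n%:Z * g))%:E.
Proof. by rewrite (measure_qball g mu_inv) haar.1 mule1. Qed.

Lemma haar_sigma_finite : sigma_finite [set: T] mu.
Proof.
exists (fun k : nat => qball R k%:Z : set T) => [|k].
  apply/esym/seteqP; split=> // x _.
  have [x0|[k xk]] := @qnormv_cases R p n x.
    by exists 0%N => //; rewrite /qball /= x0 ltW // baseX_gt0.
  by exists `|k|%N => //; rewrite /qball /= xk ler_weXz2l ?(ltW (base_gt1)) //; lia.
by split; [exact: measurable_qball|rewrite haar_qball ltry].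
Qed.

Lemma haar_qv0 : mu [set qv0] = 0%E.
Proof.
apply/eqP; rewrite -measure_le0; apply/lee_addgt0Pr => e e0; rewrite add0e.
have [k ke] : exists k : nat, B ^ (- k%:Z) <= e.
  have := @cvg_geometric R 1 B^-1; rewrite ger0_norm ?invr_ge0 ?(ltW base_gt0) //.
  rewrite invf_lt1 ?base_gt0 ?base_gt1 // => /(_ isT) /cvgrPdist_lt /(_ _ e0)[N _ /(_ N (leqnn N))].
  rewrite /= sub0r mul1r normrN ger0_norm ?exprn_ge0 ?invr_ge0 ?(ltW base_gt0) // => /ltW eN.
  by exists N; rewrite -invr_expz -exprnP -exprVn.
apply: (@le_trans _ _ (mu (qball R (- k%:Z)))).
  apply: le_measure; rewrite ?inE; [exact: measurable_qv0|exact: measurable_qball|].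
  by move=> _ ->; rewrite /qball /= qnormv0 ltW // baseX_gt0.
rewrite haar_qball lee_fin; apply: le_trans ke.
by rewrite ler_weXz2l ?(ltW base_gt1) //; nia.
Qed.

Lemma ae_neq_qv0 : {ae mu, forall x, x <> qv0}.
Proof.
exists [set qv0]; split; [exact: measurable_qv0|exact: haar_qv0|].
by move=> x /= /contrapT.
Qed.

Lemma measurable_qmatvec A : measurable_fun [set: T] (qmatvec R A : T -> T).
Proof.
apply: qmeasurableP; apply: qmeasurable_matvec => [i j|i]; first exact: qmeasurable_cst.
exact: qmeasurable_coord.
Qed.

Lemma qmatvecK A Ainv : qmatmul R Ainv A = qidmx -> cancel (qmatvec R A) (qmatvec R Ainv).
Proof. by move=> AA x; rewrite -qmatvecM AA qmatvec1. Qed.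

(* By uniqueness of Haar measure the image of [mu] under [A] is a multiple of [mu]. *)
Lemma integral_qmatvec_le A Ainv h (f : T -> \bar R) :
  qmatmul R A Ainv = qidmx -> qmatmul R Ainv A = qidmx -> qnormm R Ainv <= B ^ h ->
  measurable_fun [set: T] f -> (forall x, 0 <= f x)%E ->
  (\int[mu]_x f (qmatvec R A x) <= (B ^ (n%:Z * h))%:E * \int[mu]_x f x)%E.
Proof.
move=> AK KA Kh mf f0.
have mA := measurable_qmatvec A.
pose nu := measure_function_pushforward__canonical__measure_function_Measure mu mA.
have nu_inv : translation_invariant nu.
  move=> x E mE; rewrite /nu /= /pushforward.
  rewrite (_ : _ @^-1` _ = qtranslate R (qmatvec R Ainv x) ((qmatvec R A : T -> T) @^-1` E)).
    by rewrite mu_inv // -[X in measurable X]setTI; exact: measurable_qmatvec.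
  apply/seteqP; split=> [z /= [w Ew xw]|_ [w Ew <-]] /=.
    exists (qmatvec R Ainv w); first by rewrite /= (qmatvecK AK).
    by rewrite -qmatvecD xw (qmatvecK KA).
  by exists (qmatvec R A w) => //; rewrite qmatvecD (qmatvecK AK).
(* If A x lies in B_0, then x = A^-1 (A x) lies in B_h. *)
have nu0 : (nu (qball R 0) <= (B ^ (n%:Z * h))%:E)%E.
  rewrite -haar_qball.
  change (mu ((qmatvec R A : T -> T) @^-1` (qball R 0)) <= mu (qball R h))%E.
  apply: le_measure.
  - by rewrite inE -[X in measurable X]setTI; apply: measurable_qmatvec => //; exact: measurable_qball.
  - by rewrite inE; exact: measurable_qball.
  - move=> x; rewrite /qball /= => Ax; rewrite -(qmatvecK KA x).
    apply: (le_trans (qnormv_matvec _ _)); rewrite -[leRHS]mulr1.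
    by rewrite ler_pM ?qnormm_ge0 ?qnormv_ge0.
have nuf : nu (qball R 0) \is a fin_num.
  by rewrite ge0_fin_numE ?measure_ge0 // (le_lt_trans nu0) // ltry.
pose c : {nonneg R} := NngNum (fine_ge0 (measure_ge0 nu (qball R 0))).
have cE : (c%:num)%:E = nu (qball R 0) by rewrite /= fineK.
have nuE E : measurable E -> nu E = mscale c mu E.
  move=> mE; apply: (@measure_qball_unique _ _ _ nu (mscale c mu) nu_inv) => //.
  - by move=> x F mF; rewrite /mscale; congr (_ * _)%E; exact: mu_inv.
  - by rewrite /= /mscale cE haar_qball mulr0 expr0z mule1 -ge0_fin_numE ?measure_ge0.
  - by rewrite /= /mscale cE haar_qball mulr0 expr0z mule1.
have -> : (\int[mu]_x f (qmatvec R A x) = \int[nu]_x f x)%E.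
  by rewrite (ge0_integral_pushforward mA) // => x _; exact: f0.
rewrite (eq_measure_integral (mscale c mu)) => [|E mE _]; last exact: nuE.
rewrite ge0_integral_mscale //; apply: lee_wpmul2r; last by rewrite cE.
by apply: integral_ge0 => x _; exact: f0.
Qed.

Lemma haar_qsphere g : mu (qsphere R g) = (B ^ (n%:Z * g) * (1 - B ^ (- n%:Z)))%:E.
Proof.
transitivity (mu (qball R g) - mu (qball R (g - 1)))%E.
  rewrite qsphereE measureD; [|exact: measurable_qball|exact: measurable_qball|].
  - by rewrite (setIidr (qball_mono _)) //; lia.
  - by apply: (@le_lt_trans _ _ (mu (qball R g))) => //; rewrite haar_qball ltry.
rewrite !haar_qball -EFinB; congr _%:E; rewrite [RHS]mulrBr mulr1 -baseXD.
congr (_ - _ ^ _); lia.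
Qed.

(** The origin is null, and every other point of B_g lies on exactly one sphere of radius p^(g-k)
    with k a natural number. *)
Lemma integral_radial (h : R -> \bar R) g : (forall t, 0 <= h t)%E ->
  (\int[mu]_(x in qball R g) h (qnormv R x) =
   \sum_(0 <= k <oo) (h (B ^ (g - k%:Z)) * mu (qsphere R (g - k%:Z))))%E.
Proof.
move=> h0; rewrite (ge0_negligible_integral _ _ _ _ haar_qv0); last first.
- by move=> x _; exact: h0.
- by apply: measurable_funTS; exact: (measurable_radial h).
- exact: measurable_qball.
- exact: measurable_qv0.
rewrite (_ : _ `\` _ = \bigcup_k qsphere R (g - k%:Z)); last first.
  apply/seteqP; split=> [x [xg x0]|x [k _]].
    have [k xk] := @qnormv_powE R p n x x0; exists `|(g - k)%R|%N => //.
    move: xg; rewrite /qball /qsphere /= xk ler_eXz2l ?base_gt1 // => kg.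
    by congr (_ ^ _); lia.
  rewrite /qsphere /qball /= => xk; split.
    by rewrite xk ler_weXz2l ?(ltW base_gt1) //; lia.
  by move=> x0; move: xk; rewrite x0 qnormv0 => /esym/eqP; rewrite (negbTE (baseX_neq0 _)).
rewrite ge0_integral_bigcup.
- apply: eq_eseriesr => k _.
  rewrite (eq_integral (cst (h (B ^ (g - k%:Z))))).
    by rewrite integral_cst //; exact: measurable_qsphere.
  by move=> x; rewrite inE /qsphere /= => ->.
- by move=> k; exact: measurable_qsphere.
- by apply: measurable_funTS; exact: (measurable_radial h).
- by move=> x _; exact: h0.
- move=> k l _ _ [x []]; rewrite /qsphere /= => -> /(ieexprIz base_gt0).
  by rewrite gt_eqF ?base_gt1 // => /(_ isT); lia.
Qed.

End HaarIntegral.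

(** * Integrals of powers of the norm *)

Section RadialIntegrals.
Context {R : realType} {p n : nat}.
Local Notation B := ((qp_base p)%:R : R).
Local Notation T := (QpSpace R p n).
Context (mu : {measure set T -> \bar R}) (n_gt0 : (0 < n)%N) (haar : qp_haar mu).
Implicit Types (x : T) (g k : int).

(** The sphere of radius p^(g-k) has p^(n g) times the mass of the one of radius p^(-k). Allowing
    [h] and [h'] to differ covers the logarithm, which is shifted by [g] under scaling. *)
Lemma integral_radial_scale (h h' : R -> \bar R) (c : R) g :
  (forall t, 0 <= h t)%E -> (forall t, 0 <= h' t)%E ->
  (forall k : nat, h (B ^ (g - k%:Z)) = c%:E * h' (B ^ (- k%:Z)))%E ->
  (\int[mu]_(x in qball R g) h (qnormv R x) =
   (c * B ^ (n%:Z * g))%:E * \int[mu]_(x in qball R 0) h' (qnormv R x))%E.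
Proof.
move=> h0 h'0 hE; rewrite !(integral_radial n_gt0 haar) //.
rewrite -nneseriesZl => [|k _]; last by rewrite mule_ge0.
apply: eq_eseriesr => k _.
rewrite hE !(haar_qsphere n_gt0 haar) add0r [LHS]muleAC [RHS]muleA [RHS]muleAC -!EFinM.
rewrite (_ : n%:Z * (g - k%:Z) = n%:Z * g + n%:Z * - k%:Z); last by lia.
by rewrite baseXD; congr (_%:E * _)%E; ring.
Qed.

Lemma integral_power_ball0 (s : R) : 0 < s + n%:R -> exists2 c : R, 0 < c &
  (\int[mu]_(x in qball R 0) (powR (qnormv R x) s)%:E)%E = c%:E.
Proof.
(* [u] is the mass of the unit sphere and [z] the ratio of the contributions of consecutive spheres;
   z < 1 expresses s + n > 0. The first term alone makes the sum positive. *)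
move=> sn; pose u : R := 1 - B ^ (- n%:Z); pose z : R := powR B (- (s + n%:R)).
have u0 : 0 < u.
  by rewrite subr_gt0 -[X in _ < X](expr0z B) ltr_eXz2l ?base_gt1 //; lia.
have z0 : 0 < z by rewrite powR_gt0 // base_gt0.
have z1 : z < 1.
  rewrite /z powRN invf_lt1 ?powR_gt0 ?base_gt0 // -[X in X < _](powRr0 B).
  by rewrite /powR !gt_eqF ?base_gt0 // ltr_expR ltr_pM2r // ln_gt0 // base_gt1.
have I0 : (0 <= \int[mu]_(x in qball R 0) (powR (qnormv R x) s)%:E)%E.
  by apply: integral_ge0 => x _; rewrite lee_fin powR_ge0.
have IE : (\int[mu]_(x in qball R 0) (powR (qnormv R x) s)%:E =
    \sum_(0 <= k <oo) (geometric u z k)%:E)%E.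
  rewrite (integral_radial n_gt0 haar (h := fun t => (powR t s)%:E)); last first.
    by move=> t; rewrite lee_fin powR_ge0.
  apply: eq_eseriesr => k _; rewrite (haar_qsphere n_gt0 haar) -EFinM add0r; congr EFin.
  rewrite /geometric /= -/u mulrA [u * _]mulrC; congr (_ * _).
  rewrite -!powR_intmul ?(ltW base_gt0) // -powRrM -powRD; last by rewrite base_neq0 implybT.
  rewrite /z -powR_mulrn ?powR_ge0 // -powRrM; congr powR.
  by rewrite intrM !mulrNz -!pmulrn; ring.
have Sle (N : nat) : (\sum_(0 <= k < N) (geometric u z k)%:E <= (u / (1 - z))%:E)%E.
  rewrite sumEFin lee_fin.
  have -> : \sum_(0 <= k < N) geometric u z k = series (geometric u z) N by [].
  rewrite geometric_seriesE ?lt_eqF //= ler_pM2r ?invr_gt0 ?subr_gt0 //.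
  by rewrite ler_piMr ?(ltW u0) // gerBl exprn_ge0 // ltW.
have Ifin : (\int[mu]_(x in qball R 0) (powR (qnormv R x) s)%:E <= (u / (1 - z))%:E)%E.
  rewrite IE; apply: lime_le; last by apply: nearW => N; exact: Sle.
  by apply: is_cvg_nneseries => k _ _; rewrite lee_fin geometric_ge0 // ltW.
have Ige : (u%:E <= \int[mu]_(x in qball R 0) (powR (qnormv R x) s)%:E)%E.
  rewrite IE; apply: le_trans (nneseries_lim_ge 1 _).
    by rewrite big_nat1 /geometric /= expr0 mulr1.
  by move=> k _ _; rewrite lee_fin geometric_ge0 // ltW.
exists (fine (\int[mu]_(x in qball R 0) (powR (qnormv R x) s)%:E)%E).
  rewrite fine_gt0 //; apply/andP; split; first by apply: lt_le_trans Ige; rewrite lte_fin.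
  by apply: le_lt_trans Ifin _; rewrite ltry.
by rewrite fineK // ge0_fin_numE // (le_lt_trans Ifin) // ltry.
Qed.

Lemma integral_power (s : R) : 0 < s + n%:R -> exists2 c : R, 0 < c &
  forall g, (\int[mu]_(x in qball R g) (powR (qnormv R x) s)%:E)%E =
    (c * powR (B ^ g) (s + n%:R))%:E.
Proof.
move=> sn; have [c c0 cE] := integral_power_ball0 sn; exists c => // g.
rewrite (@integral_radial_scale (fun t => (powR t s)%:E) (fun t => (powR t s)%:E)
  (powR (B ^ g) s)) => [|t|t|k].
- rewrite cE -EFinM; congr _%:E.
  rewrite powRD; last by rewrite baseX_neq0 implybT.
  rewrite powR_mulrn ?(ltW (baseX_gt0 _)) // exprnP exprz_exp [g * _]mulrC; ring.
- by rewrite lee_fin powR_ge0.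
- by rewrite lee_fin powR_ge0.
- by rewrite -EFinM baseXD powRM // ltW // baseX_gt0.
Qed.

Lemma qwmeas_qball (alpha : R) : 0 < alpha + n%:R -> exists2 c : R, 0 < c &
  forall g, qwmeas mu alpha (qball R g) = (c * powR (B ^ g) (alpha + n%:R))%:E.
Proof. exact: integral_power. Qed.

End RadialIntegrals.

Arguments qwt R {p n} alpha x.

(** * Linear changes of variables in weighted integrals *)

Section ChangeOfVariables.
Context {R : realType} {p n : nat}.
Local Notation B := ((qp_base p)%:R : R).
Local Notation T := (QpSpace R p n).
Context (mu : {measure set T -> \bar R}) (n_gt0 : (0 < n)%N) (haar : qp_haar mu).
Implicit Types (x : T) (g k : int) (A Ainv : QpMx p n) (alpha : R) (F : T -> R).

Lemma qwt_ge0 alpha x : 0 <= qwt R alpha x. Proof. exact: powR_ge0. Qed.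

Lemma measurable_qwt alpha : measurable_fun [set: T] (qwt R alpha : T -> R).
Proof. exact: (measurable_radial (fun t => powR t alpha)). Qed.

Definition well_conditioned nu A Ainv :=
  [/\ qmatmul R A Ainv = qidmx, qmatmul R Ainv A = qidmx &
      qnormm R A * qnormm R Ainv <= B ^+ nu].

Lemma nonzero_qvector : exists x : QpV p n, x <> qv0.
Proof.
exists (fun=> qone p) => /(congr1 (fun x => qdig (x (Ordinal n_gt0)) 0)) /=.
by [].
Qed.

(** A nonzero x equals A^-1 (A x), so |A| is not 0 and |A| |A^-1| >= 1; the upper bound on |A^-1| is
    the conditioning assumption. *)
Lemma well_conditioned_norm nu A Ainv : well_conditioned nu A Ainv ->
  exists k, qnormm R A = B ^ k /\ B ^ (- k) <= qnormm R Ainv <= B ^ (nu%:Z - k).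
Proof.
move=> [AK KA cond]; have [x x0] := nonzero_qvector.
have xle : qnormv R x <= qnormm R Ainv * (qnormm R A * qnormv R x).
  rewrite -{1}(qmatvecK KA x); apply: le_trans (qnormv_matvec _ _) _.
  by rewrite ler_wpM2l ?qnormm_ge0 // qnormv_matvec.
have [A0|[k Ak]] := @qnormm_cases R p n A.
  by move: xle; rewrite A0 mul0r mulr0 leNgt qnormv_gt0.
exists k; split => //; rewrite -invr_expz; apply/andP; split.
  rewrite -div1r ler_pdivrMr ?baseX_gt0 // -Ak.
  by rewrite -(ler_pM2r (qnormv_gt0 (R := R) x0)) mul1r -mulrA.
by rewrite baseXD -invr_expz ler_pdivlMr ?baseX_gt0 // mulrC -Ak.
Qed.

Lemma qmatvec_neq0 nu A Ainv x : well_conditioned nu A Ainv -> x <> qv0 ->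
  qmatvec R A x <> qv0.
Proof.
move=> [AK KA _] x0 Ax0; apply: x0.
by rewrite -(qmatvecK KA x) Ax0 qmatvec0.
Qed.

(** ln |A x| differs from ln |A| + ln |x| by at most nu ln p: one side is |A x| <= |A| |x|, the
    other comes from x = A^-1 (A x). The sign of [alpha] decides which side is used. *)
Lemma qwt_qmatvec nu A Ainv k alpha x :
  well_conditioned nu A Ainv -> qnormm R A = B ^ k ->
  qwt R alpha x <= powR B (nu%:R * `|alpha|) * powR (B ^ k) (- alpha) *
                   qwt R alpha (qmatvec R A x).
Proof.
(* At the origin the left side is [powR 0 alpha], which is 0 only for a nonzero exponent; for
   [alpha] equal to 0 both sides are 1. *)
move=> wc Ak; have [->|alpha0] := eqVneq alpha 0.
  by rewrite /qwt normr0 mulr0 oppr0 !powRr0 !mulr1.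
have [x0|x0] := pselect (x = qv0).
  rewrite {1}/qwt x0 qnormv0 powR0 //.
  by rewrite !mulr_ge0 ?powR_ge0 ?qwt_ge0.
have Ax0 := qmatvec_neq0 wc x0.
have [k' [Ak' /andP[_ Kle]]] := well_conditioned_norm wc.
have [AK KA _] := wc.
have kk' : k = k'.
  by apply: (ieexprIz (@base_gt0 R p)); rewrite ?gt_eqF ?base_gt1 // -Ak -Ak'.
subst k'.
have xgt0 := qnormv_gt0 (R := R) x0; have Axgt0 := qnormv_gt0 (R := R) Ax0.
have Bk0 := @baseX_gt0 R p k; have B0 := @base_gt0 R p.
have lnB : 0 < ln B by rewrite ln_gt0 // base_gt1.
have h1 : qnormv R x <= B ^ (nu%:Z - k) * qnormv R (qmatvec R A x).
  rewrite -{1}(qmatvecK KA x); apply: le_trans (qnormv_matvec _ _) _.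
  by rewrite ler_wpM2r // qnormv_ge0.
have h2 : qnormv R (qmatvec R A x) <= B ^ k * qnormv R x.
  by rewrite -Ak qnormv_matvec.
rewrite /qwt; set a := qnormv R x in xgt0 h1 h2 *.
set c := qnormv R (qmatvec R A x) in Axgt0 h1 h2 *.
have lh1 : ln a <= nu%:R * ln B - ln (B ^ k) + ln c.
  have Bnu0 : 0 < B ^ (nu%:Z - k) by exact: baseX_gt0.
  have lnE : ln (B ^ (nu%:Z - k)) = nu%:R * ln B - ln (B ^ k).
    by rewrite baseXD lnM ?posrE ?baseX_gt0 // -invr_expz lnV ?posrE // -exprnP lnXn // mulr_natl.
  by rewrite -lnE -lnM ?posrE // ler_ln ?posrE ?mulr_gt0.
have lh2 : ln c <= ln (B ^ k) + ln a.
  by rewrite -lnM ?posrE ?baseX_gt0 // ler_ln ?posrE ?mulr_gt0.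
rewrite /powR !gt_eqF // -!expRD ler_expR.
have nuB : 0 <= nu%:R * ln B by rewrite mulr_ge0 // ltW.
have [al0|al0] := leP 0 alpha.
  by rewrite ger0_norm //; nra.
rewrite ltr0_norm //; nra.
Qed.

(** A factor p^(nu |alpha|) pays for comparing the weights at x and A x, and p^(nu n) for the bound
    |A^-1|^n <= (p^nu / |A|)^n on the image of Haar measure. *)
Definition chvar_const nu alpha : R := powR B (nu%:R * (`|alpha| + n%:R)).

Lemma chvar_const_gt0 nu alpha : 0 < chvar_const nu alpha.
Proof. by rewrite powR_gt0 // base_gt0. Qed.

(** [A] maps B_g into B_(g+k), so the integrand may be cut off there and the change of variables
    carried out on the whole space. *)
Lemma weighted_integral_qmatvec nu A Ainv k alpha g F :
  well_conditioned nu A Ainv -> qnormm R A = B ^ k ->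
  measurable_fun [set: T] F -> (forall x, 0 <= F x) ->
  (\int[mu]_(x in qball R g) (F (qmatvec R A x) * qwt R alpha x)%:E <=
   (chvar_const nu alpha * powR (B ^ k) (- (alpha + n%:R)))%:E *
   \int[mu]_(x in qball R (g + k)) (F x * qwt R alpha x)%:E)%E.
Proof.
move=> wc Ak mF F0.
have [k' [Ak' /andP[_ Kle]]] := well_conditioned_norm wc.
have kk' : k = k'.
  by apply: (ieexprIz (@base_gt0 R p)); rewrite ?gt_eqF ?base_gt1 // -Ak -Ak'.
subst k'.
have [AK KA _] := wc.
pose c := powR B (nu%:R * `|alpha|) * powR (B ^ k) (- alpha).
have c0 : 0 <= c by rewrite mulr_ge0 ?powR_ge0.
have mFw : measurable_fun [set: T] (fun x => (F x * qwt R alpha x)%:E).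
  by apply/measurable_EFinP; apply: measurable_funM => //; exact: measurable_qwt.
pose G := (fun x : T => (F x * qwt R alpha x)%:E) \_ (qball R (g + k)).
have mG : measurable_fun [set: T] G.
  apply/(measurable_restrictT _ _).1; first exact: measurable_qball.
  exact: measurable_funTS.
have G0 x : (0 <= G x)%E.
  by rewrite /G patchE; case: ifP => // _; rewrite lee_fin mulr_ge0 ?qwt_ge0.
have mGA : measurable_fun [set: T] (fun x => G (qmatvec R A x)).
  exact: (measurableT_comp mG (measurable_qmatvec _)).
have mball := @measurable_qball R p n g.
apply: (@le_trans _ _ (\int[mu]_(x in qball R g) (c%:E * G (qmatvec R A x)))%E).
  apply: ge0_le_integral => //.
  - by move=> x _; rewrite lee_fin mulr_ge0 ?qwt_ge0.
  - apply: measurable_funTS; apply/measurable_EFinP; apply: measurable_funM.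
      exact: (measurableT_comp mF (measurable_qmatvec _)).
    exact: measurable_qwt.
  - by apply: measurable_funTS; exact: measurable_funeM.
  move=> x xg; rewrite /G patchE ifT; last first.
    rewrite inE /qball /= addrC baseXD; apply: (le_trans (qnormv_matvec _ _)).
    by rewrite Ak ler_wpM2l ?(ltW (baseX_gt0 _)).
  rewrite -EFinM lee_fin mulrCA ler_wpM2l //; exact: (qwt_qmatvec _ _ wc Ak).
rewrite ge0_integralZl_EFin //; last exact: measurable_funTS.
have -> : (chvar_const nu alpha * powR (B ^ k) (- (alpha + n%:R)))%:E =
    (c%:E * (B ^ (n%:Z * (nu%:Z - k)))%:E)%E.
  have powE l : B ^ l = powR B l%:~R by rewrite powR_intmul // ltW // base_gt0.
  rewrite -EFinM /c /chvar_const !powE -!powRrM -!powRD ?base_neq0 ?implybT //.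
  by congr (powR _ _)%:E; rewrite intrM intrD mulrNz -!pmulrn; ring.
rewrite -muleA; apply: lee_wpmul2l; first by rewrite lee_fin.
apply: (@le_trans _ _ (\int[mu]_x G (qmatvec R A x))%E).
  by apply: ge0_subset_integral.
rewrite [X in (_ <= _ * X)%E]integral_mkcond.
exact: (integral_qmatvec_le haar AK KA Kle mG G0).
Qed.

End ChangeOfVariables.
Arguments well_conditioned R {p n} nu A Ainv.

(** * Central mean oscillation *)

Section CentralMeanOscillation.
Context {R : realType} {p n : nat}.
Local Notation B := ((qp_base p)%:R : R).
Local Notation T := (QpSpace R p n).
Context (mu : {measure set T -> \bar R}) (n_gt0 : (0 < n)%N) (haar : qp_haar mu).
Implicit Types (x : T) (g k : int) (A Ainv : QpMx p n) (alpha : R) (F : T -> R).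

Definition qw alpha g : R := fine (qwmeas mu alpha (qball R g)).

Lemma fine_qwmeas alpha g : fine (qwmeas mu alpha (qball R g)) = qw alpha g.
Proof. by []. Qed.

Lemma qwE alpha g : 0 < alpha + n%:R -> qwmeas mu alpha (qball R g) = (qw alpha g)%:E.
Proof. by move=> an; rewrite /qw; have [c _ ->] := qwmeas_qball n_gt0 haar an. Qed.

Lemma qw_gt0 alpha g : 0 < alpha + n%:R -> 0 < qw alpha g.
Proof.
move=> an; rewrite /qw; have [c c0 ->] := qwmeas_qball n_gt0 haar an.
by rewrite /= mulr_gt0 // powR_gt0 // baseX_gt0.
Qed.

Lemma qwD alpha g k : 0 < alpha + n%:R ->
  qw alpha (g + k) = qw alpha g * powR (B ^ k) (alpha + n%:R).
Proof.
move=> an; rewrite /qw; have [c c0 cE] := qwmeas_qball n_gt0 haar an.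
by rewrite !cE /= baseXD powRM ?(ltW (baseX_gt0 _)) // mulrA.
Qed.

Lemma powR_invr (x r : R) : 0 <= x -> powR x^-1 r = powR x (- r).
Proof. by move=> x0; rewrite -powR_inv1 // -powRrM mulN1r. Qed.

Lemma powR_baseX g : powR (B ^ g) n%:R = B ^ (n%:Z * g).
Proof. by rewrite powR_mulrn ?(ltW (baseX_gt0 _)) // exprnP exprz_exp mulrC. Qed.

(** Either t^(r-1) S >= 1, and t times this is the first term, or t is at most S^(-1/(r-1)). *)
Lemma young_dichotomy (r t S : R) : 1 < r -> 0 <= t -> 0 < S ->
  t <= powR t r * S + powR S (- (r - 1)^-1).
Proof.
move=> r1 t0 S0; have r10 : 0 < r - 1 by rewrite subr_gt0.
have [t1|t1] := leP 1 (powR t (r - 1) * S).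
  rewrite -[leLHS]addr0 lerD ?powR_ge0 // -[leLHS]mulr1.
  by rewrite -(mulr_powRB1 t0) ?(lt_trans ltr01) // -mulrA ler_wpM2l.
rewrite -[leLHS]add0r lerD ?mulr_ge0 ?powR_ge0 ?(ltW S0) //.
have e : t = powR (powR t (r - 1)) (r - 1)^-1.
  by rewrite -powRrM divff ?gt_eqF // powRr1.
rewrite [leLHS]e -[- _^-1]mulN1r [leRHS]powRrM powR_inv1 ?(ltW S0) //.
apply: ge0_ler_powR; rewrite ?nnegrE ?invr_ge0 ?(ltW r10) ?powR_ge0 ?(ltW S0) //.
by rewrite -div1r ler_pdivlMr // ltW.
Qed.

(* Hoelder's inequality against the [A_r] weight, up to a constant. *)
Lemma integral_le_weighted (alpha r : R) : 1 < r -> - n%:R < alpha -> alpha < n%:R * (r - 1) ->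
  exists2 C : R, 0 < C & forall (F : T -> R) (N : R) g,
    measurable_fun [set: T] F -> (forall x, 0 <= F x) -> 0 < N ->
    (\int[mu]_(x in qball R g) (powR (F x) r * qwt R alpha x)%:E <=
      (powR N r * qw alpha g)%:E)%E ->
    (\int[mu]_(x in qball R g) (F x)%:E <= (C * N * B ^ (n%:Z * g))%:E)%E.
Proof.
move=> r1 nalpha alphan.
have r10 : 0 < r - 1 by rewrite subr_gt0.
have an : 0 < alpha + n%:R by lra.
(* The exponent of the dual weight; alpha < n (r - 1) makes it integrable at the origin. *)
pose s := - (r - 1)^-1 * alpha.
have sn : 0 < s + n%:R.
  rewrite /s mulNr addrC subr_gt0 mulrC ltr_pdivrMr //.
have [c c0 cE] := integral_power n_gt0 haar sn.
exists (qw alpha 0 + c) => [|F N g mF F0 N0 Fr]; first by rewrite addr_gt0 ?qw_gt0.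
have Bg0 := @baseX_gt0 R p g.
(* The weight relative to the size of the ball. [young_dichotomy] is applied to [F x / N] and [S x];
   with this normalization both terms integrate to a constant times N p^(n g). [S x] may vanish at
   the origin, hence a comparison almost everywhere. *)
pose S x := qwt R alpha x * powR (B ^ g) (- alpha).
have mball := @measurable_qball R p n g.
have mFr : measurable_fun [set: T] (fun x => powR (F x) r * qwt R alpha x).
  apply: measurable_funM; last exact: measurable_qwt.
  exact: (measurableT_comp (measurable_powR r) mF).
pose a : R := N * powR N (- r) * powR (B ^ g) (- alpha).
have a0 : 0 <= a by rewrite !mulr_ge0 ?powR_ge0 ?(ltW N0).
pose b : R := N * powR (B ^ g) (- alpha * - (r - 1)^-1).
have b0 : 0 <= b by rewrite mulr_ge0 ?powR_ge0 ?(ltW N0).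
apply: (@le_trans _ _ (\int[mu]_(x in qball R g)
    (a%:E * (powR (F x) r * qwt R alpha x)%:E + b%:E * (powR (qnormv R x) s)%:E))%E).
  apply: ae_ge0_le_integral => //.
  - by move=> x _; rewrite lee_fin.
  - by apply/measurable_EFinP; exact: measurable_funTS.
  - by move=> x _; rewrite adde_ge0 // mule_ge0 // lee_fin ?mulr_ge0 ?powR_ge0 ?qwt_ge0.
  - apply: emeasurable_funD; apply: measurable_funeM; apply: measurable_funTS; apply/measurable_EFinP => //.
    exact: (measurable_radial (fun t => powR t s)).
  apply: filterS (ae_neq_qv0 n_gt0 haar) => x x0 _.
  have S0 : 0 < S x by rewrite mulr_gt0 ?powR_gt0 ?qnormv_gt0.
  have t0 : 0 <= F x / N by rewrite divr_ge0 // ltW.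
  rewrite -!EFinM -EFinD lee_fin.
  have := young_dichotomy r1 t0 S0; rewrite ler_pdivrMr // => /le_trans; apply.
  rewrite mulrDl lerD //.
    rewrite powRM ?invr_ge0 ?(ltW N0) // powR_invr ?(ltW N0) // /S /a.
    by rewrite le_eqVlt; apply/orP; left; apply/eqP; ring.
  rewrite /b /S powRM ?qwt_ge0 ?powR_ge0 // /qwt -!powRrM /s.
  by rewrite le_eqVlt; apply/orP; left; apply/eqP; rewrite [alpha * _]mulrC; ring.
rewrite ge0_integralD //; last 4 first.
- by move=> x _; rewrite mule_ge0 // lee_fin ?mulr_ge0 ?powR_ge0 ?qwt_ge0.
- by apply: measurable_funeM; apply: measurable_funTS; exact/measurable_EFinP.
- by move=> x _; rewrite mule_ge0 // lee_fin ?mulr_ge0 ?powR_ge0 ?qwt_ge0.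
- apply: measurable_funeM; apply: measurable_funTS; apply/measurable_EFinP.
  exact: (measurable_radial (fun t => powR t s)).
rewrite !ge0_integralZl_EFin //; last 4 first.
- by move=> x _; rewrite lee_fin powR_ge0.
- apply: measurable_funTS; apply/measurable_EFinP.
  exact: (measurable_radial (fun t => powR t s)).
- by move=> x _; rewrite lee_fin mulr_ge0 ?powR_ge0 ?qwt_ge0.
- by apply: measurable_funTS; exact/measurable_EFinP.
rewrite cE; apply: (@le_trans _ _ (a%:E * (powR N r * qw alpha g)%:E +
    b%:E * (c * powR (B ^ g) (s + n%:R))%:E)%E).
  by apply: leeD => //; apply: lee_wpmul2l.
rewrite -!EFinM -EFinD lee_fin -powR_baseX -[in qw alpha g](add0r g) qwD //.
have N1 : powR N (- r) * powR N r = 1 by rewrite powRN mulVf // powR_eq0 gt_eqF.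
have B1 e : powR (B ^ g) (- e) * powR (B ^ g) (e + n%:R) = powR (B ^ g) n%:R.
  by rewrite -powRD ?addKr // baseX_neq0 implybT.
have -> : a * (powR N r * (qw alpha 0 * powR (B ^ g) (alpha + n%:R))) =
    N * qw alpha 0 * powR (B ^ g) n%:R.
  transitivity (powR N (- r) * powR N r * (N * qw alpha 0 *
      (powR (B ^ g) (- alpha) * powR (B ^ g) (alpha + n%:R)))); first by rewrite /a; ring.
  by rewrite N1 B1 mul1r.
have -> : b * (c * powR (B ^ g) (s + n%:R)) = N * c * powR (B ^ g) n%:R.
  rewrite -(B1 s) /b /s (_ : - alpha * _ = - (- (r - 1)^-1 * alpha)); last by ring.
  by ring.
by rewrite le_eqVlt; apply/orP; left; apply/eqP; ring.
Qed.

Lemma qcmo_norm_le alpha r (b : T -> R) (N : R) g : 0 < alpha + n%:R -> 0 < r -> 0 <= N ->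
  (qcmo_norm mu alpha r b <= N%:E)%E ->
  (\int[mu]_(x in qball R g) (powR `|b x - qmean mu b g| r * qwt R alpha x)%:E <=
   (powR N r * qw alpha g)%:E)%E.
Proof.
move=> an r0 N0 bN; set I := (X in (X <= _)%E).
have I0 : (0 <= I)%E.
  by apply: integral_ge0 => x _; rewrite lee_fin mulr_ge0 ?powR_ge0 ?qwt_ge0.
have qw0 := qw_gt0 g an.
have : (poweR ((qw alpha g)^-1%:E * I) r^-1 <= N%:E)%E.
  by apply: le_trans bN; apply: ereal_sup_ubound; exists g.
have X0 : (0 <= (qw alpha g)^-1%:E * I)%E by rewrite mule_ge0 // lee_fin invr_ge0 ltW.
move=> /(gt0_ler_poweR (ltW r0)); rewrite -poweRrM mulVf ?gt_eqF // poweRe1 // poweR_EFin.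
rewrite lee_pdivrMl // -EFinM mulrC; apply.
  by rewrite in_itv /= poweR_ge0 leey.
by rewrite in_itv /= lee_fin N0 leey.
Qed.

(** Finiteness of the integral of |b - c| makes b integrable on the ball, so the [fine] inside
    [qmean] loses nothing, and the mean of b - c is the difference of the means. *)
Lemma qmean_sub_le (b : T -> R) (c K : R) g : measurable_fun [set: T] b ->
  (\int[mu]_(x in qball R g) `|b x - c|%:E <= K%:E)%E ->
  `|qmean mu b g - c| <= K / B ^ (n%:Z * g).
Proof.
move=> mb bK; have mball := @measurable_qball R p n g.
have Bg := @baseX_gt0 R p (n%:Z * g).
have mbc : measurable_fun [set: T] (fun x => (b x - c)%:E).
  by apply/measurable_EFinP; exact: measurable_funB.
have ibc : mu.-integrable (qball R g) (fun x => (b x - c)%:E).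
  apply/integrableP; split; first exact: measurable_funTS.
  by apply: le_lt_trans (ltry K).
have ic : mu.-integrable (qball R g) (fun=> c%:E).
  apply/integrableP; split; first exact: measurable_cst.
  by rewrite integral_cst // haar_qball // -EFinM ltry.
have absK : (`|\int[mu]_(x in qball R g) (b x - c)%:E| <= K%:E)%E.
  by apply: le_trans bK; apply: le_abse_integral => //; exact: measurable_funTS.
have Ifin : (\int[mu]_(x in qball R g) (b x - c)%:E)%E \is a fin_num.
  exact: integrable_fin_num.
have bE : (\int[mu]_(x in qball R g) (b x)%:E)%E =
    (fine (\int[mu]_(x in qball R g) (b x - c)%:E)%E + c * B ^ (n%:Z * g))%:E.
  rewrite EFinD fineK // EFinM -(haar_qball haar) -(integral_cst mu mball) -integralD //.
  by apply: eq_integral => x _; rewrite -EFinD subrK.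
rewrite /qmean bE haar_qball //= mulrDl mulfK ?gt_eqF // addrK.
rewrite normrM [`|_^-1|]gtr0_norm ?invr_gt0 // ler_pM2r ?invr_gt0 //.
by rewrite -fine_abse // -lee_fin fineK // abse_fin_num.
Qed.

Lemma qmean_diff (alpha r : R) : 1 < r -> - n%:R < alpha -> alpha < n%:R * (r - 1) ->
  exists2 C : R, 0 < C & forall (b : T -> R) (N : R) g (j : nat),
    measurable_fun [set: T] b -> 0 < N -> (qcmo_norm mu alpha r b <= N%:E)%E ->
    `|qmean mu b (g - j%:Z) - qmean mu b g| <= C * j%:R * N.
Proof.
move=> r1 nalpha alphan.
have an : 0 < alpha + n%:R by lra.
have [C C0 CP] := integral_le_weighted r1 nalpha alphan.
(* [C] bounds the oscillation over B_h, and p^n is the ratio of the masses of B_h and B_(h-1). *)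
exists (C * B ^ n%:Z) => [|b N g j mb N0 bN]; first by rewrite mulr_gt0 ?baseX_gt0.
have step h : `|qmean mu b (h - 1) - qmean mu b h| <= C * B ^ n%:Z * N.
  have mbh : measurable_fun [set: T] (fun x => `|b x - qmean mu b h|).
    by apply: measurableT_comp => //; exact: measurable_funB.
  have := CP _ N h mbh (fun=> normr_ge0 _) N0 (qcmo_norm_le h an _ (ltW N0) bN).
  move=> /(_ (lt_trans ltr01 r1)) bh.
  have bh1 : (\int[mu]_(x in qball R (h - 1)) `|b x - qmean mu b h|%:E <=
      (C * N * B ^ (n%:Z * h))%:E)%E.
    apply: le_trans bh; apply: ge0_subset_integral.
    - exact: measurable_qball.
    - exact: measurable_qball.
    - by apply: measurable_funTS; exact/measurable_EFinP.
    - by move=> x _; rewrite lee_fin.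
    - by apply: qball_mono; lia.
  have := qmean_sub_le mb bh1; move=> /le_trans; apply.
  rewrite (_ : n%:Z * h = n%:Z + n%:Z * (h - 1)); last by rewrite mulrBr mulr1 addrC subrK.
  by rewrite baseXD mulrA mulfK ?baseX_neq0 // mulrAC.
elim: j => [|j IH]; first by rewrite subr0 subrr normr0 mulr0 mul0r.
have -> : g - j.+1%:Z = g - j%:Z - 1 by lia.
apply: le_trans (ler_distD (qmean mu b (g - j%:Z)) _ _) _.
by rewrite -natr1 mulrDr mulrDl mulr1 [leRHS]addrC lerD.
Qed.

(** The sum is at most three times the maximum, whose power is one of the three powers. *)
Lemma powR_add3_le (r a b c : R) : 0 < r -> 0 <= a -> 0 <= b -> 0 <= c ->
  powR (a + b + c) r <= powR 3 r * (powR a r + powR b r + powR c r).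
Proof.
move=> r0 a0 b0 c0; pose t := Num.max (Num.max a b) c.
have t0 : 0 <= t by rewrite !le_max a0.
have abct : a + b + c <= 3 * t.
  have at' : a <= t by rewrite !le_max lexx.
  have bt : b <= t by rewrite !le_max lexx orbT.
  have ct : c <= t by rewrite !le_max lexx orbT.
  by lra.
apply: (@le_trans _ _ (powR (3 * t) r)).
  by apply: ge0_ler_powR; rewrite ?nnegrE ?(ltW r0) ?addr_ge0 ?mulr_ge0.
rewrite powRM // ler_wpM2l ?powR_ge0 // /t !maxEle.
have := powR_ge0 a r; have := powR_ge0 b r; have := powR_ge0 c r.
by repeat case: ifP => _; lra.
Qed.

(** The difference is split at the means over B_g and over B_(g-j), which contains the image of B_g:
    an oscillation on B_g, a difference of means of size at most linear in [j], and an oscillation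
    transported by [A]. *)
Lemma qcmo_difference (nu : nat) (alpha r : R) :
  1 < r -> - n%:R < alpha -> alpha < n%:R * (r - 1) ->
  exists2 C : R, 0 < C & forall (b : T -> R) (N : R) g (j : nat) A Ainv,
    measurable_fun [set: T] b -> 0 < N -> (qcmo_norm mu alpha r b <= N%:E)%E ->
    (0 < j)%N -> well_conditioned R nu A Ainv -> qnormm R A = B ^ (- j%:Z) ->
    (\int[mu]_(x in qball R g)
       (powR `|b x - b (qmatvec R A x)| r * qwt R alpha x)%:E <=
     (powR (C * j%:R * N) r * qw alpha g)%:E)%E.
Proof.
move=> r1 nalpha alphan; have r0 := lt_trans ltr01 r1.
have an : 0 < alpha + n%:R by lra.
have [C C0 CP] := qmean_diff r1 nalpha alphan.
pose C1 := @chvar_const R p n nu alpha.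
have C10 : 0 < C1 by exact: chvar_const_gt0.
(* One summand for each piece, in the order oscillation on B_g, difference of means, transported
   oscillation. The first and third are absorbed into j^r because j >= 1. *)
pose C' := powR 3 r * (1 + powR C r + C1).
have C'0 : 0 < C'.
  by apply: mulr_gt0; [exact: powR_gt0|apply: addr_gt0 => //; apply: addr_gt0 => //; exact: powR_gt0].
exists (powR C' r^-1) => [|b N g j A Ainv mb N0 bN j0 wc Aj]; first exact: powR_gt0.
have mball := @measurable_qball R p n g.
pose m0 := qmean mu b g; pose m1 := qmean mu b (g - j%:Z).
have mpow c : measurable_fun [set: T] (fun x => powR `|b x - c| r).
  apply: (measurableT_comp (measurable_powR r)); apply: measurableT_comp => //.
  exact: measurable_funB.
have mf c : measurable_fun (qball R g : set T) (fun x => (powR `|b x - c| r * qwt R alpha x)%:E).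
  apply: measurable_funTS; apply/measurable_EFinP; apply: measurable_funM => //.
  exact: measurable_qwt.
have mcst c : measurable_fun (qball R g : set T) (fun x => (c * qwt R alpha x)%:E).
  by apply: measurable_funTS; apply/measurable_EFinP; apply: measurable_funM => //; exact: measurable_qwt.
have mfA c : measurable_fun (qball R g : set T)
    (fun x => (powR `|b (qmatvec R A x) - c| r * qwt R alpha x)%:E).
  apply: measurable_funTS; apply/measurable_EFinP; apply: measurable_funM; last exact: measurable_qwt.
  exact: (measurableT_comp (mpow c) (measurable_qmatvec _)).
pose f1 x := (powR `|b x - m0| r * qwt R alpha x)%:E.
pose f2 x := (powR `|m1 - m0| r * qwt R alpha x)%:E.
pose f3 x := (powR `|b (qmatvec R A x) - m1| r * qwt R alpha x)%:E.
have mf1 : measurable_fun (qball R g : set T) f1 by exact: mf.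
have mf2 : measurable_fun (qball R g : set T) f2 by exact: mcst.
have mf3 : measurable_fun (qball R g : set T) f3 by exact: mfA.
have f0 u x : (0 <= (powR u r * qwt R alpha x)%:E)%E.
  by rewrite lee_fin mulr_ge0 ?powR_ge0 ?qwt_ge0.
apply: (@le_trans _ _ ((powR 3 r)%:E * \int[mu]_(x in qball R g) (f1 x + f2 x + f3 x))%E).
  rewrite -ge0_integralZl_EFin ?powR_ge0 //; last 2 first.
  - by move=> x _; rewrite !adde_ge0 // /f1 /f2 /f3.
  - by apply: emeasurable_funD; [apply: emeasurable_funD|].
  apply: ge0_le_integral => //.
  - apply: measurable_funTS; apply/measurable_EFinP; apply: measurable_funM; last exact: measurable_qwt.
    apply: (measurableT_comp (measurable_powR r)); apply: measurableT_comp => //.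
    by apply: measurable_funB => //; exact: (measurableT_comp mb (measurable_qmatvec _)).
  - by apply: measurable_funeM; apply: emeasurable_funD; [apply: emeasurable_funD|].
  move=> x _; rewrite /f1 /f2 /f3 -!EFinD -EFinM lee_fin -!mulrDl mulrA.
  rewrite ler_wpM2r ?qwt_ge0 //; apply: le_trans (powR_add3_le _ _ _ _) => //.
  apply: ge0_ler_powR; rewrite ?nnegrE ?(ltW r0) ?addr_ge0 //.
  rewrite (_ : b x - _ = (b x - m0) - (m1 - m0) - (b (qmatvec R A x) - m1)); last by ring.
  by apply: le_trans (ler_normB _ _) _; rewrite lerD2r ler_normB.
rewrite ge0_integralD //; last 3 first.
- by move=> x _; rewrite adde_ge0 // /f1 /f2.
- exact: emeasurable_funD.
- by move=> x _; rewrite /f3.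
rewrite ge0_integralD //; last 2 first.
- by move=> x _; rewrite /f1.
- by move=> x _; rewrite /f2.
have I1 := qcmo_norm_le g an r0 (ltW N0) bN.
have I2 : (\int[mu]_(x in qball R g) f2 x <= (powR (C * j%:R * N) r * qw alpha g)%:E)%E.
  have -> : (\int[mu]_(x in qball R g) f2 x = (powR `|m1 - m0| r * qw alpha g)%:E)%E.
    rewrite EFinM -(qwE g an) /qwmeas -ge0_integralZl_EFin ?powR_ge0 //.
    - by move=> x _; rewrite lee_fin qwt_ge0.
    - by apply: measurable_funTS; apply/measurable_EFinP; exact: measurable_qwt.
  rewrite lee_fin ler_wpM2r ?(ltW (qw_gt0 _ _)) //.
  apply: ge0_ler_powR; rewrite ?nnegrE ?(ltW r0) ?mulr_ge0 ?(ltW C0) ?(ltW N0) //.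
  exact: CP.
(* The power of |A| from the change of variables cancels the ratio of the masses of B_(g-j) and
   B_g. *)
have I3 : (\int[mu]_(x in qball R g) f3 x <= (C1 * powR N r * qw alpha g)%:E)%E.
  apply: le_trans (weighted_integral_qmatvec n_gt0 haar _ _ wc Aj (mpow m1) (fun=> powR_ge0 _ _)) _.
  have := qcmo_norm_le (g - j%:Z) an r0 (ltW N0) bN.
  move=> /(lee_wpmul2l (x := (C1 * powR (B ^ (- j%:Z)) (- (alpha + n%:R)))%:E)) h.
  apply: le_trans (h _) _; first by rewrite lee_fin mulr_ge0 ?powR_ge0 ?(ltW C10).
  rewrite -EFinM lee_fin qwD //.
  have B1 e : powR (B ^ (- j%:Z)) (- e) * powR (B ^ (- j%:Z)) e = 1.
    by rewrite powRN mulVf // powR_eq0 (negbTE (baseX_neq0 _)).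
  rewrite le_eqVlt; apply/orP; left; apply/eqP.
  transitivity (C1 * powR N r * qw alpha g *
    (powR (B ^ (- j%:Z)) (- (alpha + n%:R)) * powR (B ^ (- j%:Z)) (alpha + n%:R))); first by ring.
  by rewrite B1 mulr1.
apply: (@le_trans _ _ ((powR 3 r)%:E * ((powR N r * qw alpha g)%:E +
   (powR (C * j%:R * N) r * qw alpha g)%:E + (C1 * powR N r * qw alpha g)%:E))%E).
  by apply: lee_wpmul2l; [rewrite lee_fin powR_ge0|apply: leeD => //; apply: leeD].
have qg := qw_gt0 g an; have jR : 1 <= j%:R :> R by rewrite ler1n.
rewrite -!EFinD -EFinM lee_fin -!mulrDl mulrA ler_wpM2r ?(ltW qg) //.
have powRM3 c : 0 <= c -> powR (c * j%:R * N) r = powR c r * powR j%:R r * powR N r.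
  by move=> c0; rewrite !powRM ?mulr_ge0 ?(ltW N0).
rewrite !powRM3 ?powR_ge0 ?(ltW C0) // -powRrM mulVf ?gt_eqF // powRr1 ?(ltW C'0) //.
have j1 : 1 <= powR j%:R r :> R.
  by rewrite -[leLHS](powRr0 j%:R); apply: ler_powR => //; exact: ltW.
have Nr : 0 <= powR N r by exact: powR_ge0.
rewrite /C' -!mulrA ler_wpM2l ?powR_ge0 // !mulrDl mul1r !lerD //.
- by rewrite -[leLHS]mul1r ler_wpM2r.
- by rewrite ler_wpM2l ?(ltW C10) // -[leLHS]mul1r ler_wpM2r.
Qed.

End CentralMeanOscillation.
Opaque qw chvar_const.
Arguments qw {R p n} mu alpha g.

(** * Weighted inequalities *)

Section Hoelder.
Context {R : realType}.

Lemma powR_addr (a r s : R) : 0 < a -> powR a (r + s) = powR a r * powR a s.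
Proof. by move=> a0; apply: powRD; apply/implyP => _; rewrite gt_eqF. Qed.

Lemma prod_powR_sum (I : finType) (a : R) (f : I -> R) : 0 < a ->
  \prod_i powR a (f i) = powR a (\sum_i f i).
Proof.
move=> a0; apply: (big_rec2 (fun x y => x = powR a y)); first by rewrite powRr0.
by move=> i x y _ ->; rewrite powR_addr.
Qed.

Lemma powR_prod (I : finType) (f : I -> R) (s : R) : (forall i, 0 <= f i) ->
  powR (\prod_i f i) s = \prod_i powR (f i) s.
Proof.
move=> f0.
suff [] : powR (\prod_i f i) s = \prod_i powR (f i) s /\ 0 <= \prod_i f i by [].
apply: (big_rec2 (fun x y => powR x s = y /\ 0 <= x)); first by rewrite powR1.
by move=> i x y _ [<- x0]; rewrite powRM // mulr_ge0.
Qed.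

(** Each base is at most the total [S], and the exponents sum to 1. If [S] is 0, a factor is 0 to a
    positive power; m > 0 supplies that factor. *)
Lemma prod_powR_le_sum (m : nat) (a c th eta : 'I_m -> R) : (0 < m)%N ->
  (forall i, 0 <= a i) -> (forall i, 0 <= c i) ->
  (forall i, 0 < th i) -> (forall i, 0 < eta i) ->
  \sum_i th i + \sum_i eta i = 1 ->
  \prod_i powR (a i) (th i) * \prod_i powR (c i) (eta i) <= \sum_i a i + \sum_i c i.
Proof.
move=> m0 a0 c0 th0 eta0 sum1.
set S := \sum_i a i + \sum_i c i.
have sa0 : 0 <= \sum_i a i by exact: sumr_ge0.
have sc0 : 0 <= \sum_i c i by exact: sumr_ge0.
have aS i : a i <= S.
  by rewrite /S (bigD1 i) //= -addrA lerDl addr_ge0 // sumr_ge0.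
have cS i : c i <= S.
  by rewrite /S (bigD1 i (P := xpredT) (F := c)) //= addrCA lerDl addr_ge0 // sumr_ge0.
have S0 : 0 <= S by rewrite addr_ge0.
have [S00|Sneq0] := eqVneq S 0.
  rewrite S00 (bigD1 (Ordinal m0)) //= (_ : a _ = 0) ?powR0 ?mul0r ?gt_eqF //.
  by apply/eqP; rewrite eq_le a0 -{1}S00 aS.
have Spos : 0 < S by rewrite lt0r Sneq0.
apply: (@le_trans _ _ (\prod_i powR S (th i) * \prod_i powR S (eta i))).
  apply: ler_pM.
  - by apply: prodr_ge0 => i _; exact: powR_ge0.
  - by apply: prodr_ge0 => i _; exact: powR_ge0.
  - apply: ler_prod => i _; rewrite powR_ge0 /=.
    by apply: ge0_ler_powR; rewrite ?nnegrE ?(ltW (th0 i)).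
  - apply: ler_prod => i _; rewrite powR_ge0 /=.
    by apply: ge0_ler_powR; rewrite ?nnegrE ?(ltW (eta0 i)).
by rewrite !prod_powR_sum // -powR_addr // sum1 powRr1.
Qed.

End Hoelder.

(** * Morrey norms and composition with a matrix *)

Section Morrey.
Context {R : realType} {p n : nat}.
Local Notation B := ((qp_base p)%:R : R).
Local Notation T := (QpSpace R p n).
Context (mu : {measure set T -> \bar R}) (n_gt0 : (0 < n)%N) (haar : qp_haar mu).
Implicit Types (x : T) (g k : int) (A Ainv : QpMx p n) (alpha : R) (F : T -> R).

Lemma qmorrey_norm_le alpha q lambda (f : T -> R) (M : R) g :
  0 < alpha + n%:R -> 0 < q -> 0 <= M ->
  (qmorrey_norm mu alpha q lambda (EFin \o f) <= M%:E)%E ->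
  (\int[mu]_(x in qball R g) (powR `|f x| q * qwt R alpha x)%:E <=
   (powR M q * powR (qw mu alpha g) (1 + lambda * q))%:E)%E.
Proof.
move=> an q0 M0 fM; set I := (X in (X <= _)%E).
have I0 : (0 <= I)%E.
  by apply: integral_ge0 => x _; rewrite lee_fin mulr_ge0 ?powR_ge0 ?qwt_ge0.
have qw0 := qw_gt0 n_gt0 haar g an.
have : (poweR ((powR (qw mu alpha g) (- 1 - lambda * q))%:E * I) q^-1 <= M%:E)%E.
  apply: le_trans fM; apply: ereal_sup_ubound; exists g => //.
  by rewrite (qwE n_gt0 haar g an).
have X0 : (0 <= (powR (qw mu alpha g) (- 1 - lambda * q))%:E * I)%E.
  by rewrite mule_ge0 // lee_fin powR_ge0.
move=> /(gt0_ler_poweR (ltW q0)); rewrite -poweRrM mulVf ?gt_eqF // poweRe1 // poweR_EFin.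
rewrite -opprD powRN lee_pdivrMl ?powR_gt0 // -EFinM [_ * powR M q]mulrC; apply.
  by rewrite in_itv /= poweR_ge0 leey.
by rewrite in_itv /= lee_fin M0 leey.
Qed.

(** Converse of [qmorrey_norm_le]. Here [h] has extended real values because it will be the image
    under the operator, whose integral may be infinite at some points. *)
Lemma qmorrey_norm_bound alpha q lambda (h : T -> \bar R) (L : R) :
  0 < alpha + n%:R -> 0 < q -> 0 <= L ->
  (forall g, (\int[mu]_(x in qball R g) (poweR `|h x| q * (qwt R alpha x)%:E) <=
    (powR L q * powR (qw mu alpha g) (1 + lambda * q))%:E)%E) ->
  (qmorrey_norm mu alpha q lambda h <= L%:E)%E.
Proof.
move=> an q_gt0 L0 hL; apply: ge_ereal_sup => _ [g _ <-].
have qg := qw_gt0 n_gt0 haar g an.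
rewrite (qwE n_gt0 haar g an) poweR_EFin.
have -> : L%:E = poweR (powR L q)%:E q^-1.
  by rewrite poweR_EFin -powRrM divff ?gt_eqF // powRr1.
have I0 : (0 <= \int[mu]_(x in qball R g) (poweR `|h x| q * (qwt R alpha x)%:E))%E.
  by apply: integral_ge0 => x _; apply: mule_ge0; [exact: poweR_ge0|rewrite lee_fin qwt_ge0].
apply: gt0_ler_poweR; rewrite ?in_itv /= ?leey ?andbT ?lee_fin ?powR_ge0 ?invr_ge0 ?(ltW q_gt0) //.
  by apply: mule_ge0 => //; rewrite lee_fin powR_ge0.
by rewrite -opprD powRN lee_pdivrMl ?powR_gt0 // -EFinM [_ * powR L q]mulrC.
Qed.

(** The mass of B_(g+k) to the power 1 + lambda q absorbs the factor |A|^(-(alpha + n)) of the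
    change of variables and leaves |A|^((alpha + n) lambda q). The bound is written as a q-th power
    times the mass of B_g, the form that [weighted_hoelder] takes. *)
Lemma qmorrey_qmatvec nu alpha q lambda (f : T -> R) (M : R) g k A Ainv :
  0 < alpha + n%:R -> 0 < q -> 0 <= M -> measurable_fun [set: T] f ->
  (qmorrey_norm mu alpha q lambda (EFin \o f) <= M%:E)%E ->
  well_conditioned R nu A Ainv -> qnormm R A = B ^ k ->
  (\int[mu]_(x in qball R g) (powR `|f (qmatvec R A x)| q * qwt R alpha x)%:E <=
   (powR (powR (@chvar_const R p n nu alpha) q^-1 * M * powR (qw mu alpha g) lambda *
          powR (B ^ k) ((alpha + n%:R) * lambda)) q * qw mu alpha g)%:E)%E.
Proof.
move=> an q0 M0 mf fM wc Ak; set C := chvar_const nu alpha.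
have C0 : 0 < C by exact: chvar_const_gt0.
have mfq : measurable_fun [set: T] (fun x => powR `|f x| q).
  by apply: (measurableT_comp (measurable_powR q)); exact: measurableT_comp.
apply: le_trans (weighted_integral_qmatvec n_gt0 haar _ _ wc Ak mfq (fun=> powR_ge0 _ _)) _.
apply: (@le_trans _ _ ((C * powR (B ^ k) (- (alpha + n%:R)))%:E *
    (powR M q * powR (qw mu alpha (g + k)) (1 + lambda * q))%:E)%E).
  apply: lee_wpmul2l; first by rewrite lee_fin mulr_ge0 ?powR_ge0 ?(ltW C0).
  exact: qmorrey_norm_le.
have Bk := @baseX_gt0 R p k; have qg := qw_gt0 n_gt0 haar g an.
rewrite -EFinM lee_fin (qwD n_gt0 haar) // !powRM ?powR_ge0 ?mulr_ge0 ?powR_ge0 ?(ltW qg) //.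
rewrite -(powRrM C) mulVf ?gt_eqF // (powRr1 (ltW C0)) -!powRrM.
have -> : powR (qw mu alpha g) (1 + lambda * q) = qw mu alpha g * powR (qw mu alpha g) (lambda * q).
  by rewrite powR_addr // powRr1 // ltW.
have -> : powR (B ^ k) ((alpha + n%:R) * (1 + lambda * q)) =
   powR (B ^ k) (alpha + n%:R) * powR (B ^ k) ((alpha + n%:R) * lambda * q).
  by rewrite -powR_addr //; congr powR; ring.
have B1 : powR (B ^ k) (- (alpha + n%:R)) * powR (B ^ k) (alpha + n%:R) = 1.
  by rewrite powRN mulVf // powR_eq0 (negbTE (baseX_neq0 _)).
rewrite le_eqVlt; apply/orP; left; apply/eqP.
transitivity (C * powR M q * (qw mu alpha g * powR (qw mu alpha g) (lambda * q)) *
   powR (B ^ k) ((alpha + n%:R) * lambda * q) *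
   (powR (B ^ k) (- (alpha + n%:R)) * powR (B ^ k) (alpha + n%:R))); first by ring.
by rewrite B1; ring.
Qed.

End Morrey.

(** Algebra for [weighted_hoelder]: [U] and [V] stand for norms, [W] for masses of the ball and [w]
    for weights at a point. A normalized term to the power q / rs i contributes t^q U^(-q), since
    the exponent rs i meets q / rs i. *)
Lemma prod_powR_normalized {R : realType} (m : nat) (q : R) (rs qs t s U V w W : 'I_m -> R) :
  (forall i, 0 < rs i) -> (forall i, 0 < qs i) -> (forall i, 0 <= t i) -> (forall i, 0 <= s i) ->
  (forall i, 0 < U i) -> (forall i, 0 < V i) -> (forall i, 0 < w i) -> (forall i, 0 < W i) ->
  \prod_i powR ((powR (U i) (rs i) * W i)^-1 * (powR (t i) (rs i) * w i)) (q / rs i) *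
  \prod_i powR ((powR (V i) (qs i) * W i)^-1 * (powR (s i) (qs i) * w i)) (q / qs i) =
  powR (\prod_i t i * \prod_i s i) q * powR (\prod_i U i * \prod_i V i) (- q) *
  \prod_i powR (w i / W i) (q / rs i + q / qs i).
Proof.
move=> rs0 qs0 t0 s0 U0 V0 w0 W0.
have powE x y e c d : 0 < y -> 0 <= x -> 0 < e -> 0 < c -> 0 < d ->
    powR ((powR y e * d)^-1 * (powR x e * c)) (q / e) =
    powR x q * powR y (- q) * powR (c / d) (q / e).
  move=> y0 x0 e0 c0 d0; have eq : e * (q / e) = q by rewrite mulrC divfK // gt_eqF.
  have -> : (powR y e * d)^-1 * (powR x e * c) = powR x e * (powR y e)^-1 * (c / d).
    by field; rewrite powR_eq0 !gt_eqF.
  rewrite !(powRM (q / e)) ?mulr_ge0 ?invr_ge0 ?powR_ge0 ?(ltW d0) ?(ltW c0) //.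
  by rewrite powR_invr ?powR_ge0 // -!powRrM mulrN eq.
have tE i := powE (t i) (U i) (rs i) (w i) (W i) (U0 i) (t0 i) (rs0 i) (w0 i) (W0 i).
have sE i := powE (s i) (V i) (qs i) (w i) (W i) (V0 i) (s0 i) (qs0 i) (w0 i) (W0 i).
transitivity (
  \prod_i (powR (t i) q * powR (U i) (- q) * powR (w i / W i) (q / rs i)) *
  \prod_i (powR (s i) q * powR (V i) (- q) * powR (w i / W i) (q / qs i))).
  by congr (_ * _); apply: eq_bigr => i _; [exact: tE|exact: sE].
have -> : \prod_i powR (w i / W i) (q / rs i + q / qs i) =
    \prod_i powR (w i / W i) (q / rs i) * \prod_i powR (w i / W i) (q / qs i).
  by rewrite -big_split; apply: eq_bigr => i _ /=; rewrite powR_addr // divr_gt0.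
have p0 (f : 'I_m -> R) : (forall i, 0 < f i) -> 0 <= \prod_i f i.
  by move=> f0; apply: prodr_ge0 => i _; exact: ltW.
have p0' (f : 'I_m -> R) : (forall i, 0 <= f i) -> 0 <= \prod_i f i.
  by move=> f0; apply: prodr_ge0.
rewrite (powRM q (p0' _ t0) (p0' _ s0)) (powRM (- q) (p0 _ U0) (p0 _ V0)).
rewrite (powR_prod q t0) (powR_prod q s0).
rewrite (powR_prod (- q) (fun i => ltW (U0 i))) (powR_prod (- q) (fun i => ltW (V0 i))).
by rewrite !big_split /=; ring.
Qed.

(** * Hoelder's inequality for 2m functions with power weights *)

Section WeightedHoelder.
Context {R : realType} {p n m : nat}.
Local Notation B := ((qp_base p)%:R : R).
Local Notation T := (QpSpace R p n).
Context (mu : {measure set T -> \bar R}) (n_gt0 : (0 < n)%N) (haar : qp_haar mu).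
Context (q alpha : R) (qs rs alphas : 'I_m -> R).
Context (m_gt0 : (0 < m)%N) (q_gt0 : 0 < q).
Context (qs_gt0 : forall i, 0 < qs i) (rs_gt0 : forall i, 0 < rs i).
Context (alphas_gt : forall i, 0 < alphas i + n%:R).
Context (sum_exponents : \sum_(i < m) (qs i)^-1 + \sum_(i < m) (rs i)^-1 = q^-1).
Context (sum_weights :
  \sum_(i < m) alphas i / qs i + \sum_(i < m) alphas i / rs i = alpha / q).
Implicit Types (x : T) (g : int).

(** The exponent of the i-th weight in the product. The [e i] sum to 1 and average the [alphas i] to
    [alpha], so alpha + n is a convex combination of the alphas i + n. *)
Let e i := q / rs i + q / qs i.

Let sum_e : \sum_i e i = 1.
Proof.
by rewrite big_split /= -!mulr_sumr -mulrDr addrC sum_exponents divff // gt_eqF.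
Qed.

Let sum_alpha_e : \sum_i alphas i * e i = alpha.
Proof.
transitivity (q * (\sum_(i < m) alphas i / qs i + \sum_(i < m) alphas i / rs i)).
  rewrite -big_split mulr_sumr /=; apply: eq_bigr => i _; rewrite /e; ring.
by rewrite sum_weights mulrC divfK // gt_eqF.
Qed.

Let e_gt0 i : 0 < e i.
Proof. by rewrite addr_gt0 ?divr_gt0. Qed.

Let sum_an_e : \sum_i (alphas i + n%:R) * e i = alpha + n%:R.
Proof.
under eq_bigr do rewrite mulrDl.
by rewrite big_split /= sum_alpha_e -mulr_sumr sum_e mulr1.
Qed.

Lemma weight_exponent_gt0 : 0 < alpha + n%:R.
Proof.
rewrite -sum_an_e (bigD1 (Ordinal m_gt0)) //=.
apply: ltr_pwDl; first by rewrite mulr_gt0.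
by apply: sumr_ge0 => i _; rewrite mulr_ge0 // ltW.
Qed.

Let qw_baseE a g : 0 < a + n%:R -> qw mu a g = qw mu a 0 * powR (B ^ g) (a + n%:R).
Proof. by move=> an; rewrite -[in LHS](add0r g) (qwD n_gt0 haar). Qed.

(** The powers of p^g match because the (alphas i + n) e i sum to alpha + n; [K] involves only
    masses of the unit ball. *)
Lemma weight_product : exists2 K : R, 0 < K & forall g x, x <> qv0 ->
  \prod_i powR (qwt R (alphas i) x / qw mu (alphas i) g) (e i) =
  K * (qwt R alpha x / qw mu alpha g).
Proof.
have an := weight_exponent_gt0.
pose K0 := \prod_i powR (qw mu (alphas i) 0) (- e i).
have k0 := qw_gt0 n_gt0 haar 0 an.
exists (K0 * qw mu alpha 0) => [|g x x0].
  apply: mulr_gt0 => //; apply: prodr_gt0 => i _; apply: powR_gt0.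
  exact: (qw_gt0 n_gt0 haar).
have xg := qnormv_gt0 (R := R) x0; have Bg := @baseX_gt0 R p g.
transitivity (\prod_i (powR (qnormv R x) (alphas i * e i) * powR (qw mu (alphas i) 0) (- e i) *
    powR (B ^ g) (- ((alphas i + n%:R) * e i)))).
  apply: eq_bigr => i _.
  have qi : 0 <= qw mu (alphas i) 0 := ltW (qw_gt0 n_gt0 haar 0 (alphas_gt i)).
  have Gi := powR_ge0 (B ^ g) (alphas i + n%:R).
  have inv0 : 0 <= (qw mu (alphas i) 0 * powR (B ^ g) (alphas i + n%:R))^-1.
    by rewrite invr_ge0; exact: mulr_ge0.
  rewrite (qw_baseE g (alphas_gt i)) (powRM (e i) (qwt_ge0 (alphas i) x) inv0).
  rewrite (powR_invr (e i) (mulr_ge0 qi Gi)) (powRM (- e i) qi Gi).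
  by rewrite /qwt -!powRrM mulrN mulrA.
rewrite !big_split /= !prod_powR_sum // sum_alpha_e sumrN sum_an_e powRN (qw_baseE g an) /qwt.
rewrite -/K0; field.
by rewrite powR_eq0 !gt_eqF.
Qed.

Lemma weighted_hoelder : exists2 C : R, 0 < C &
  forall (u v : 'I_m -> T -> R) (U V : 'I_m -> R) g,
    (forall i, measurable_fun [set: T] (u i)) -> (forall i, measurable_fun [set: T] (v i)) ->
    (forall i x, 0 <= u i x) -> (forall i x, 0 <= v i x) ->
    (forall i, 0 < U i) -> (forall i, 0 < V i) ->
    (forall i, (\int[mu]_(x in qball R g) (powR (u i x) (rs i) * qwt R (alphas i) x)%:E <=
      (powR (U i) (rs i) * qw mu (alphas i) g)%:E)%E) ->
    (forall i, (\int[mu]_(x in qball R g) (powR (v i x) (qs i) * qwt R (alphas i) x)%:E <=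
      (powR (V i) (qs i) * qw mu (alphas i) g)%:E)%E) ->
    (\int[mu]_(x in qball R g) (powR (\prod_i u i x * \prod_i v i x) q * qwt R alpha x)%:E <=
      (C * powR (\prod_i U i * \prod_i V i) q * qw mu alpha g)%:E)%E.
Proof.
have an := weight_exponent_gt0.
have [K K0 KP] := weight_product.
(* Each of the 2m normalized functions [a i] and [c i] below has integral at most 1 over the ball,
   and [K] converts the product of the normalized weights into the weight of exponent [alpha]. *)
exists (K^-1 * (m + m)%:R) => [|u v U V g mu_ mv u0 v0 U0 V0 uU vV].
  by rewrite mulr_gt0 ?invr_gt0 // ltr0n addn_gt0 m_gt0.
have mball := @measurable_qball R p n g.
have qg := qw_gt0 n_gt0 haar g an.
pose a i x := (powR (U i) (rs i) * qw mu (alphas i) g)^-1 * (powR (u i x) (rs i) * qwt R (alphas i) x).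
pose c i x := (powR (V i) (qs i) * qw mu (alphas i) g)^-1 * (powR (v i x) (qs i) * qwt R (alphas i) x).
have D0 s W i : 0 < W -> 0 < (powR W s * qw mu (alphas i) g)^-1.
  move=> W0; rewrite invr_gt0; apply: mulr_gt0; first exact: powR_gt0.
  exact: (qw_gt0 n_gt0 haar).
have a0 i x : 0 <= a i x by rewrite mulr_ge0 ?mulr_ge0 ?powR_ge0 ?qwt_ge0 // ltW // D0.
have c0 i x : 0 <= c i x by rewrite mulr_ge0 ?mulr_ge0 ?powR_ge0 ?qwt_ge0 // ltW // D0.
have mw s (F : T -> R) i : measurable_fun [set: T] F ->
    measurable_fun [set: T] (fun x => powR (F x) s * qwt R (alphas i) x).
  move=> mF; apply: measurable_funM; last exact: measurable_qwt.
  exact: (measurableT_comp (measurable_powR s) mF).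
have ma i : measurable_fun [set: T] (a i) by apply: measurable_funM => //; exact: mw.
have mc i : measurable_fun [set: T] (c i) by apply: measurable_funM => //; exact: mw.
have Ia i : (\int[mu]_(x in qball R g) (a i x)%:E <= 1)%E.
  under eq_integral do rewrite EFinM.
  rewrite ge0_integralZl_EFin ?(ltW (D0 _ _ _ _)) //; last 2 first.
  - by move=> x _; rewrite lee_fin mulr_ge0 ?powR_ge0 ?qwt_ge0.
  - by apply: measurable_funTS; apply/measurable_EFinP; exact: mw.
  by rewrite lee_pdivrMl ?mule1 // -invr_gt0 D0.
have Ic i : (\int[mu]_(x in qball R g) (c i x)%:E <= 1)%E.
  under eq_integral do rewrite EFinM.
  rewrite ge0_integralZl_EFin ?(ltW (D0 _ _ _ _)) //; last 2 first.
  - by move=> x _; rewrite lee_fin mulr_ge0 ?powR_ge0 ?qwt_ge0.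
  - by apply: measurable_funTS; apply/measurable_EFinP; exact: mw.
  by rewrite lee_pdivrMl ?mule1 // -invr_gt0 D0.
pose L := powR (\prod_i U i * \prod_i V i) q * qw mu alpha g / K.
have UV0 : 0 < \prod_i U i * \prod_i V i by rewrite mulr_gt0 // prodr_gt0.
have L0 : 0 < L by rewrite !mulr_gt0 ?powR_gt0 ?invr_gt0.
apply: (@le_trans _ _ (\int[mu]_(x in qball R g)
    (L%:E * (\sum_(i < m) (a i x)%:E + \sum_(i < m) (c i x)%:E)))%E).
  apply: ae_ge0_le_integral => //.
  - by move=> x _; rewrite lee_fin mulr_ge0 ?powR_ge0 ?qwt_ge0.
  - apply: measurable_funTS; apply/measurable_EFinP; apply: measurable_funM; last exact: measurable_qwt.
    apply: (measurableT_comp (measurable_powR q)); by apply: measurable_funM; apply: measurable_prod => i _.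
  - move=> x _; rewrite mule_ge0 ?lee_fin ?(ltW L0) // adde_ge0 // sume_ge0 // => i _.
      by rewrite lee_fin.
    by rewrite lee_fin.
  - apply: measurable_funTS; apply: measurable_funeM.
    by apply: emeasurable_funD; apply: emeasurable_sum => i; exact/measurable_EFinP.
  apply: filterS (ae_neq_qv0 n_gt0 haar) => x x0 _.
  rewrite !sumEFin -EFinD -EFinM lee_fin.
  have th i : 0 < q / rs i by rewrite divr_gt0.
  have eta i : 0 < q / qs i by rewrite divr_gt0.
  have sum1 : \sum_i q / rs i + \sum_i q / qs i = 1 by rewrite -big_split.
  apply: (@le_trans _ _ (L * (\prod_i powR (a i x) (q / rs i) * \prod_i powR (c i x) (q / qs i)))).
    2: by rewrite ler_pM2l //; exact: prod_powR_le_sum.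
  rewrite le_eqVlt; apply/orP; left; apply/eqP.
  rewrite /a /c (prod_powR_normalized _ rs_gt0 qs_gt0 (u0^~ x) (v0^~ x) U0 V0); last 2 first.
  - by move=> i; rewrite powR_gt0 // qnormv_gt0.
  - by move=> i; exact: (qw_gt0 n_gt0 haar).
  rewrite (KP g x x0) powRN /L; field.
  by rewrite powR_eq0 !gt_eqF.
rewrite ge0_integralZl_EFin ?(ltW L0) //; last 2 first.
- by move=> x _; rewrite adde_ge0 // sume_ge0 // => i _; rewrite lee_fin.
- apply: measurable_funTS.
  by apply: emeasurable_funD; apply: emeasurable_sum => i; exact/measurable_EFinP.
rewrite ge0_integralD //; last 4 first.
- by move=> x _; rewrite sume_ge0 // => i _; rewrite lee_fin.
- by apply: measurable_funTS; apply: emeasurable_sum => i; exact/measurable_EFinP.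
- by move=> x _; rewrite sume_ge0 // => i _; rewrite lee_fin.
- by apply: measurable_funTS; apply: emeasurable_sum => i; exact/measurable_EFinP.
rewrite !ge0_integral_sum //; last 4 first.
- by move=> i; apply: measurable_funTS; exact/measurable_EFinP.
- by move=> i x _; rewrite lee_fin.
- by move=> i; apply: measurable_funTS; exact/measurable_EFinP.
- by move=> i x _; rewrite lee_fin.
apply: (@le_trans _ _ (L%:E * (m + m)%:R%:E)%E); last first.
  by rewrite -EFinM lee_fin le_eqVlt; apply/orP; left; apply/eqP; rewrite /L; ring.
apply: lee_wpmul2l; first by rewrite lee_fin ltW.
rewrite natrD EFinD; apply: leeD.
  apply: (@le_trans _ _ (\sum_(i < m) 1%:E)%E); first exact: lee_sum.
  by rewrite sumEFin sumr_const card_ord.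
apply: (@le_trans _ _ (\sum_(i < m) 1%:E)%E); first exact: lee_sum.
by rewrite sumEFin sumr_const card_ord.
Qed.

End WeightedHoelder.

(** * Minkowski's integral inequality up to a constant *)

Section MinkowskiIntegral.
Context {R : realType}.

(** The two terms on the right are equal at s = (X / M)^(1/q); there H <= 2 s M, and s^q M^q =
    M^(q-1) X. *)
Lemma poweR_le_scaling (q M : R) (H X : \bar R) : 1 <= q -> 0 < M -> (0 <= H)%E -> (0 <= X)%E ->
  (forall s : R, 0 < s -> (H <= (powR s (1 - q))%:E * X + (s * M)%:E)%E) ->
  (poweR H q <= (powR 2 q * powR M (q - 1))%:E * X)%E.
Proof.
move=> q1 M0 H0 X0 HX; have q0 : 0 < q by apply: lt_le_trans q1.
have c0 : 0 < powR 2 q * powR M (q - 1) by rewrite mulr_gt0 ?powR_gt0.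
case: X X0 HX => [x| |] // X0 HX; last by rewrite gt0_muley ?lte_fin // leey.
rewrite lee_fin in X0.
have Hfin : H \is a fin_num.
  by rewrite ge0_fin_numE // (le_lt_trans (HX 1 ltr01)) // -EFinM -EFinD ltry.
case: H Hfin H0 HX => [h| |] // _ h0 HX; rewrite lee_fin in h0.
rewrite poweR_EFin -EFinM lee_fin.
have hs s : 0 < s -> h <= powR s (1 - q) * x + s * M.
  by move=> s0; have := HX s s0; rewrite -EFinM -EFinD lee_fin.
(* No positive s balances the terms if X is 0; letting s tend to 0 then gives H = 0. *)
have [x0|xpos] := leP x 0.
  have xE : x = 0 by apply/eqP; rewrite eq_le x0 X0.
  have h_le0 : h <= 0.
    apply/ler_addgt0Pr => e e0; rewrite add0r.
    have := hs (e / M) (divr_gt0 e0 M0).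
    by rewrite xE mulr0 add0r divfK // gt_eqF.
  have -> : h = 0 by apply/eqP; rewrite eq_le h_le0 h0.
  by rewrite xE mulr0 powR0 // gt_eqF.
pose s := powR (x / M) q^-1.
have s0 : 0 < s by rewrite powR_gt0 // divr_gt0.
have sq : powR s q = x / M by rewrite /s -powRrM mulVf ?gt_eqF // powRr1 // divr_ge0 // ltW.
have sx : powR s (1 - q) * x = s * M.
  rewrite powR_addr // powRr1 ?(ltW s0) // powRN sq invf_div; field; by rewrite gt_eqF.
have h2 : h <= 2 * (s * M).
  by apply: le_trans (hs s s0) _; rewrite sx; lra.
apply: (@le_trans _ _ (powR (2 * (s * M)) q)).
  by apply: ge0_ler_powR; rewrite ?nnegrE ?(ltW q0) ?mulr_ge0 ?(ltW s0) ?(ltW M0).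
rewrite !powRM ?mulr_ge0 ?(ltW s0) ?(ltW M0) // sq -(mulr_powRB1 (ltW M0) q0).
by rewrite le_eqVlt; apply/orP; left; apply/eqP; field; rewrite gt_eqF.
Qed.

Context d1 d2 (X : measurableType d1) (Y : measurableType d2).
Context (m1 : {sigma_finite_measure set X -> \bar R}).
Context (m2 : {sigma_finite_measure set Y -> \bar R}).

(* A form of Minkowski's integral inequality: the slice norms are only dominated, by [D]. *)
Lemma minkowski_integral (q M S : R) (P : X * Y -> R) (phi D : Y -> R) (w : X -> R) :
  1 <= q -> 0 < M -> 0 <= S ->
  measurable_fun [set: X * Y] P -> measurable_fun [set: Y] phi ->
  measurable_fun [set: Y] D -> measurable_fun [set: X] w ->
  (forall z, 0 <= P z) -> (forall y, 0 <= phi y) -> (forall y, 0 <= D y) -> (forall x, 0 <= w x) ->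
  {ae m2, forall y, phi y != 0 -> 0 < D y /\
    (\int[m1]_x (powR (P (x, y)) q * w x)%:E <= (powR (D y) q * S)%:E)%E} ->
  (\int[m2]_y (phi y * D y)%:E <= M%:E)%E ->
  (\int[m1]_x (poweR (\int[m2]_y (phi y * P (x, y))%:E) q * (w x)%:E) <=
   (powR 2 q * powR M q * S)%:E)%E.
Proof.
move=> q1 M0 S0 mP mphi mD mw P0 phi0 D0 w0 aeD phiD.
have q0 : 0 < q by apply: lt_le_trans q1.
(* Under the integral in x, P^q becomes at most D^q S, and D^(1-q) D^q = D brings back the integrand
   phi D. *)
pose Q (z : X * Y) := phi z.2 * (powR (P z) q * powR (D z.2) (1 - q)).
have Q0 z : 0 <= Q z by rewrite !mulr_ge0 ?powR_ge0.
have mphi2 : measurable_fun [set: X * Y] (fun z => phi z.2) by exact: measurableT_comp.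
have mD2 : measurable_fun [set: X * Y] (fun z => D z.2) by exact: measurableT_comp.
have mw1 : measurable_fun [set: X * Y] (fun z => w z.1) by exact: measurableT_comp.
have mQ : measurable_fun [set: X * Y] Q.
  apply: measurable_funM => //; apply: measurable_funM.
    exact: (measurableT_comp (measurable_powR q) mP).
  exact: (measurableT_comp (measurable_powR (1 - q)) mD2).
have mPy x : measurable_fun [set: Y] (fun y => P (x, y)) by exact: measurable_fun_pair2.
have mQy x : measurable_fun [set: Y] (fun y => Q (x, y)) by exact: measurable_fun_pair2.
pose H x := (\int[m2]_y (phi y * P (x, y))%:E)%E.
pose XI x := (\int[m2]_y (Q (x, y))%:E)%E.
pose c := powR 2 q * powR M (q - 1).
have c0 : 0 <= c by rewrite mulr_ge0 ?powR_ge0.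
have H0 x : (0 <= H x)%E by apply: integral_ge0 => y _; rewrite lee_fin mulr_ge0.
have XI0 x : (0 <= XI x)%E by apply: integral_ge0 => y _; rewrite lee_fin.
have HX x : (poweR (H x) q <= c%:E * XI x)%E.
  apply: poweR_le_scaling => // s s0.
  apply: (@le_trans _ _ (\int[m2]_y ((powR s (1 - q))%:E * (Q (x, y))%:E + s%:E * (phi y * D y)%:E))%E).
    apply: ae_ge0_le_integral => //.
    - by move=> y _; rewrite lee_fin mulr_ge0.
    - by apply/measurable_EFinP; apply: measurable_funM.
    - move=> y _; apply: adde_ge0.
        by rewrite -EFinM lee_fin mulr_ge0 ?powR_ge0 ?Q0.
      by rewrite -EFinM lee_fin; apply: mulr_ge0; [exact: ltW|exact: mulr_ge0].
    - apply: emeasurable_funD; apply: measurable_funeM; apply/measurable_EFinP => //.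
      exact: measurable_funM.
    apply: filterS aeD => y Dy _; rewrite -!EFinM -EFinD lee_fin /Q /=.
    have [->|phiy] := eqVneq (phi y) 0; first by rewrite !mul0r !mulr0 addr0.
    have [Dpos _] := Dy phiy; have sD : 0 < s * D y by rewrite mulr_gt0.
    (* If P <= s D the last term suffices. Otherwise P = P^q P^(1-q), and 1 - q <= 0 gives P^(1-q)
       <= (s D)^(1-q). *)
    have PsD : P (x, y) <= powR s (1 - q) * (powR (P (x, y)) q * powR (D y) (1 - q)) + s * D y.
      have [PD|DP] := leP (P (x, y)) (s * D y).
        by rewrite -[leLHS]add0r lerD // !mulr_ge0 ?powR_ge0.
      rewrite -[leLHS]addr0 lerD ?(ltW sD) //.
      have Ppos := lt_trans sD DP.
      rewrite mulrCA -powRM ?(ltW s0) //.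
      have {1}-> : P (x, y) = powR (P (x, y)) q * powR (P (x, y)) (1 - q).
        by rewrite -powR_addr // addrC subrK powRr1 // ltW.
      rewrite ler_wpM2l ?powR_ge0 // -opprB !powRN lef_pV2 ?posrE ?powR_gt0 //.
      by apply: ge0_ler_powR; rewrite ?nnegrE ?subr_ge0 ?(ltW sD) ?(ltW DP).
    apply: le_trans (ler_wpM2l (phi0 y) PsD) _.
    by rewrite le_eqVlt; apply/orP; left; apply/eqP; ring.
  rewrite ge0_integralD //; last 4 first.
  - by move=> y _; rewrite -EFinM lee_fin mulr_ge0 ?powR_ge0 ?Q0.
  - by apply: measurable_funeM; exact/measurable_EFinP.
  - by move=> y _; rewrite -EFinM lee_fin; apply: mulr_ge0; [exact: ltW|exact: mulr_ge0].
  - by apply: measurable_funeM; apply/measurable_EFinP; exact: measurable_funM.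
  have mphiD : measurable_fun [set: Y] (fun y => (phi y * D y)%:E).
    by apply/measurable_EFinP; exact: measurable_funM.
  rewrite !ge0_integralZl_EFin ?powR_ge0 ?(ltW s0) //; last 3 first.
  - by move=> y _; rewrite lee_fin mulr_ge0.
  - by move=> y _; rewrite lee_fin.
  - exact/measurable_EFinP.
  by apply: leeD => //; rewrite EFinM; apply: lee_wpmul2l => //; rewrite lee_fin ltW.
pose F (z : X * Y) := ((Q z) * w z.1)%:E.
have mF : measurable_fun [set: X * Y] F by apply/measurable_EFinP; exact: measurable_funM.
have F0 z : (0 <= F z)%E by rewrite lee_fin mulr_ge0.
have mXI : measurable_fun [set: X] XI.
  apply: (@measurable_fun_fubini_tonelli_F _ _ _ _ _ m2 (fun z => (Q z)%:E)).
    exact/measurable_EFinP.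
  by move=> z; rewrite lee_fin.
have mH : measurable_fun [set: X] H.
  apply: (@measurable_fun_fubini_tonelli_F _ _ _ _ _ m2 (fun z => (phi z.2 * P z)%:E)).
    by apply/measurable_EFinP; exact: measurable_funM.
  by move=> z; rewrite lee_fin mulr_ge0.
have mwE : measurable_fun [set: X] (fun x => (w x)%:E) by exact/measurable_EFinP.
apply: (@le_trans _ _ (\int[m1]_x (c%:E * (XI x * (w x)%:E)))%E).
  apply: ge0_le_integral => //.
  - by move=> x _; apply: mule_ge0; [exact: poweR_ge0|rewrite lee_fin].
  - by apply: emeasurable_funM => //; exact: (measurableT_comp (measurable_poweR q) mH).
  - by apply: measurable_funeM; exact: emeasurable_funM.
  - by move=> x _; rewrite muleA; apply: lee_wpmul2r; [rewrite lee_fin|exact: HX].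
rewrite ge0_integralZl_EFin //; last 2 first.
- by move=> x _; apply: mule_ge0 => //; rewrite lee_fin.
- exact: emeasurable_funM.
have -> : (\int[m1]_x (XI x * (w x)%:E) = \int[m1]_x \int[m2]_y F (x, y))%E.
  apply: eq_integral => x _; rewrite /XI muleC -ge0_integralZl_EFin //.
  - by apply: eq_integral => y _; rewrite /F /= -EFinM mulrC.
  - by move=> y _; rewrite lee_fin.
  - exact/measurable_EFinP.
rewrite fubini_tonelli //.
apply: (@le_trans _ _ (c%:E * \int[m2]_y (S%:E * (phi y * D y)%:E))%E).
  apply: lee_wpmul2l => //; apply: ae_ge0_le_integral => //.
  - by move=> y _; apply: integral_ge0.
  - exact: measurable_fun_fubini_tonelli_G.
  - by move=> y _; apply: mule_ge0; rewrite lee_fin // mulr_ge0.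
  - by apply: measurable_funeM; apply/measurable_EFinP; exact: measurable_funM.
  apply: filterS aeD => y Dy _.
  have [phiy|phiy] := eqVneq (phi y) 0.
    rewrite phiy mul0r mule0 integral0_eq // => x _.
    by rewrite /F /Q /= phiy !mul0r.
  have [Dpos PD] := Dy phiy.
  have -> : (\int[m1]_x F (x, y) = (phi y * powR (D y) (1 - q))%:E *
      \int[m1]_x (powR (P (x, y)) q * w x)%:E)%E.
    rewrite -ge0_integralZl_EFin ?mulr_ge0 ?powR_ge0 //.
    - by apply: eq_integral => x _; rewrite /F /Q /= -EFinM; congr EFin; ring.
    - by move=> x _; rewrite lee_fin mulr_ge0 ?powR_ge0.
    - apply/measurable_EFinP; apply: measurable_funM => //.
      apply: (measurableT_comp (measurable_powR q)); exact: measurable_fun_pair1.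
  apply: (@le_trans _ _ ((phi y * powR (D y) (1 - q))%:E * (powR (D y) q * S)%:E)%E).
    by apply: lee_wpmul2l => //; rewrite lee_fin mulr_ge0 ?powR_ge0.
  rewrite -!EFinM lee_fin le_eqVlt; apply/orP; left; apply/eqP.
  have DE : powR (D y) (1 - q) * powR (D y) q = D y.
    by rewrite -powR_addr // subrK powRr1 // ltW.
  transitivity (phi y * (powR (D y) (1 - q) * powR (D y) q) * S); first by ring.
  by rewrite DE; ring.
rewrite ge0_integralZl_EFin //; last 2 first.
- by move=> y _; rewrite lee_fin mulr_ge0.
- by apply/measurable_EFinP; exact: measurable_funM.
apply: (@le_trans _ _ (c%:E * (S%:E * M%:E))%E).
  by apply: lee_wpmul2l => //; apply: lee_wpmul2l.
rewrite -!EFinM lee_fin /c -(mulr_powRB1 (ltW M0) q0).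
by rewrite le_eqVlt; apply/orP; left; apply/eqP; ring.
Qed.

End MinkowskiIntegral.

Section SigmaFinite.
Context {R : realType} {p n : nat}.
Local Notation T := (QpSpace R p n).
Context (mu : {measure set T -> \bar R}).

(** An alias of [mu] that takes the proofs as parameters, so that sigma-finiteness, required by
    Tonelli's theorem, can be declared as a canonical instance. *)
Definition haar_sfinite (n_gt0 : (0 < n)%N) (haar : qp_haar mu) : set T -> \bar R := mu.

Context (n_gt0 : (0 < n)%N) (haar : qp_haar mu).

HB.instance Definition _ := isMeasure.Build _ _ _ (haar_sfinite n_gt0 haar)
  (measure0 mu) (measure_ge0 mu) (@measure_semi_sigma_additive _ _ _ mu).

HB.instance Definition _ := Measure_isSigmaFinite.Build _ _ _ (haar_sfinite n_gt0 haar)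
  (haar_sigma_finite n_gt0 haar).

End SigmaFinite.

(** * The Hausdorff operator *)

Section HausdorffOperator.
Context {R : realType} {p n m : nat}.
Local Notation B := ((qp_base p)%:R : R).
Local Notation T := (QpSpace R p n).
Context (mu : {measure set T -> \bar R}) (n_gt0 : (0 < n)%N) (haar : qp_haar mu).
Implicit Types (A Ainv : 'I_m -> T -> QpMx p n) (Phi : T -> R) (b f : 'I_m -> T -> R).

Lemma qmeasurable_compose d1 d2 (X : measurableType d1) (Y : measurableType d2)
  (u : Y -> Qp p) (h : X -> Y) : qmeasurable (R := R) u -> measurable_fun [set: X] h ->
  qmeasurable (R := R) (u \o h).
Proof. by move=> mu_ mh k; exact: (measurableT_comp (mu_ k) mh). Qed.

(** Joint measurability in (x, y), with x as first component, prepares the use of Tonelli's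
    theorem. *)
Lemma measurable_qmatvec2 (M : T -> QpMx p n) :
  (forall i j, qmeasurable (R := R) (fun y => M y i j)) ->
  measurable_fun [set: T * T] (fun z : T * T => qmatvec R (M z.2) z.1 : T).
Proof.
move=> mM; apply: qmeasurableP; apply: qmeasurable_matvec => [i j|i].
  exact: (qmeasurable_compose (mM i j) measurable_snd).
exact: (qmeasurable_compose (qmeasurable_coord i) measurable_fst).
Qed.

Definition hausdorff_weight Phi (y : T) : R := Phi y / qnormv R y ^+ n.

Definition hausdorff_kernel A b f (z : T * T) : R :=
  \prod_(i < m) (b i z.1 - b i (qmatvec R (A i z.2) z.1)) *
  \prod_(i < m) f i (qmatvec R (A i z.2) z.1).

Lemma qHopE Phi A b f x : qHop mu Phi A b f x =
  (\int[mu]_y (hausdorff_weight Phi y * hausdorff_kernel A b f (x, y))%:E)%E.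
Proof. by apply: eq_integral => y _; rewrite /hausdorff_kernel mulrA. Qed.

Section Data.
Context (nu : nat) (Phi : T -> R) (A Ainv : 'I_m -> T -> QpMx p n).
Context (data : qp_hausdorff_data mu nu Phi A Ainv).

Lemma hausdorff_weight_ge0 y : 0 <= hausdorff_weight Phi y.
Proof.
by case: data => -[_ Phi0] _ _ _ _; rewrite divr_ge0 // exprn_ge0 // qnormv_ge0.
Qed.

Lemma measurable_hausdorff_weight : measurable_fun [set: T] (hausdorff_weight Phi).
Proof.
case: data => -[mPhi _] _ _ _ _; apply: measurable_funM => //.
exact: (measurable_radial (fun t => (t ^+ n)^-1)).
Qed.

Lemma hausdorff_qmeasurable i j k :
  qmeasurable (R := R) (fun y => A i y j k) /\ qmeasurable (R := R) (fun y => Ainv i y j k).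
Proof.
by case: data => _ mA _ _ _; split; apply: qmeasurable_comp; have [] := mA i j k.
Qed.

Lemma ae_well_conditioned :
  {ae mu, forall y, forall i, well_conditioned R nu (A i y) (Ainv i y)}.
Proof.
case: data => _ _ inv cond _; apply: filterS2 inv cond => y invy condy i.
by have [? ?] := invy i; split.
Qed.

(** |A_i(y)| is a power of the base, so being below 1 it is p^(-j) with j >= 1. *)
Lemma hausdorff_norm y i : hausdorff_weight Phi y != 0 ->
  well_conditioned R nu (A i y) (Ainv i y) ->
  exists j : nat, [/\ (0 < j)%N, qnormm R (A i y) = B ^ (- j%:Z),
    `|ln (qnormm R (A i y)) / ln B| = j%:R & B ^ j%:Z <= qnormm R (Ainv i y)].
Proof.
move=> w0 wc; case: data => _ _ _ _ /(_ y) supp.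
have Phi0 : Phi y != 0 by apply: contraNneq w0 => Phi0; rewrite /hausdorff_weight Phi0 mul0r.
have [k [Ak /andP[Kge _]]] := well_conditioned_norm n_gt0 wc.
have := supp Phi0 i; rewrite Ak -[X in _ < X](expr0z B) ltr_eXz2l ?base_gt1 // => k0.
have [s [s0 kE]] : exists s : nat, (0 < s)%N /\ k = - s%:Z.
  by exists `|k|%N; split; lia.
subst k; exists s; split=> //; last by rewrite opprK in Kge.
have lnB : 0 < ln B by rewrite ln_gt0 // base_gt1.
rewrite -invr_expz lnV ?posrE ?baseX_gt0 // -exprnP lnXn ?base_gt0 // mulNr normrN.
by rewrite -[ln B *+ _]mulr_natl mulfK ?gt_eqF // normr_nat.
Qed.

Lemma measurable_hausdorff_kernel b f :
  (forall i, measurable_fun [set: T] (b i)) -> (forall i, measurable_fun [set: T] (f i)) ->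
  measurable_fun [set: T * T] (hausdorff_kernel A b f).
Proof.
move=> mb mf.
have mA i : measurable_fun [set: T * T] (fun z : T * T => qmatvec R (A i z.2) z.1 : T).
  by apply: measurable_qmatvec2 => j k; have [] := hausdorff_qmeasurable i j k.
apply: measurable_funM; apply: measurable_prod => i _.
  apply: measurable_funB; first exact: (measurableT_comp (mb i) measurable_fst).
  exact: (measurableT_comp (mb i) (mA i)).
exact: (measurableT_comp (mf i) (mA i)).
Qed.

Lemma measurable_qHop b f :
  (forall i, measurable_fun [set: T] (b i)) -> (forall i, measurable_fun [set: T] (f i)) ->
  measurable_fun [set: T] (qHop mu Phi A b f).
Proof.
move=> mb mf.
pose F (z : T * T) := (hausdorff_weight Phi z.2 * hausdorff_kernel A b f z)%:E.
have mF : measurable_fun [set: T * T] F.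
  apply/measurable_EFinP; apply: measurable_funM; last exact: measurable_hausdorff_kernel.
  exact: (measurableT_comp measurable_hausdorff_weight measurable_snd).
(* The integrand is signed, whereas the Tonelli measurability lemma asks for nonnegative ones; it is
   applied to the positive and negative parts. *)
rewrite (_ : qHop mu Phi A b f = fun x =>
   (\int[haar_sfinite n_gt0 haar]_y (F^\+ (x, y)) - \int[haar_sfinite n_gt0 haar]_y (F^\- (x, y)))%E).
  apply: emeasurable_funB.
    apply: (@measurable_fun_fubini_tonelli_F _ _ _ _ _ (haar_sfinite n_gt0 haar) F^\+%E).
      exact: measurable_funepos.
    by move=> z; exact: funepos_ge0.
  apply: (@measurable_fun_fubini_tonelli_F _ _ _ _ _ (haar_sfinite n_gt0 haar) F^\-%E).
    exact: measurable_funeneg.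
  by move=> z; exact: funeneg_ge0.
apply/funext => x; rewrite qHopE integralE.
by congr (_ - _)%E; apply: eq_integral => y _; rewrite !(funeposE, funenegE).
Qed.

Lemma measurable_qC8_integrand (lambdas alphas : 'I_m -> R) :
  measurable_fun [set: T] (fun y => \prod_(i < m)
    (powR (qnormm R (Ainv i y)) (- ((alphas i + n%:R) * lambdas i)) *
     `|ln (qnormm R (A i y)) / ln B|)).
Proof.
apply: measurable_prod => i _; apply: measurable_funM.
  apply: (measurableT_comp (measurable_powR _)); apply: measurable_qnormm => j k.
  by have [] := hausdorff_qmeasurable i j k.
apply: measurableT_comp => //; apply: measurable_funM => //.
apply: measurableT_comp => //; apply: measurable_qnormm => j k.
by have [] := hausdorff_qmeasurable i j k.
Qed.

End Data.
End HausdorffOperator.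

Lemma choice_ex2 (S U : Type) (P Q : S -> U -> Prop) :
  (forall x, exists2 y, P x y & Q x y) -> exists f, forall x, P x (f x) /\ Q x (f x).
Proof.
move=> PQ; have /choice[f fP] x : exists y, P x y /\ Q x y.
  by have [y] := PQ x; exists y.
by exists f.
Qed.

(** * Sufficiency *)

Section Boundedness.
Context {R : realType} {p n m : nat}.
Local Notation B := ((qp_base p)%:R : R).
Local Notation T := (QpSpace R p n).
Context (mu : {measure set T -> \bar R}) (n_gt0 : (0 < n)%N) (haar : qp_haar mu).
Context (q alpha lambda : R) (qs rs alphas lambdas : 'I_m -> R).
Context (m_gt0 : (0 < m)%N) (q_ge1 : 1 <= q).
Context (qs_ge1 : forall i, 1 <= qs i) (rs_gt1 : forall i, 1 < rs i).
Context (alphas_gt : forall i, - n%:R < alphas i).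
Context (alphas_lt : forall i, alphas i < n%:R * (rs i - 1)).
Context (sum_exponents : \sum_(i < m) (qs i)^-1 + \sum_(i < m) (rs i)^-1 = q^-1).
Context (sum_weights :
  \sum_(i < m) alphas i / qs i + \sum_(i < m) alphas i / rs i = alpha / q).
Context (lambdas_lt0 : forall i, lambdas i < 0).
Context (lambda_sum : (alpha + n%:R) * lambda = \sum_(i < m) (alphas i + n%:R) * lambdas i).

Let q_gt0 : 0 < q. Proof. exact: lt_le_trans q_ge1. Qed.
Let qs_gt0 i : 0 < qs i. Proof. exact: lt_le_trans (qs_ge1 i). Qed.
Let rs_gt0 i : 0 < rs i. Proof. exact: lt_trans (rs_gt1 i). Qed.
Let an_gt0 i : 0 < alphas i + n%:R. Proof. by rewrite addrC -ltrBlDl sub0r. Qed.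

Let alpha_gt : 0 < alpha + n%:R.
Proof. exact: (weight_exponent_gt0 m_gt0 q_gt0 qs_gt0 rs_gt0 an_gt0 sum_exponents sum_weights). Qed.

(** The exponents of p^g on the two sides agree by the relation between [lambda] and the
    [lambdas i]. *)
Lemma morrey_weight_product : exists2 K : R, 0 < K & forall g,
  \prod_i powR (qw mu (alphas i) g) (lambdas i) = K * powR (qw mu alpha g) lambda.
Proof.
have qwE0 a g : 0 < a + n%:R -> qw mu a g = qw mu a 0 * powR (B ^ g) (a + n%:R).
  by move=> an; rewrite -[in LHS](add0r g) (qwD n_gt0 haar).
have k0 := qw_gt0 n_gt0 haar 0 alpha_gt.
pose P0 := \prod_i powR (qw mu (alphas i) 0) (lambdas i).
exists (P0 * powR (qw mu alpha 0) (- lambda)).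
  apply: mulr_gt0; last exact: powR_gt0.
  by apply: prodr_gt0 => i _; apply: powR_gt0; exact: (qw_gt0 n_gt0 haar).
move=> g; rewrite (qwE0 alpha g alpha_gt) powRM ?powR_ge0 ?(ltW k0) //.
transitivity (P0 * (powR (qw mu alpha 0) (- lambda) * powR (qw mu alpha 0) lambda) *
  powR (powR (B ^ g) (alpha + n%:R)) lambda); last by ring.
rewrite -powR_addr // addNr powRr0 mulr1.
rewrite -powRrM lambda_sum -prod_powR_sum ?baseX_gt0 // -big_split /=.
apply: eq_bigr => i _; rewrite (qwE0 _ g (an_gt0 i)).
have qi : 0 <= qw mu (alphas i) 0 := ltW (qw_gt0 n_gt0 haar 0 (an_gt0 i)).
by rewrite (powRM (lambdas i) qi (powR_ge0 _ _)) -powRrM.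
Qed.

Lemma hausdorff_estimate (nu : nat) : exists2 C : R, 0 < C &
  forall (Phi : T -> R) (A Ainv : 'I_m -> T -> QpMx p n) (b f : 'I_m -> T -> R)
    (N M : 'I_m -> R) (K : R) (g : int),
  qp_hausdorff_data mu nu Phi A Ainv ->
  (forall i, measurable_fun [set: T] (b i)) -> (forall i, measurable_fun [set: T] (f i)) ->
  (forall i, 0 < N i) -> (forall i, 0 < M i) -> 0 < K ->
  (forall i, qcmo_norm mu (alphas i) (rs i) (b i) <= (N i)%:E)%E ->
  (forall i, qmorrey_norm mu (alphas i) (qs i) (lambdas i) (EFin \o f i) <= (M i)%:E)%E ->
  (qC8 mu Phi A Ainv alphas lambdas <= K%:E)%E ->
  (\int[mu]_(x in qball R g) (poweR `|qHop mu Phi A b f x| q * (qwt R alpha x)%:E) <=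
   (powR (C * K * \prod_i N i * \prod_i M i) q * powR (qw mu alpha g) (1 + lambda * q))%:E)%E.
Proof.
have [Cb CbP] := choice_ex2 (fun i =>
  qcmo_difference n_gt0 haar nu (rs_gt1 i) (alphas_gt i) (alphas_lt i)).
have [Ch Ch0 ChP] := weighted_hoelder n_gt0 haar m_gt0 q_gt0 qs_gt0 rs_gt0 an_gt0
  sum_exponents sum_weights.
have [K2 K20 K2P] := morrey_weight_product.
have [Cf [Cf0 CfE]] : exists Cf : 'I_m -> R, (forall i, 0 < Cf i) /\
    (forall i, powR (@chvar_const R p n nu (alphas i)) (qs i)^-1 = Cf i).
  exists (fun i => powR (@chvar_const R p n nu (alphas i)) (qs i)^-1).
  by split=> // i; rewrite powR_gt0 // chvar_const_gt0.
have Cb0 i : 0 < Cb i by have [] := CbP i.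
(* 2 comes from Minkowski, [Cb] from the oscillation of b along A, [Cf] from the change of variables
   in the Morrey norm, [K2] from the product of ball masses and [Ch] from Hoelder. The last enters
   under a q-th root because Hoelder bounds a q-th power. *)
pose C := 2 * (\prod_i Cb i) * (\prod_i Cf i) * K2 * powR Ch q^-1.
have C0 : 0 < C by rewrite !mulr_gt0 ?powR_gt0 // prodr_gt0.
exists C => //.
move=> Phi A Ainv b f N M K g data mb mf N0 M0 K0 bN fM C8K.
have qg := qw_gt0 n_gt0 haar g alpha_gt.
have qig i := qw_gt0 n_gt0 haar g (an_gt0 i).
have mball := @measurable_qball R p n g.
pose phi := hausdorff_weight Phi.
have phi0 y : 0 <= phi y := hausdorff_weight_ge0 data y.
have mphi : measurable_fun [set: T] phi := measurable_hausdorff_weight data.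
pose P z := `|hausdorff_kernel A b f z|.
have mP : measurable_fun [set: T * T] P.
  by apply: measurableT_comp => //; exact: (measurable_hausdorff_kernel data).
(* The part of the slice norm independent of y; the other factor, [E] below, is the integrand of C_8
   without Phi(y) / |y|^n. *)
pose cg := (\prod_i (Cb i * N i)) * (\prod_i (Cf i * M i * powR (qw mu (alphas i) g) (lambdas i))).
have cg0 : 0 < cg.
  apply: mulr_gt0; apply: prodr_gt0 => i _; first exact: mulr_gt0.
  by apply: mulr_gt0; [exact: mulr_gt0|exact: powR_gt0].
pose E y := \prod_(i < m)
    (powR (qnormm R (Ainv i y)) (- ((alphas i + n%:R) * lambdas i)) *
     `|ln (qnormm R (A i y)) / ln B|).
have E0 y : 0 <= E y by apply: prodr_ge0 => i _; rewrite mulr_ge0 ?powR_ge0.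
have mE : measurable_fun [set: T] E by exact: (measurable_qC8_integrand data).
pose D y := cg * E y.
have mD : measurable_fun [set: T] D by exact: measurable_funM.
(* The indicator moves the ball into the weight, since [minkowski_integral] is stated on whole
   spaces. *)
pose w x := \1_(qball R g : set T) x * qwt R alpha x.
have mw : measurable_fun [set: T] w.
  by apply: measurable_funM; [exact: measurable_indic|exact: measurable_qwt].
have w0 x : 0 <= w x by rewrite mulr_ge0 ?qwt_ge0.
have integral_w (h : T -> \bar R) :
    (\int[mu]_x (h x * (w x)%:E) = \int[mu]_(x in qball R g) (h x * (qwt R alpha x)%:E))%E.
  rewrite [RHS]integral_mkcond; apply: eq_integral => x _.
  by rewrite patchE /w indicE; case: (x \in _); rewrite ?mul1r // mul0r mule0.
have slice : {ae mu, forall y, phi y != 0 -> 0 < D y /\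
    (\int[mu]_x (powR (P (x, y)) q * w x)%:E <= (powR (D y) q * (Ch * qw mu alpha g))%:E)%E}.
  apply: filterS (ae_well_conditioned data) => y wc phiy.
  have [j jP] := choice (fun i => hausdorff_norm n_gt0 data phiy (wc i)).
  (* Bounds for the normalized norms of b_i(x) - b_i(A_i(y) x) and f_i(A_i(y) x) on B_g. They are
     positive because j i >= 1, and this gives 0 < D y. *)
  pose U i := Cb i * (j i)%:R * N i.
  pose V i := Cf i * M i * powR (qw mu (alphas i) g) (lambdas i) *
    powR (B ^ (- (j i)%:Z)) ((alphas i + n%:R) * lambdas i).
  have U0 i : 0 < U i by have [j0 _ _ _] := jP i; rewrite !mulr_gt0 // ltr0n.
  have V0 i : 0 < V i.
    apply: mulr_gt0; last by apply: powR_gt0; exact: baseX_gt0.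
    by apply: mulr_gt0; [exact: mulr_gt0|exact: powR_gt0].
  pose u i x := `|b i x - b i (qmatvec R (A i y) x)|.
  pose v i x := `|f i (qmatvec R (A i y) x)|.
  have mAy i := measurable_qmatvec (R := R) (A i y).
  have mu_ i : measurable_fun [set: T] (u i).
    apply: measurableT_comp => //; apply: measurable_funB => //.
    exact: (measurableT_comp (mb i) (mAy i)).
  have mv i : measurable_fun [set: T] (v i).
    by apply: measurableT_comp => //; exact: (measurableT_comp (mf i) (mAy i)).
  have uU i : (\int[mu]_(x in qball R g) (powR (u i x) (rs i) * qwt R (alphas i) x)%:E <=
      (powR (U i) (rs i) * qw mu (alphas i) g)%:E)%E.
    have [j0 Aj _ _] := jP i; have [_ h] := CbP i.
    exact: (h _ _ g _ _ _ (mb i) (N0 i) (bN i) j0 (wc i) Aj).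
  have vV i : (\int[mu]_(x in qball R g) (powR (v i x) (qs i) * qwt R (alphas i) x)%:E <=
      (powR (V i) (qs i) * qw mu (alphas i) g)%:E)%E.
    have [_ Aj _ _] := jP i.
    have := qmorrey_qmatvec n_gt0 haar g (an_gt0 i) (qs_gt0 i) (ltW (M0 i)) (mf i) (fM i) (wc i) Aj.
    by rewrite CfE.
  have UV0 : 0 < \prod_i U i * \prod_i V i by rewrite mulr_gt0 // prodr_gt0.
  have UVD : \prod_i U i * \prod_i V i <= D y.
    rewrite /D /cg /E -!big_split /=; apply: ler_prod => i _.
    rewrite mulr_ge0 ?(ltW (U0 i)) ?(ltW (V0 i)) //=.
    have [j0 Aj -> Kj] := jP i.
    rewrite /U /V; set Q := powR (qw _ _ _) _.
    set s := (alphas i + n%:R) * lambdas i.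
    have s0 : 0 <= - s by rewrite oppr_ge0 nmulr_lle0 ?(ltW (an_gt0 i)).
    (* lambda_i < 0 makes the exponent [- s] nonnegative, so the bound p^j <= |A_i^-1| may be raised
       to it. *)
    have le : powR (B ^ (- (j i)%:Z)) s <= powR (qnormm R (Ainv i y)) (- s).
      have -> : powR (B ^ (- (j i)%:Z)) s = powR (B ^ (j i)%:Z) (- s).
        by rewrite -[RHS](powR_invr s (ltW (baseX_gt0 _))) invr_expz.
      by apply: ge0_ler_powR; rewrite ?nnegrE ?(ltW (baseX_gt0 _)) ?qnormm_ge0.
    have c0 : 0 <= Cb i * N i * (Cf i * M i * Q) * (j i)%:R.
      by rewrite !mulr_ge0 ?powR_ge0 // ltW.
    have := ler_wpM2l c0 le; congr (_ <= _); ring.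
  split; first exact: lt_le_trans UV0 UVD.
  have -> : (\int[mu]_x (powR (P (x, y)) q * w x)%:E =
      \int[mu]_(x in qball R g) (powR (\prod_i u i x * \prod_i v i x) q * qwt R alpha x)%:E)%E.
    under eq_integral do rewrite EFinM.
    rewrite integral_w; apply: eq_integral => x _; rewrite -EFinM.
    by rewrite /P /hausdorff_kernel normrM !normr_prod.
  apply: (le_trans (ChP u v U V g mu_ mv (fun i x => normr_ge0 _) (fun i x => normr_ge0 _)
    U0 V0 uU vV)).
  rewrite lee_fin mulrA [Ch * _]mulrC ler_wpM2r ?(ltW qg) // ler_wpM2r ?(ltW Ch0) //.
  by apply: ge0_ler_powR; rewrite ?nnegrE ?(ltW q_gt0) ?(ltW UV0) // (le_trans _ UVD) ?(ltW UV0).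
have phiD : (\int[mu]_y (phi y * D y)%:E <= (cg * K)%:E)%E.
  have -> : (\int[mu]_y (phi y * D y)%:E = cg%:E * qC8 mu Phi A Ainv alphas lambdas)%E.
    rewrite /qC8 -ge0_integralZl_EFin ?(ltW cg0) //.
    - by apply: eq_integral => y _; rewrite -EFinM /D mulrCA.
    - by move=> y _; rewrite lee_fin; apply: mulr_ge0; [exact: phi0|exact: E0].
    - by apply/measurable_EFinP; apply: measurable_funM.
  by rewrite (EFinM cg K); apply: lee_wpmul2l => //; rewrite lee_fin ltW.
have main := @minkowski_integral R _ _ _ _ (haar_sfinite n_gt0 haar) (haar_sfinite n_gt0 haar)
  q (cg * K) (Ch * qw mu alpha g) P phi D w q_ge1 (mulr_gt0 cg0 K0) _ mP mphi mD mw
  (fun=> normr_ge0 _) phi0 _ w0 slice phiD.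
apply: (@le_trans _ _ (\int[mu]_x (poweR (\int[mu]_y (phi y * P (x, y))%:E) q * (w x)%:E))%E).
  rewrite integral_w; apply: ge0_le_integral => //.
  - by move=> x _; apply: mule_ge0; [exact: poweR_ge0|rewrite lee_fin qwt_ge0].
  - apply: measurable_funTS; apply: emeasurable_funM.
      apply: (measurableT_comp (measurable_poweR q)); apply: measurableT_comp => //.
      exact: (measurable_qHop n_gt0 haar data).
    by apply/measurable_EFinP; exact: measurable_qwt.
  - apply: measurable_funTS; apply: emeasurable_funM.
      apply: (measurableT_comp (measurable_poweR q)).
      apply: (@measurable_fun_fubini_tonelli_F _ _ _ _ _ (haar_sfinite n_gt0 haar)
        (fun z => (phi z.2 * P z)%:E)).
        apply/measurable_EFinP; apply: measurable_funM => //.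
        exact: (measurableT_comp mphi measurable_snd).
      by move=> z; rewrite lee_fin mulr_ge0 ?phi0 ?normr_ge0.
    by apply/measurable_EFinP; exact: measurable_qwt.
  move=> x _; apply: lee_wpmul2r; first by rewrite lee_fin qwt_ge0.
  have I0 : (0 <= \int[mu]_y (phi y * P (x, y))%:E)%E.
    by apply: integral_ge0 => y _; rewrite lee_fin mulr_ge0 ?phi0 ?normr_ge0.
  apply: (gt0_ler_poweR (ltW q_gt0)); rewrite ?in_itv /= ?leey ?andbT //.
  rewrite qHopE; apply: (le_trans (le_abse_integral _ _ _)) => //.
    apply/measurable_EFinP; apply: measurable_funM => //.
    exact: (measurable_fun_pair2 _ (measurable_hausdorff_kernel data mb mf)).
  apply: ge0_le_integral => //.
  - apply: measurableT_comp => //; apply/measurable_EFinP; apply: measurable_funM => //.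
    exact: (measurable_fun_pair2 _ (measurable_hausdorff_kernel data mb mf)).
  - apply/measurable_EFinP; apply: measurable_funM => //.
    exact: (measurable_fun_pair2 _ mP).
  - by move=> y _; rewrite lee_fin normrM ger0_norm.
apply: (le_trans (main _ _)).
- by rewrite mulr_ge0 // ltW.
- by move=> y; rewrite mulr_ge0 // ltW.
rewrite lee_fin le_eqVlt; apply/orP; left; apply/eqP.
have NE : \prod_i (Cb i * N i) = \prod_i Cb i * \prod_i N i by rewrite big_split.
have ME : \prod_i (Cf i * M i * powR (qw mu (alphas i) g) (lambdas i)) =
    \prod_i Cf i * \prod_i M i * (K2 * powR (qw mu alpha g) lambda).
  by rewrite !big_split /= K2P.
have pos (F : 'I_m -> R) : (forall i, 0 < F i) -> 0 <= \prod_i F i.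
  by move=> F0; apply: prodr_ge0 => i _; exact: ltW.
rewrite powR_addr // (powRr1 (ltW qg)) (powRrM (qw mu alpha g)).
have -> : Ch = powR (powR Ch q^-1) q by rewrite -powRrM mulVf ?gt_eqF // powRr1 // ltW.
set Z := powR (qw mu alpha g) lambda.
transitivity (powR (2 * (cg * K) * powR Ch q^-1) q * qw mu alpha g).
  have ck0 : 0 <= cg * K by rewrite mulr_ge0 // ltW.
  have ck2 : 0 <= 2 * (cg * K) by rewrite mulr_ge0.
  by rewrite (powRM q ck2 (powR_ge0 _ _)) (powRM q (ler0n _ 2) ck0); ring.
transitivity (powR (C * K * \prod_i N i * \prod_i M i * Z) q * qw mu alpha g); last first.
  have CK0 : 0 <= C * K * \prod_i N i * \prod_i M i.
    apply: mulr_ge0; last exact: pos.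
    by apply: mulr_ge0; [apply: mulr_ge0; [rewrite ltW|rewrite ltW]|exact: pos].
  by rewrite (powRM q CK0 (powR_ge0 _ _)); ring.
have cgE : cg = \prod_i Cb i * \prod_i N i * (\prod_i Cf i * \prod_i M i * (K2 * Z)).
  by rewrite /cg NE ME.
rewrite (_ : 2 * (cg * K) * powR Ch q^-1 = C * K * \prod_i N i * \prod_i M i * Z) //.
by rewrite cgE /C; ring.
Qed.

(** The bounds with perturbed norms are polynomials in e, so the passage to e = 0 is continuity of
    polynomial evaluation. *)
Lemma lee_poly0 (X : \bar R) (P : {poly R}) :
  (forall e : R, 0 < e -> (X <= P.[e]%:E)%E) -> (X <= P.[0]%:E)%E.
Proof.
move=> XP; case: X XP => [x| |] XP; last by rewrite leNye.
  rewrite lee_fin; apply/ler_addgt0Pr => d d0.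
  have /cvgrPdist_lt/(_ d d0)/nbhs_ballP[e /= e0 He] := @continuous_horner R P 0.
  have e20 : 0 < e / 2 by rewrite divr_gt0.
  have : ball (0 : R) e (e / 2).
    by rewrite /ball /= sub0r normrN gtr0_norm // ltr_pdivrMr // ltr_pMr // ltr1n.
  move=> /He; have := XP _ e20; rewrite lee_fin distrC ltr_norml => xe /andP[_ h].
  by apply: le_trans xe _; rewrite -lerBlDl ltW.
by have := XP 1 ltr01; rewrite leNgt ltry.
Qed.

Lemma hausdorff_bounded (nu : nat) : exists C : R, 0 < C /\
  forall (Phi : T -> R) (A Ainv : 'I_m -> T -> QpMx p n),
    qp_hausdorff_data mu nu Phi A Ainv ->
    (qC8 mu Phi A Ainv alphas lambdas < +oo)%E ->
    forall b : 'I_m -> T -> R, (forall i, in_qcmo mu (alphas i) (rs i) (b i)) ->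
    forall f : 'I_m -> T -> R,
      (forall i, in_qmorrey mu (alphas i) (qs i) (lambdas i) (f i)) ->
      qlocL mu alpha q (qHop mu Phi A b f) /\
      (qmorrey_norm mu alpha q lambda (qHop mu Phi A b f) <=
        (C * fine (qC8 mu Phi A Ainv alphas lambdas) *
         \prod_(i < m) fine (qcmo_norm mu (alphas i) (rs i) (b i)) *
         \prod_(i < m) fine (qmorrey_norm mu (alphas i) (qs i) (lambdas i) (EFin \o f i)))%:E)%E.
Proof.
have [C C0 CP] := hausdorff_estimate nu; exists C; split=> // Phi A Ainv data C8fin b bP f fP.
have mb i : measurable_fun [set: T] (b i) by have [[/measurable_EFinP]] := bP i.
have mf i : measurable_fun [set: T] (f i) by have [[/measurable_EFinP]] := fP i.
have fin_le (X : \bar R) (e : R) : (0 <= X)%E -> (X < +oo)%E -> 0 < e ->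
    0 < fine X + e /\ (X <= (fine X + e)%:E)%E.
  move=> X0 Xoo e0; have f0 : 0 <= fine X by exact: fine_ge0.
  split; first by rewrite ltr_wpDl.
  by rewrite EFinD fineK ?ge0_fin_numE // leeDl // lee_fin ltW.
have C80 : (0 <= qC8 mu Phi A Ainv alphas lambdas)%E.
  apply: integral_ge0 => y _; rewrite lee_fin mulr_ge0 ?(hausdorff_weight_ge0 data) //.
  by apply: prodr_ge0 => i _; rewrite mulr_ge0 ?powR_ge0.
have b0 i : (0 <= qcmo_norm mu (alphas i) (rs i) (b i))%E.
  by apply: (le_trans _ (ereal_sup_ubound (ex_intro2 _ _ 0 I erefl))); exact: poweR_ge0.
have f0 i : (0 <= qmorrey_norm mu (alphas i) (qs i) (lambdas i) (EFin \o f i))%E.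
  by apply: (le_trans _ (ereal_sup_ubound (ex_intro2 _ _ 0 I erefl))); exact: poweR_ge0.
have est (e : R) : 0 < e -> forall g,
    (\int[mu]_(x in qball R g) (poweR `|qHop mu Phi A b f x| q * (qwt R alpha x)%:E) <=
     (powR (C * (fine (qC8 mu Phi A Ainv alphas lambdas) + e) *
       \prod_i (fine (qcmo_norm mu (alphas i) (rs i) (b i)) + e) *
       \prod_i (fine (qmorrey_norm mu (alphas i) (qs i) (lambdas i) (EFin \o f i)) + e)) q *
      powR (qw mu alpha g) (1 + lambda * q))%:E)%E.
  move=> e0 g; have [? ?] := fin_le _ e C80 C8fin e0.
  have bN i := fin_le _ e (b0 i) (bP i).2 e0.
  have fN i := fin_le _ e (f0 i) (fP i).2 e0.
  by apply: (CP Phi A Ainv) => // i; [have [] := bN i|have [] := fN i|have [] := bN i|have [] := fN i].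
split.
  split; first exact: (measurable_qHop n_gt0 haar data).
  by move=> g; apply: le_lt_trans (est 1 ltr01 g) _; rewrite ltry.
pose P : {poly R} := C%:P * ((fine (qC8 mu Phi A Ainv alphas lambdas))%:P + 'X) *
  \prod_i ((fine (qcmo_norm mu (alphas i) (rs i) (b i)))%:P + 'X) *
  \prod_i ((fine (qmorrey_norm mu (alphas i) (qs i) (lambdas i) (EFin \o f i)))%:P + 'X).
have PE e : P.[e] = C * (fine (qC8 mu Phi A Ainv alphas lambdas) + e) *
       \prod_i (fine (qcmo_norm mu (alphas i) (rs i) (b i)) + e) *
       \prod_i (fine (qmorrey_norm mu (alphas i) (qs i) (lambdas i) (EFin \o f i)) + e).
  rewrite !hornerM hornerC !horner_prod hornerD hornerC hornerX.
  by congr (_ * _ * _); apply: eq_bigr => i _; rewrite hornerD hornerC hornerX.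
have := @lee_poly0 (qmorrey_norm mu alpha q lambda (qHop mu Phi A b f)) P.
rewrite PE addr0; under eq_bigr do rewrite addr0; under [X in _ * X]eq_bigr do rewrite addr0.
apply=> e e0; rewrite PE; apply: (qmorrey_norm_bound n_gt0 haar alpha_gt q_gt0 _ (est e e0)).
have ge0 (X : \bar R) : (0 <= X)%E -> 0 <= fine X + e by move=> X0; rewrite addr_ge0 ?fine_ge0 // ltW.
rewrite !mulr_ge0 ?ge0 ?(ltW C0) //; apply: prodr_ge0 => i _; exact: ge0.
Qed.

End Boundedness.

(** * Test functions and necessity *)

Section TestFunctions.
Context {R : realType} {p n : nat}.
Local Notation B := ((qp_base p)%:R : R).
Local Notation T := (QpSpace R p n).
Context (mu : {measure set T -> \bar R}) (n_gt0 : (0 < n)%N) (haar : qp_haar mu).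
Implicit Types (x : T) (g : int) (alpha : R).

Definition qpower (s : R) (x : T) : R := powR (qnormv R x) s.

(** Over B_g the integral of f^q against the weight is a constant times the mass of B_g to the power
    1 + lambda q, so one bound [L] serves all balls. Convergence at the origin is the condition 1 +
    lambda q > 0. *)
Lemma in_qmorrey_qpower alpha q lambda : 0 < alpha + n%:R -> 0 < q -> - q^-1 < lambda ->
  in_qmorrey mu alpha q lambda (qpower ((alpha + n%:R) * lambda)).
Proof.
move=> an q0 lambda_gt.
have lq : 0 < 1 + lambda * q.
  by rewrite addrC -ltrBlDr sub0r -ltr_pdivrMr // mulN1r.
pose s := (alpha + n%:R) * lambda * q + alpha.
have sE : s + n%:R = (alpha + n%:R) * (1 + lambda * q) by rewrite /s; ring.
have sn : 0 < s + n%:R by rewrite sE mulr_gt0.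
have [c c0 cE] := integral_power n_gt0 haar sn.
have mf : measurable_fun [set: T] (qpower ((alpha + n%:R) * lambda)).
  exact: (measurable_radial (fun t => powR t ((alpha + n%:R) * lambda))).
have Ile g : (\int[mu]_(x in qball R g)
      (poweR `|(EFin \o qpower ((alpha + n%:R) * lambda)) x| q * (qwt R alpha x)%:E) <=
    (c * powR (B ^ g) (s + n%:R))%:E)%E.
  rewrite -cE; apply: ae_ge0_le_integral.
  - exact: measurable_qball.
  - by move=> x _; apply: mule_ge0; [exact: poweR_ge0|rewrite lee_fin qwt_ge0].
  - apply: measurable_funTS; apply: emeasurable_funM.
      apply: (measurableT_comp (measurable_poweR q)); apply: measurableT_comp => //.
      exact/measurable_EFinP.
    by apply/measurable_EFinP; exact: measurable_qwt.
  - by move=> x _; rewrite lee_fin powR_ge0.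
  - apply: measurable_funTS; apply/measurable_EFinP.
    exact: (measurable_radial (fun t => powR t s)).
  apply: filterS (ae_neq_qv0 n_gt0 haar) => x x0 _ /=.
  have xg := qnormv_gt0 (R := R) x0.
  by rewrite -EFinM lee_fin ger0_norm ?powR_ge0 // /qpower /qwt -powRrM -powR_addr.
pose L := powR (c * powR (qw mu alpha 0) (- (1 + lambda * q))) q^-1.
split.
  split; first exact/measurable_EFinP.
  by move=> g; apply: le_lt_trans (Ile g) (ltry _).
apply: le_lt_trans (ltry L); apply: (qmorrey_norm_bound n_gt0 haar an q0 (powR_ge0 _ _)) => g.
apply: le_trans (Ile g) _; rewrite lee_fin le_eqVlt; apply/orP; left; apply/eqP.
have k0 := qw_gt0 n_gt0 haar 0 an; have c0' := ltW c0.
rewrite /L -powRrM mulVf ?gt_eqF // powRr1 ?mulr_ge0 ?powR_ge0 //.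
rewrite -[qw mu alpha g](congr1 (qw mu alpha) (add0r g)) (qwD n_gt0 haar) //.
rewrite powRM ?powR_ge0 ?(ltW k0) // -powRrM -sE mulrA -[c * _ * _]mulrA -powR_addr //.
by rewrite addNr powRr0 mulr1.
Qed.

Definition qlog (x : T) : R := ln (qnormv R x) / ln B.

Lemma measurable_qlog : measurable_fun [set: T] qlog.
Proof. exact: (measurable_radial (fun t => ln t / ln B)). Qed.

(* [-ln t <= t^(-d) / d] makes the logarithm integrable against a smaller power. *)
Lemma integral_qlog_ball0 alpha r : 0 < alpha + n%:R -> 0 < r -> exists2 I : R, 0 <= I &
  (\int[mu]_(x in qball R 0) (powR `|qlog x| r * qwt R alpha x)%:E)%E = I%:E.
Proof.
(* Half of alpha + n is sacrificed, which keeps alpha - e above -n; with d = e / r, the r-th power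
   of |x|^(-d) costs exactly |x|^(-e). *)
move=> an r0; pose e := (alpha + n%:R) / 2; pose d := e / r.
have e0 : 0 < e by rewrite divr_gt0.
have d0 : 0 < d by rewrite divr_gt0.
have lnB : 0 < ln B by rewrite ln_gt0 // base_gt1.
have sn : 0 < (alpha - e) + n%:R.
  by rewrite (_ : _ + _ = e) // /e; field.
have [c c0 cE] := integral_power n_gt0 haar sn.
pose a := powR (d^-1 / ln B) r.
have I0 : (0 <= \int[mu]_(x in qball R 0) (powR `|qlog x| r * qwt R alpha x)%:E)%E.
  by apply: integral_ge0 => x _; rewrite lee_fin mulr_ge0 ?powR_ge0 ?qwt_ge0.
have Ile : (\int[mu]_(x in qball R 0) (powR `|qlog x| r * qwt R alpha x)%:E <=
    (a * (c * powR (B ^ 0) (alpha - e + n%:R)))%:E)%E.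
  rewrite (EFinM a) -(cE 0) -ge0_integralZl_EFin ?powR_ge0 //; last 3 first.
  - exact: measurable_qball.
  - by move=> x _; rewrite lee_fin powR_ge0.
  - apply: measurable_funTS; apply/measurable_EFinP.
    exact: (measurable_radial (fun t => powR t (alpha - e))).
  apply: ae_ge0_le_integral.
  - exact: measurable_qball.
  - by move=> x _; rewrite lee_fin mulr_ge0 ?powR_ge0 ?qwt_ge0.
  - apply: measurable_funTS; apply/measurable_EFinP.
    exact: (measurable_radial (fun t => powR `|ln t / ln B| r * powR t alpha)).
  - by move=> x _; rewrite -EFinM lee_fin mulr_ge0 ?powR_ge0.
  - apply: measurable_funTS; apply: measurable_funeM; apply/measurable_EFinP.
    exact: (measurable_radial (fun t => powR t (alpha - e))).
  apply: filterS (ae_neq_qv0 n_gt0 haar) => x x0 x1.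
  have xg := qnormv_gt0 (R := R) x0; rewrite /qball /= expr0z in x1.
  rewrite -EFinM lee_fin /qwt /qlog.
  set t := qnormv R x in xg x1 *.
  (* This is ln (1 + u) <= u at u = t^(-d) - 1; ln t is nonpositive on the unit ball. *)
  have lnt : `|ln t| <= d^-1 * powR t (- d).
    rewrite ler0_norm ?ln_le0 // -ler_pdivrMl ?invr_gt0 // invrK.
    have tp : 0 < powR t (- d) by exact: powR_gt0.
    have h : ln (1 + (powR t (- d) - 1)) <= powR t (- d) - 1 by apply: le_ln1Dx; lra.
    move: h; rewrite [1 + _]addrC subrK ln_powR mulNr mulrN => h.
    by apply: le_trans h _; rewrite gerBl.
  rewrite powR_addr // [leRHS]mulrCA [leLHS]mulrC ler_wpM2l ?powR_ge0 //.
  have -> : a * powR t (- e) = powR (d^-1 / ln B * powR t (- d)) r.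
    rewrite powRM ?powR_ge0 ?mulr_ge0 ?invr_ge0 ?(ltW d0) ?(ltW lnB) // -powRrM /a.
    by congr (_ * powR _ _); rewrite /d mulNr divfK // gt_eqF.
  apply: ge0_ler_powR; rewrite ?nnegrE ?(ltW r0) ?mulr_ge0 ?powR_ge0 ?invr_ge0 ?(ltW d0) ?(ltW lnB) //.
  rewrite normrM [`|_^-1|]gtr0_norm ?invr_gt0 // mulrAC ler_wpM2r // invr_ge0 ltW //.
exists (fine (\int[mu]_(x in qball R 0) (powR `|qlog x| r * qwt R alpha x)%:E)%E).
  exact: fine_ge0.
by rewrite fineK // ge0_fin_numE // (le_lt_trans Ile) // ltry.
Qed.

(** On the sphere of radius p^(g-k), log_p |x| - g takes the value that log_p has on the sphere of
    radius p^(-k), so the oscillation around [g] is the same for all balls. *)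
Lemma integral_qlog alpha r : 0 < alpha + n%:R -> 0 < r -> exists2 I : R, 0 <= I & forall g,
  (\int[mu]_(x in qball R g) (powR `|qlog x - g%:~R| r * qwt R alpha x)%:E)%E =
  (I * qw mu alpha g)%:E.
Proof.
move=> an r0; have [I0 I0ge I0E] := integral_qlog_ball0 an r0.
have k0 := qw_gt0 n_gt0 haar 0 an.
exists (I0 / qw mu alpha 0) => [|g]; first by rewrite divr_ge0 // ltW.
pose h t := (powR `|ln t / ln B - g%:~R| r * powR t alpha)%:E.
pose h' t := (powR `|ln t / ln B| r * powR t alpha)%:E.
have lnB : 0 < ln B by rewrite ln_gt0 // base_gt1.
have lnE k : ln (B ^ k) / ln B = k%:~R.
  by rewrite -powR_intmul ?(ltW base_gt0) // ln_powR mulfK // gt_eqF.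
have := @integral_radial_scale R p n mu n_gt0 haar h h' (powR (B ^ g) alpha) g.
rewrite /h /h' => -> => [|t|t|k]; last 3 first.
- by rewrite lee_fin mulr_ge0 ?powR_ge0.
- by rewrite lee_fin mulr_ge0 ?powR_ge0.
- rewrite -EFinM !lnE baseXD powRM ?(ltW (baseX_gt0 _)) // intrD addrAC subrr add0r.
  by congr EFin; ring.
rewrite I0E -EFinM; congr EFin.
rewrite -[in qw mu alpha g](add0r g) (qwD n_gt0 haar) // powR_addr ?baseX_gt0 // powR_baseX.
by field; rewrite gt_eqF.
Qed.

Lemma qlog_oscillation alpha r : 0 < alpha + n%:R -> 0 < r -> exists2 I : R, 0 <= I &
  forall g c, (\int[mu]_(x in qball R g) (powR `|qlog x - c| r * qwt R alpha x)%:E <=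
    (powR 3 r * (I + powR `|g%:~R - c| r) * qw mu alpha g)%:E)%E.
Proof.
move=> an r0; have [I I0 IE] := integral_qlog an r0; exists I => // g c.
have mball := @measurable_qball R p n g.
have ml c' : measurable_fun (qball R g : set T) (fun x => (powR `|qlog x - c'| r * qwt R alpha x)%:E).
  apply: measurable_funTS; apply/measurable_EFinP.
  exact: (measurable_radial (fun t => powR `|ln t / ln B - c'| r * powR t alpha)).
have mw : measurable_fun (qball R g : set T) (fun x => (qwt R alpha x)%:E).
  by apply: measurable_funTS; apply/measurable_EFinP; exact: measurable_qwt.
pose k := powR `|g%:~R - c| r.
apply: (@le_trans _ _ (\int[mu]_(x in qball R g) ((powR 3 r)%:E *
    ((powR `|qlog x - g%:~R| r * qwt R alpha x)%:E + k%:E * (qwt R alpha x)%:E)))%E).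
  apply: ge0_le_integral => //.
  - by move=> x _; rewrite lee_fin mulr_ge0 ?powR_ge0 ?qwt_ge0.
  - by apply: measurable_funeM; apply: emeasurable_funD => //; exact: measurable_funeM.
  move=> x _; rewrite -[(k%:E * _)%E]EFinM -EFinD -EFinM lee_fin -mulrDl mulrA ler_wpM2r ?qwt_ge0 //.
  (* Applied with third summand 0, whose r-th power is 0 because r > 0. *)
  have := powR_add3_le r0 (normr_ge0 (qlog x - g%:~R)) (normr_ge0 (g%:~R - c)) (lexx 0).
  rewrite addr0 (powR0 (negbT (gt_eqF r0))) addr0; apply: le_trans.
  by apply: ge0_ler_powR; rewrite ?nnegrE ?(ltW r0) ?addr_ge0 // ler_distD.
rewrite ge0_integralZl_EFin ?powR_ge0 //; last 2 first.
- by move=> x _; rewrite -[(k%:E * _)%E]EFinM -EFinD lee_fin addr_ge0 ?mulr_ge0 ?powR_ge0 ?qwt_ge0.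
- by apply: emeasurable_funD => //; exact: measurable_funeM.
rewrite ge0_integralD //; last 3 first.
- by move=> x _; rewrite lee_fin mulr_ge0 ?powR_ge0 ?qwt_ge0.
- by move=> x _; rewrite -EFinM lee_fin mulr_ge0 ?powR_ge0 ?qwt_ge0.
- exact: measurable_funeM.
rewrite IE ge0_integralZl_EFin ?powR_ge0 // => [|x _]; last by rewrite lee_fin qwt_ge0.
rewrite -/(qwmeas mu alpha (qball R g)) (qwE n_gt0 haar) // -[(k%:E * _)%E]EFinM -EFinD -EFinM lee_fin.
by rewrite -mulrDl mulrA.
Qed.

(** Oscillation is known around [g], while the norm refers to the unweighted mean; [integral_qlog]
    with weight exponent 0 and power 1 keeps this mean within a fixed distance of [g]. *)
Lemma in_qcmo_qlog alpha r : 1 < r -> 0 < alpha + n%:R -> in_qcmo mu alpha r qlog.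
Proof.
move=> r1 an; have r0 := lt_trans ltr01 r1.
have [I I0 IP] := qlog_oscillation an r0.
split.
  split; first by apply/measurable_EFinP; exact: measurable_qlog.
  move=> g; apply: le_lt_trans (ltry (powR 3 r * (I + powR `|g%:~R - 0| r) * qw mu alpha g)).
  apply: le_trans (IP g 0); rewrite le_eqVlt; apply/orP; left; apply/eqP.
  by apply: eq_integral => x _; rewrite subr0.
have n0 : 0 < 0 + n%:R :> R by rewrite add0r ltr0n.
have [J J0 JE] := integral_qlog n0 ltr01.
have mean g : `|qmean mu qlog g - g%:~R| <= J * qw mu 0 0.
  have h : (\int[mu]_(x in qball R g) `|qlog x - g%:~R|%:E <= (J * qw mu 0 g)%:E)%E.
    rewrite -JE le_eqVlt; apply/orP; left; apply/eqP; apply: eq_integral => x _.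
    by rewrite /qwt powRr0 mulr1 powRr1.
  have := qmean_sub_le haar measurable_qlog h.
  rewrite -[in qw mu 0 g](add0r g) (qwD n_gt0 haar) // add0r powR_baseX.
  by rewrite mulrA mulfK // baseX_neq0.
pose L := powR (powR 3 r * (I + powR (J * qw mu 0 0) r)) r^-1.
apply: le_lt_trans (ltry L); apply: ge_ereal_sup => _ [g _ <-].
rewrite /L -poweR_EFin; have qg := qw_gt0 n_gt0 haar g an.
have X0 : (0 <= \int[mu]_(x in qball R g) (powR `|qlog x - qmean mu qlog g| r * qwt R alpha x)%:E)%E.
  by apply: integral_ge0 => x _; rewrite lee_fin mulr_ge0 ?powR_ge0 ?qwt_ge0.
have Jq : 0 <= J * qw mu 0 0 by apply: mulr_ge0 => //; exact: ltW (qw_gt0 n_gt0 haar 0 n0).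
apply: gt0_ler_poweR; rewrite ?in_itv /= ?leey ?andbT ?invr_ge0 ?(ltW r0) //.
- by apply: mule_ge0 => //; rewrite lee_fin invr_ge0 ltW.
- by rewrite lee_fin mulr_ge0 ?addr_ge0 ?powR_ge0.
rewrite fine_qwmeas lee_pdivrMl // -EFinM; apply: le_trans (IP g _) _.
rewrite lee_fin [leRHS]mulrC ler_wpM2r ?(ltW qg) // ler_wpM2l ?powR_ge0 // lerD2l.
apply: ge0_ler_powR; rewrite ?nnegrE ?(ltW r0) // distrC; exact: mean.
Qed.

End TestFunctions.

(** * Necessity *)

Section Necessity.
Context {R : realType} {p n m : nat}.
Local Notation B := ((qp_base p)%:R : R).
Local Notation T := (QpSpace R p n).
Context (mu : {measure set T -> \bar R}) (n_gt0 : (0 < n)%N) (haar : qp_haar mu).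
Context (nu : nat) (Phi : T -> R) (A Ainv : 'I_m -> T -> QpMx p n).
Context (data : qp_hausdorff_data mu nu Phi A Ainv).
Context (s : 'I_m -> R) (s_lt0 : forall i, s i < 0).

Let b : 'I_m -> T -> R := fun=> qlog.
Let f : 'I_m -> T -> R := fun i => qpower (s i).
Let phi := hausdorff_weight Phi.
Let E (y : T) := \prod_(i < m) (powR (qnormm R (Ainv i y)) (- s i) * `|ln (qnormm R (A i y)) / ln B|).
Let c (x : T) := \prod_(i < m) (powR B (nu%:R * s i) * powR (qnormv R x) (s i)).

(** From |A x| <= p^(-j) |x| the logarithm drops by at least j. With |A^-1| <= p^(nu + j) this also
    gives |A x| <= p^nu |x| / |A^-1|, reversed by the negative exponent [s i]. *)
Let test_factor i y x : x <> qv0 -> phi y != 0 -> well_conditioned R nu (A i y) (Ainv i y) ->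
  `|ln (qnormm R (A i y)) / ln B| <= b i x - b i (qmatvec R (A i y) x) /\
  powR B (nu%:R * s i) * powR (qnormv R x) (s i) * powR (qnormm R (Ainv i y)) (- s i) <=
    f i (qmatvec R (A i y) x).
Proof.
move=> x0 phiy wc.
have [j [j0 Aj -> _]] := hausdorff_norm n_gt0 data phiy wc.
have [k [Ak /andP[Kge Kle]]] := well_conditioned_norm n_gt0 wc.
have kj : k = - j%:Z.
  by apply: (ieexprIz (@base_gt0 R p)); rewrite ?gt_eqF ?base_gt1 // -Ak -Aj.
subst k; rewrite opprK in Kge Kle.
have Ax0 := qmatvec_neq0 wc x0.
have xg := qnormv_gt0 (R := R) x0; have Axg := qnormv_gt0 (R := R) Ax0.
have lnB : 0 < ln B by rewrite ln_gt0 // base_gt1.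
have Kg : 0 < qnormm R (Ainv i y) by apply: lt_le_trans Kge; exact: baseX_gt0.
have Axle : qnormv R (qmatvec R (A i y) x) <= B ^ (- j%:Z) * qnormv R x.
  by rewrite -Aj qnormv_matvec.
split.
  rewrite /b /qlog -mulrBl ler_pdivlMr // lerBrDr -lerBrDl.
  have := Axle; rewrite -ler_ln ?posrE ?mulr_gt0 ?baseX_gt0 // lnM ?posrE ?baseX_gt0 //.
  rewrite -invr_expz lnV ?posrE ?baseX_gt0 // -exprnP lnXn ?base_gt0 // -[ln B *+ _]mulr_natl.
  by lra.
rewrite /f /qpower.
have AxB : qnormv R (qmatvec R (A i y) x) <= B ^ nu%:Z * qnormv R x * (qnormm R (Ainv i y))^-1.
  apply: le_trans Axle _; rewrite mulrAC ler_wpM2r ?(ltW xg) //.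
  by rewrite ler_pdivlMr // mulrC -ler_pdivlMr ?baseX_gt0 // invr_expz opprK -baseXD.
have -> : powR B (nu%:R * s i) * powR (qnormv R x) (s i) * powR (qnormm R (Ainv i y)) (- s i) =
    powR (B ^ nu%:Z * qnormv R x * (qnormm R (Ainv i y))^-1) (s i).
  rewrite !powRM ?mulr_ge0 ?invr_ge0 ?(ltW (baseX_gt0 _)) ?(ltW xg) ?(ltW Kg) //.
  by rewrite powR_invr ?(ltW Kg) // -powR_intmul ?(ltW base_gt0) // -powRrM -pmulrn.
rewrite -[s i]opprK ![powR _ (- - s i)]powRN lef_pV2 ?posrE ?powR_gt0 ?mulr_gt0 ?invr_gt0 ?baseX_gt0 //.
apply: ge0_ler_powR; rewrite ?nnegrE ?oppr_ge0 ?(ltW (s_lt0 i)) ?(ltW Axg) //.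
by rewrite !mulr_ge0 ?invr_ge0 ?(ltW (baseX_gt0 _)) ?(ltW xg) ?(ltW Kg).
Qed.

Let test_kernel x : x <> qv0 -> {ae mu, forall y,
  c x * (phi y * E y) <= phi y * hausdorff_kernel A b f (x, y)}.
Proof.
move=> x0; apply: filterS (ae_well_conditioned data) => y wc.
have [->|phiy] := eqVneq (phi y) 0; first by rewrite !mul0r mulr0.
rewrite mulrCA ler_wpM2l ?(hausdorff_weight_ge0 data) //.
rewrite /hausdorff_kernel /c /E -!big_split /=; apply: ler_prod => i _.
rewrite !mulr_ge0 ?powR_ge0 //=.
have [h1 h2] := test_factor x0 phiy (wc i).
rewrite mulrA [leRHS]mulrC; apply: ler_pM => //.
by rewrite !mulr_ge0 ?powR_ge0.
Qed.

(** If the integral were infinite, the image of the test functions would be +oo off the origin,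
    against local integrability on the unit ball, which has mass 1. *)
Lemma qC8_finite (q alpha : R) : 0 < q -> qlocL mu alpha q (qHop mu Phi A b f) ->
  (\int[mu]_y (phi y * E y)%:E < +oo)%E.
Proof.
move=> q0 [mH Hloc]; rewrite ltNge leye_eq; apply/negP => /eqP Eoo.
have mb i : measurable_fun [set: T] (b i) by exact: measurable_qlog.
have mf i : measurable_fun [set: T] (f i).
  exact: (measurable_radial (fun t => powR t (s i))).
have mphi : measurable_fun [set: T] phi := measurable_hausdorff_weight data.
have mker x : measurable_fun [set: T] (fun y => hausdorff_kernel A b f (x, y)).
  exact: (measurable_fun_pair2 _ (measurable_hausdorff_kernel data mb mf)).
have mE : measurable_fun [set: T] E.
  apply: measurable_prod => i _; apply: measurable_funM.
    apply: (measurableT_comp (measurable_powR _)); apply: measurable_qnormm => j k.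
    by have [] := hausdorff_qmeasurable data i j k.
  apply: measurableT_comp => //; apply: measurable_funM => //.
  apply: measurableT_comp => //; apply: measurable_qnormm => j k.
  by have [] := hausdorff_qmeasurable data i j k.
have E0 y : 0 <= E y by apply: prodr_ge0 => i _; rewrite mulr_ge0 ?powR_ge0.
have phi0 y : 0 <= phi y := hausdorff_weight_ge0 data y.
have Hoo x : x <> qv0 -> qHop mu Phi A b f x = +oo%E.
  move=> x0; have xg := qnormv_gt0 (R := R) x0.
  have cx : 0 < c x by rewrite prodr_gt0 // => i _; rewrite mulr_gt0 ?powR_gt0 // base_gt0.
  have ker := test_kernel x0.
  (* The integrand is known to be nonnegative only for almost every y; the absolute value makes it
     so everywhere, and the lower bound can be integrated. *)
  rewrite qHopE -/phi (ae_eq_integral (fun y => `|phi y * hausdorff_kernel A b f (x, y)|%:E)) //.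
  - apply/eqP; rewrite -leye_eq -[leLHS](@gt0_muley _ (c x)%:E) ?lte_fin // -Eoo.
    rewrite -ge0_integralZl_EFin ?(ltW cx) //.
    + apply: ae_ge0_le_integral => //.
      * by move=> y _; rewrite -EFinM lee_fin; apply: mulr_ge0; [exact: ltW|exact: mulr_ge0].
      * by apply: measurable_funeM; apply/measurable_EFinP; exact: measurable_funM.
      * apply/measurable_EFinP; apply: measurableT_comp => //; exact: measurable_funM.
      apply: filterS ker => y h _; rewrite -EFinM lee_fin.
      exact: le_trans h (ler_norm _).
    + by move=> y _; rewrite lee_fin; exact: mulr_ge0.
    + by apply/measurable_EFinP; exact: measurable_funM.
  - by apply/measurable_EFinP; exact: measurable_funM.
  - by apply/measurable_EFinP; apply: measurableT_comp => //; exact: measurable_funM.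
  apply: filterS ker => y h _; rewrite ger0_norm //.
  by apply: le_trans h; apply: mulr_ge0; [exact: ltW|exact: mulr_ge0].
have mball := @measurable_qball R p n 0.
have := Hloc 0; apply/negP; rewrite -leNgt.
apply: (@le_trans _ _ (\int[mu]_(x in qball R 0) cst +oo%E x)%E).
  by rewrite integral_cst // haar.1 mule1.
apply: ae_ge0_le_integral => //.
- by move=> x _; rewrite /cst leey.
- by move=> x _; apply: mule_ge0; [exact: poweR_ge0|rewrite lee_fin qwt_ge0].
- apply: measurable_funTS; apply: emeasurable_funM.
    by apply: (measurableT_comp (measurable_poweR q)); exact: measurableT_comp.
  by apply/measurable_EFinP; exact: measurable_qwt.
apply: filterS (ae_neq_qv0 n_gt0 haar) => x x0 _.
rewrite Hoo //= gt_eqF // gt0_mulye // lte_fin.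
by rewrite powR_gt0 // qnormv_gt0.
Qed.

End Necessity.

Theorem theorem4p6 (R : realType) (p n m : nat) (q alpha lambda : R)
    (qs rs alphas lambdas : 'I_m -> R) :
  prime p -> (0 < n)%N -> (0 < m)%N ->
  1 <= q -> (forall i, 1 <= qs i) -> (forall i, 1 < rs i) ->
  (forall i, - n%:R < alphas i < n%:R * rs i / rconj (rs i)) ->
  \sum_(i < m) (qs i)^-1 + \sum_(i < m) (rs i)^-1 = q^-1 ->
  \sum_(i < m) alphas i / qs i + \sum_(i < m) alphas i / rs i = alpha / q ->
  (forall i, - (qs i)^-1 < lambdas i < 0) ->
  (alpha + n%:R) * lambda = \sum_(i < m) (alphas i + n%:R) * lambdas i ->
  forall mu : {measure set (QpSpace R p n) -> \bar R}, qp_haar mu ->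
  (* (i) *)
  (forall nu : nat, exists C : R, 0 < C /\
    forall (Phi : QpSpace R p n -> R) (A Ainv : 'I_m -> QpSpace R p n -> QpMx p n),
      qp_hausdorff_data mu nu Phi A Ainv ->
      (qC8 mu Phi A Ainv alphas lambdas < +oo)%E ->
      forall b : 'I_m -> QpSpace R p n -> R,
        (forall i, in_qcmo mu (alphas i) (rs i) (b i)) ->
        forall f : 'I_m -> QpSpace R p n -> R,
          (forall i, in_qmorrey mu (alphas i) (qs i) (lambdas i) (f i)) ->
          qlocL mu alpha q (qHop mu Phi A b f) /\
          (qmorrey_norm mu alpha q lambda (qHop mu Phi A b f) <=
             (C * fine (qC8 mu Phi A Ainv alphas lambdas) *
              \prod_(i < m) fine (qcmo_norm mu (alphas i) (rs i) (b i)) *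
              \prod_(i < m) fine (qmorrey_norm mu (alphas i) (qs i) (lambdas i)
                                   (EFin \o f i)))%:E)%E)
  /\
  (* (ii) *)
  (forall (nu : nat) (Phi : QpSpace R p n -> R)
      (A Ainv : 'I_m -> QpSpace R p n -> QpMx p n),
      qp_hausdorff_data mu nu Phi A Ainv ->
      (forall b : 'I_m -> QpSpace R p n -> R,
        (forall i, in_qcmo mu (alphas i) (rs i) (b i)) ->
        exists K : R, forall f : 'I_m -> QpSpace R p n -> R,
          (forall i, in_qmorrey mu (alphas i) (qs i) (lambdas i) (f i)) ->
          qlocL mu alpha q (qHop mu Phi A b f) /\
          (qmorrey_norm mu alpha q lambda (qHop mu Phi A b f) <=
             (K * \prod_(i < m) fine (qmorrey_norm mu (alphas i) (qs i) (lambdas i)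
                                        (EFin \o f i)))%:E)%E) ->
      (qC8 mu Phi A Ainv alphas lambdas < +oo)%E).
Proof.
move=> _ n0 m0 q1 qs1 rs1 alphas_bd sume sumw lambdas_bd lsum mu haar.
have alphas_gt i : - n%:R < alphas i by have /andP[] := alphas_bd i.
(* With r' = r / (r - 1), the bound n r / r' is n (r - 1). *)
have alphas_lt i : alphas i < n%:R * (rs i - 1).
  have /andP[_] := alphas_bd i; have ri := lt_trans ltr01 (rs1 i).
  rewrite (_ : n%:R * (rs i - 1) = n%:R * rs i / rconj (rs i)) // /rconj.
  by field; rewrite !gt_eqF // subr_gt0.
have lambdas_lt0 i : lambdas i < 0 by have /andP[] := lambdas_bd i.
split=> [nu|nu Phi A Ainv data bounded].
  exact: (hausdorff_bounded n0 haar m0 q1 qs1 rs1 alphas_gt alphas_lt sume sumw lambdas_lt0 lsum nu).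
have an i : 0 < alphas i + n%:R by rewrite addrC -ltrBlDl sub0r.
have q0 : 0 < q by exact: lt_le_trans q1.
pose s i := (alphas i + n%:R) * lambdas i.
have s0 i : s i < 0 by rewrite pmulr_rlt0.
have [K KP] := bounded (fun=> qlog) (fun i => in_qcmo_qlog n0 haar (rs1 i) (an i)).
have fP i : in_qmorrey mu (alphas i) (qs i) (lambdas i) (qpower (s i)).
  apply: in_qmorrey_qpower => //; first exact: lt_le_trans (qs1 i).
  by have /andP[] := lambdas_bd i.
(* Boundedness at the test functions yields local q-integrability of the image, which is the input
   of [qC8_finite]. *)
have [Hloc _] := KP _ fP.
exact: (qC8_finite n0 haar data s0 q0 Hloc).
Qed.
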